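(* Let $X$ be a reflexive Banach space with $1$-symmetric basis. A closed subspace $Y$ of $V_X^0$ has the point of continuity property (PCP) if and only if $(\overline{Y}^{w^{*}}\setminus Y)\cap C[0,1]=\emptyset$.
   Context: $X$ is a (infinite-dimensional, real) reflexive Banach space with a $1$-symmetric basis $(e_n)_n$, i.e. $\|\sum_n \epsilon_n a_n e_{\pi(n)}\|_X=\|\sum_n a_n e_n\|_X$ for all finitely supported real $(a_n)$, signs $\epsilon_n$ and permutations $\pi$ of $\mathbb{N}$. For $f:[0,1]\to\mathbb{R}$ and a partition $\mathcal{P}=\{0=t_0<\dots<t_n=1\}$ put $\alpha_X(f,\mathcal{P})=\|\sum_{i=0}^{n-1}(f(t_{i+1})-f(t_i))e_i\|_X$ (with $e_0,\dots,e_{n-1}$ any $n$ distinct basis vectors) and $\delta(\mathcal{P})=\max_i(t_{i+1}-t_i)$. Let $\|f\|_{V_X}=\sup_{\mathcal{P}}\alpha_X(f,\mathcal{P})$, $V_X=\{f:[0,1]\to\mathbb{R}: f(0)=0,\ \|f\|_{V_X}<\infty\}$ and $V_X^0=\{f\in V_X:\lim_{\varepsilon\to0}\sup\{\alpha_X(f,\mathcal{P}):\delta(\mathcal{P})\le\varepsilon\}=0\}$, Banach spaces with norm $\|\cdot\|_{V_X}$; $V_X^0\subset C[0,1]$. The bidual $(V_X^0)^{**}$ is identified isometrically with $V_X$: $F\in(V_X^0)^{**}$ corresponds to the function $t\mapsto F(\delta_t)$, where $\delta_t\in(V_X^0)^*$ is evaluation at $t\in[0,1]$. For $Y\subset V_X^0$,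 $\overline{Y}^{w^*}\subset V_X$ is the closure of $Y$ in the weak$^*$ topology $\sigma((V_X^0)^{**},(V_X^0)^{*})$. A bounded subset $W$ of a Banach space has PCP if for every nonempty weakly closed subset $A$ of $W$ and every $\varepsilon>0$ there exists a nonempty relatively weakly open subset $U$ of $A$ with $\mathrm{diam}(U)<\varepsilon$; a Banach space has PCP if its closed unit ball has PCP. *)

(* Defs.v *)
From HB Require Import structures.
From mathcomp Require Import all_boot all_order all_algebra.
From mathcomp Require Import all_classical all_reals all_analysis.

Set Implicit Arguments.
Unset Strict Implicit.
Unset Printing Implicit Defensive.
Import Order.TTheory GRing.Theory Num.Theory.
Import numFieldNormedType.Exports.

Local Open Scope classical_set_scope.
Local Open Scope ring_scope.

Section Dual.
Context (R : realType) (E : normedModType R).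

Definition dual_pred : {pred (E -> R)} :=
  [pred f : E -> R | `[< scalar f /\ continuous f >]].

Lemma dual_pred_submod_closed : submod_closed dual_pred.
Proof.
split; first by apply/asboolP; split => [k x y|x];
  [rewrite /= mulr0 addr0|exact: cvg_cst].
move=> k f g /asboolP[lf cf] /asboolP[lg cg]; apply/asboolP; split.
  move=> c x y; rewrite !fctE lf lg /GRing.scale/=.
  rewrite !mulrDr !mulrA [k * c]mulrC -!addrA; congr (_ + _).
  by rewrite addrCA.
move=> x; apply: cvgD; last exact: cg.
by apply: cvgM; [exact: cvg_cst|exact: cf].
Qed.

HB.instance Definition _ :=
  GRing.isSubmodClosed.Build R (E -> R) dual_pred dual_pred_submod_closed.

Record dual : Type :=
  Dual { dual_fun :> E -> R ; dual_funP : dual_fun \in dual_pred }.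

HB.instance Definition _ := [isSub for dual_fun].
HB.instance Definition _ := [Choice of dual by <:].
HB.instance Definition _ := [SubChoice_isSubLmodule of dual by <:].


Lemma dual_linear (f : dual) : linear (dual_fun f : E -> R).
Proof. by have /asboolP[lf _] := dual_funP f. Qed.

Lemma dual_continuous (f : dual) : continuous (dual_fun f).
Proof. by have /asboolP[_ cf] := dual_funP f. Qed.

HB.instance Definition _ (f : dual) :=
  GRing.isLinear.Build R E R *:%R (dual_fun f) (dual_linear f).

Lemma dualD (f g : dual) x : (f + g) x = f x + g x. Proof. by []. Qed.

Lemma dualZ k (f : dual) x : (k *: f) x = k * f x. Proof. by []. Qed.

Definition opnorm (f : dual) : R :=
  sup [set `|f x| | x in [set x : E | `|x| <= 1]].

Lemma has_sup_opnorm (f : dual) :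
  has_sup [set `|f x| | x in [set x : E | `|x| <= 1]].
Proof.
split; first by exists `|f 0|, 0 => //=; rewrite normr0.
have /linear_bounded_continuous/linear_boundedP fb := @dual_continuous f.
have [r r0 fr] := pinfty_ex_gt0 fb; exists r => _ [x /= x1 <-].
by rewrite (le_trans (fr x))// ler_piMr// ltW.
Qed.

Lemma opnorm_ge (f : dual) x : `|x| <= 1 -> `|f x| <= opnorm f.
Proof. by move=> x1; apply: ub_le_sup; [case: (has_sup_opnorm f)|exists x]. Qed.

Lemma opnorm_le (f : dual) C :
  (forall x, `|x| <= 1 -> `|f x| <= C) -> opnorm f <= C.
Proof.
move=> fC; apply: ge_sup; first by case: (has_sup_opnorm f).
by move=> _ [x /= x1 <-]; exact: fC.
Qed.

Lemma opnormP (f : dual) x : `|f x| <= opnorm f * `|x|.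
Proof.
have [->|x0] := eqVneq x 0; first by rewrite linear0 !normr0 mulr0.
rewrite -ler_pdivrMr ?normr_gt0//.
have := @opnorm_ge f (`|x|^-1 *: x); rewrite normfZV// lexx => /(_ isT).
by rewrite linearZ/= normrM normfV normr_id mulrC.
Qed.

Lemma opnormD (f g : dual) : opnorm (f + g) <= opnorm f + opnorm g.
Proof.
apply: opnorm_le => x x1; rewrite dualD (le_trans (ler_normD _ _))//.
by rewrite lerD// opnorm_ge.
Qed.

Lemma opnormZ k (f : dual) : opnorm (k *: f) = `|k| * opnorm f.
Proof.
apply/eqP; rewrite eq_le; apply/andP; split.
  by apply: opnorm_le => x x1; rewrite dualZ normrM ler_wpM2l// opnorm_ge.
have [->|k0] := eqVneq k 0.
  by rewrite normr0 mul0r (le_trans _ (@opnorm_ge _ 0 _))// normr0.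
rewrite mulrC -ler_pdivlMr ?normr_gt0//; apply: opnorm_le => x x1.
by rewrite ler_pdivlMr ?normr_gt0// mulrC -normrM -dualZ opnorm_ge.
Qed.

Lemma opnorm_eq0 (f : dual) : opnorm f = 0 -> f = 0.
Proof.
move=> f0; apply/val_inj/funext => x /=; apply/eqP.
by rewrite -normr_le0 (le_trans (opnormP f x))// f0 mul0r.
Qed.

HB.instance Definition _ :=
  Lmodule_isNormed.Build R dual opnormD opnormZ opnorm_eq0.

End Dual.

Section Bidual.
Context (R : realType) (E : normedModType R).

Lemma evaluation_dual_pred (x : E) :
  (fun f : dual E => f x) \in @dual_pred R (dual E).
Proof.
apply/asboolP; have lin : linear (fun f : dual E => f x : R) by [].
split => //.
pose L : {linear dual E -> R} := HB.pack (fun f : dual E => f x)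
  (GRing.isLinear.Build _ _ _ _ _ lin).
apply: (@bounded_linear_continuous _ _ _ L); apply/linear_boundedP.
exists `|x|; split => [|r xr f]; first exact: num_real.
rewrite (le_trans (opnormP f x))// mulrC.
by apply: ler_wpM2r; [exact: (@normr_ge0 _ _ f)|exact: ltW].
Qed.

Definition evaluation (x : E) : dual (dual E) := Dual (evaluation_dual_pred x).

Definition reflexive_space : Prop :=
  forall F : dual (dual E), exists x : E, F = evaluation x.

(* A copy of E carrying sigma(E, E^* ): the coarsest topology making every
   continuous linear functional continuous. *)
Definition weak : Type :=
  sup_topology (fun f : dual E =>
    Topological.class (initial_topology (dual_fun f))).

HB.instance Definition _ := Topological.on weak.

(* A copy of the dual of E carrying sigma(E^*, E). *)
Definition weak_star : Type :=
  sup_topology (fun x : E =>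
    Topological.class (initial_topology (fun f : dual E => f x))).

HB.instance Definition _ := Topological.on weak_star.

Definition diameter (A : set E) : \bar R :=
  ereal_sup [set `|x.1 - x.2|%:E | x in A `*` A].

(* Meant for bounded W. A weakly open subset of A is written A `&` O with O
   weakly open in E; closedness of A is in the weak topology of E. *)
Definition PCP (W : set E) : Prop :=
  forall A : set E, A `<=` W -> A !=set0 -> @closed weak A ->
  forall eps : R, 0 < eps ->
  exists O : set E, [/\ @open weak O, A `&` O !=set0 &
    (diameter (A `&` O) < eps%:E)%E].

Definition PCP_space : Prop := PCP [set x : E | `|x| <= 1].

End Bidual.

Section Subspace.
Context (R : realType) (E : normedModType R) (Y : submodClosed E).

(* The linear subspace Y as a normed space in its own right, so that its weak
   topology is the one induced by its own dual. *)
Record subspace_of : Type :=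
  SubspaceOf { subspace_val :> E ; subspace_valP : subspace_val \in Y }.

HB.instance Definition _ := [isSub for subspace_val].
HB.instance Definition _ := [Choice of subspace_of by <:].
HB.instance Definition _ := [SubChoice_isSubLmodule of subspace_of by <:].

Definition subspace_norm (y : subspace_of) : R := `|subspace_val y|.

Lemma subspace_normD x y :
  subspace_norm (x + y) <= subspace_norm x + subspace_norm y.
Proof. exact: ler_normD. Qed.

Lemma subspace_normZ k x : subspace_norm (k *: x) = `|k| * subspace_norm x.
Proof. exact: normrZ. Qed.

Lemma subspace_norm_eq0 x : subspace_norm x = 0 -> x = 0.
Proof. by move=> /normr0_eq0 x0; exact: val_inj. Qed.

HB.instance Definition _ := Lmodule_isNormed.Build R subspace_of
  subspace_normD subspace_normZ subspace_norm_eq0.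

End Subspace.

Section Basis.
Context (R : realType) (X : normedModType R).

Definition schauder_basis (e : nat -> X) : Prop :=
  forall x : X, exists! a : nat -> R,
    series (fun n => a n *: e n) @ \oo --> x.

(* A finitely supported sequence is given by its first n terms. *)
Definition one_symmetric (e : nat -> X) : Prop :=
  forall (n : nat) (a : nat -> R) (s : nat -> bool) (p : nat -> nat),
  bijective p ->
  `|\sum_(i < n) ((-1) ^+ s i * a i) *: e (p i)| = `|\sum_(i < n) a i *: e i|.

Record symmetric_basis : Type := SymmetricBasis {
  basis_seq :> nat -> X ;
  basis_schauder : schauder_basis basis_seq ;
  basis_one_symmetric : one_symmetric basis_seq }.

Lemma basis_neq0 (e : symmetric_basis) n : e n != 0.
Proof.
apply/eqP => en0; have [a [_ au]] := basis_schauder e 0.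
have H (b : nat -> R) : (forall k, b k *: e k = 0) -> a = b.
  move=> be; apply: au.
  rewrite (_ : series _ = cst 0); first exact: cvg_cst.
  by apply/funext => k; rewrite /series/= big1.
have a0 : a = cst 0 by apply: H => k; rewrite scale0r.
have a1 : a = (fun k => (k == n)%:R).
  by apply: H => k; case: eqP => [->|_]; rewrite ?en0 ?scaler0// scale0r.
have := congr1 (@^~ n) a1; rewrite a0 /= eqxx => /esym/eqP.
by rewrite oner_eq0.
Qed.

Lemma basis_sum_ge (e : symmetric_basis) (a b : R) :
  `|a| * `|e 0%N| <= `|a *: e 0%N + b *: e 1%N|.
Proof.
pose c (k : nat) := if k == 0%N then a else b.
have := @basis_one_symmetric e 2 c (fun k => k == 1%N) id
  (Bijective (fun=> erefl) (fun=> erefl)).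
rewrite !big_ord_recl !big_ord0 !addr0 /= expr0 mul1r expr1 mulN1r => E.
rewrite -normrZ -(ler_pMn2r (n := 2))// -normrMn.
have -> : (a *: e 0%N) *+ 2 = (a *: e 0%N + b *: e 1%N)
    + (a *: e 0%N + (- b) *: e 1%N).
  by rewrite scaleNr addrACA subrr addr0 mulr2n.
by rewrite (le_trans (ler_normD _ _))// mulr2n lerD2l E.
Qed.

End Basis.

Notation unit_interval R := (set_type `[0%R : R, 1%R]%classic).

Section UnitInterval.
Context (R : realType).

Lemma zero_in_itv01 : (0 : R) \in `[0 : R, 1]%classic.
Proof. by rewrite inE/= in_itv/= lexx ler01. Qed.

Lemma one_in_itv01 : (1 : R) \in `[0 : R, 1]%classic.
Proof. by rewrite inE/= in_itv/= lexx ler01. Qed.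

Definition zeroI : unit_interval R := exist _ 0 zero_in_itv01.
Definition oneI : unit_interval R := exist _ 1 one_in_itv01.

(* The list s = [:: t_1; ...; t_n] stands for 0 = t_0 < t_1 < ... < t_n = 1:
   the point t_0 = 0 is not part of s. Then left_pt s i is t_i and
   right_pt s i is t_(i+1). *)
Definition partition01 (s : seq (unit_interval R)) : Prop :=
  itv_partition 0 1 (map val s).

Definition left_pt (s : seq (unit_interval R)) (i : nat) : unit_interval R :=
  nth zeroI (zeroI :: s) i.

Definition right_pt (s : seq (unit_interval R)) (i : nat) : unit_interval R :=
  nth zeroI s i.

Definition mesh (s : seq (unit_interval R)) : R :=
  \big[Num.max/0]_(i < size s) (val (right_pt s i) - val (left_pt s i)).

Lemma exists_partition01 (d : R) : 0 < d ->
  exists2 s, partition01 s & mesh s <= d.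
Proof.
move=> d0; pose n := (Num.truncn d^-1).+1.
have n0 : 0 < n%:R :> R by rewrite ltr0n.
have nd : n%:R^-1 <= d.
  by rewrite -[leRHS]invrK lef_pV2 ?posrE ?invr_gt0// ltW// truncnS_gt.
pose t (k : nat) : unit_interval R := insubd zeroI (k%:R / n%:R).
have tE k : (k <= n)%N -> val (t k) = k%:R / n%:R.
  move=> kn; rewrite /t val_insubd ifT// inE/= in_itv/= divr_ge0//=.
  by rewrite ler_pdivrMr// mul1r ler_nat.
have t0 : t 0%N = zeroI by apply: val_inj; rewrite tE// mul0r.
pose s := [seq t k | k <- iota 1 n].
have szs : size s = n by rewrite size_map size_iota.
have rE i : (i < n)%N -> right_pt s i = t i.+1.
  by move=> ni; rewrite /right_pt (nth_map 0%N) ?size_iota// nth_iota.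
have lE i : (i < n)%N -> left_pt s i = t i.
  by case: i => [//|i] ni; rewrite /left_pt/= -rE// ltnW.
exists s.
  split; last first.
    rewrite -nth_last -map_comp size_map size_iota (nth_map 0%N) ?size_iota//.
    by rewrite nth_iota// add1n prednK//= tE// divff// gt_eqF.
  have -> : path <%R 0 (map val s) = sorted <%R (map val (zeroI :: s)) by [].
  apply/(sortedP 0) => i; rewrite size_map => si.
  have ni : (i < n)%N by rewrite -szs.
  rewrite !(nth_map zeroI) ?(ltnW si)//=.
  rewrite -[nth _ (_ :: _) i]/(left_pt s i) -[nth _ s i]/(right_pt s i).
  by rewrite (rE _ ni) (lE _ ni) (tE _ ni) (tE _ (ltnW ni)) ltr_pM2r ?invr_gt0// ltr_nat.
rewrite /mesh; apply: bigmax_le; first exact: ltW.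
move=> [i si] _; have ni : (i < n)%N by rewrite -szs.
rewrite -[nat_of_ord _]/i (rE _ ni) (lE _ ni) (tE _ ni) (tE _ (ltnW ni)).
by rewrite -mulrBl -natrB// subSnn mul1r.
Qed.

End UnitInterval.

Section VX.
Context (R : realType) (X : normedModType R) (e : symmetric_basis X).
Implicit Types (f g : unit_interval R -> R) (s : seq (unit_interval R)).

Definition increments f s : X :=
  \sum_(i < size s) (f (right_pt s i) - f (left_pt s i)) *: e i.

Definition alphaX f s : R := `|increments f s|.

Definition sup_alphaX f (P : set (seq (unit_interval R))) : \bar R :=
  ereal_sup [set (alphaX f s)%:E | s in P].

Definition VX_norm f : \bar R := sup_alphaX f [set s | partition01 s].

Definition VX : set (unit_interval R -> R) :=
  [set f | f (zeroI R) = 0 /\ (VX_norm f < +oo)%E].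

Definition mesh_alphaX f (d : R) : \bar R :=
  sup_alphaX f [set s | partition01 s /\ mesh s <= d].

Definition VX0_set : set (unit_interval R -> R) :=
  [set f | VX f /\ mesh_alphaX f d @[d --> 0^'+] --> 0%E].

Lemma alphaXD f g s : alphaX (f + g) s <= alphaX f s + alphaX g s.
Proof.
rewrite (le_trans _ (ler_normD _ _))// le_eqVlt; apply/orP; left.
apply/eqP; congr `|_|; rewrite /increments -big_split/=.
by apply: eq_bigr => i _; rewrite -scalerDl !fctE opprD addrACA.
Qed.

Lemma alphaXZ k f s : alphaX (k *: f) s = `|k| * alphaX f s.
Proof.
rewrite /alphaX -normrZ; congr `|_|; rewrite /increments scaler_sumr.
by apply: eq_bigr => i _; rewrite scalerA mulrBr.
Qed.

Lemma sup_alphaX_ge0 f P : P !=set0 -> (0 <= sup_alphaX f P)%E.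
Proof.
move=> [s Ps]; apply: (@le_trans _ _ (alphaX f s)%:E).
  by rewrite lee_fin normr_ge0.
by apply: ereal_sup_ubound; exists s.
Qed.

Lemma sup_alphaXD f g P : P !=set0 ->
  (sup_alphaX (f + g)%R P <= sup_alphaX f P + sup_alphaX g P)%E.
Proof.
move=> P0; apply: ge_ereal_sup => _ [s Ps <-].
rewrite (@le_trans _ _ ((alphaX f s)%:E + (alphaX g s)%:E)%E)//.
  by rewrite -EFinD lee_fin alphaXD.
by apply: leeD; apply: ereal_sup_ubound; exists s.
Qed.

Lemma sup_alphaXZ k f P : P !=set0 ->
  (sup_alphaX (k *: f)%R P = `|k|%:E * sup_alphaX f P)%E.
Proof.
have main c g : P !=set0 ->
    (sup_alphaX (c *: g)%R P <= `|c|%:E * sup_alphaX g P)%E.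
  move=> P0; apply: ge_ereal_sup => _ [s Ps <-]; rewrite alphaXZ EFinM.
  by apply: lee_wpmul2l; [rewrite lee_fin|apply: ereal_sup_ubound; exists s].
move=> P0; apply/eqP; rewrite eq_le main//=.
have [->|k0] := eqVneq k 0; first by rewrite normr0 mul0e sup_alphaX_ge0.
have := main k^-1 (k *: f) P0; rewrite scalerA mulVf// scale1r => H.
rewrite (@le_trans _ _ (`|k|%:E * (`|k^-1|%:E * sup_alphaX (k *: f)%R P))%E)//.
  by apply: lee_wpmul2l => //; rewrite lee_fin.
by rewrite muleA -EFinM -normrM divff// normr1 mul1e.
Qed.

Lemma partition01_nonempty : [set s : seq (unit_interval R) | partition01 s] !=set0.
Proof. by have [s ? _] := exists_partition01 (@ltr01 R); exists s. Qed.

Lemma mesh_partition01_nonempty (d : R) : 0 < d ->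
  [set s : seq (unit_interval R) | partition01 s /\ mesh s <= d] !=set0.
Proof. by move=> /exists_partition01[s ? ?]; exists s. Qed.

Lemma VX_norm_ge0 f : (0 <= VX_norm f)%E.
Proof. exact/sup_alphaX_ge0/partition01_nonempty. Qed.

Lemma VX_norm_fin f : VX f -> VX_norm f \is a fin_num.
Proof. by move=> [_ ?]; rewrite ge0_fin_numE// VX_norm_ge0. Qed.

Definition VX0_pred : {pred (unit_interval R -> R)} := mem VX0_set.

Lemma VX0_submod_closed : submod_closed VX0_pred.
Proof.
have Z k f : VX0_set f -> VX0_set (k *: f).
  move=> [[f0 foo] fl]; split; first split.
  - by rewrite fctE f0 scaler0.
  - rewrite /VX_norm sup_alphaXZ; last exact: partition01_nonempty.
    by rewrite -[sup_alphaX _ _](@fineK _ (VX_norm f)) ?VX_norm_fin// -EFinM ltry.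
  - rewrite -(mule0 `|k|%:E).
    apply: (@cvg_trans _ ((`|k|%:E * mesh_alphaX f d)%E @[d --> 0^'+])).
      apply: near_eq_cvg; near=> d; rewrite /mesh_alphaX sup_alphaXZ//.
      by apply: mesh_partition01_nonempty.
    exact: cvgeZl.
have D f g : VX0_set f -> VX0_set g -> VX0_set (f + g).
  move=> [[f0 foo] fl] [[g0 goo] gl]; split; first split.
  - by rewrite fctE f0 g0 addr0.
  - apply: le_lt_trans (sup_alphaXD _ _ partition01_nonempty) _.
    by rewrite lte_add_pinfty.
  - apply: (@squeeze_cvge _ _ _ _ (cst 0%E) _
      (fun d => mesh_alphaX f d + mesh_alphaX g d)%E).
    + near=> d; have d0 : 0 < d by [].
      by rewrite sup_alphaX_ge0 ?sup_alphaXD//; exact: mesh_partition01_nonempty.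
    + exact: cvg_cst.
    + by rewrite -[X in _ --> X]adde0; apply: cvgeD.
have VX00 : VX0_set 0.
  have E P : P !=set0 -> sup_alphaX 0 P = 0%E.
    by move=> P0; rewrite -(scale0r 0) sup_alphaXZ// normr0 mul0e.
  split; first split => //.
    by rewrite /VX_norm E ?ltry//; exact: partition01_nonempty.
  apply: (@cvg_trans _ ((fun=> 0%E) @ (0 : R)^'+)); last exact: cvg_cst.
  apply: near_eq_cvg; near=> d; rewrite /mesh_alphaX E//.
  by apply: mesh_partition01_nonempty.
split; first by rewrite inE.
by move=> k f g; rewrite !inE => Vf Vg; apply: D => //; exact: Z.
Unshelve. all: by end_near. Qed.

HB.instance Definition _ :=
  GRing.isSubmodClosed.Build R (unit_interval R -> R) VX0_pred VX0_submod_closed.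

Record VX0 : Type :=
  MkVX0 { VX0_fun :> unit_interval R -> R ; VX0P : VX0_fun \in VX0_pred }.

HB.instance Definition _ := [isSub for VX0_fun].
HB.instance Definition _ := [Choice of VX0 by <:].
HB.instance Definition _ := [SubChoice_isSubLmodule of VX0 by <:].

Definition VX0_norm (f : VX0) : R := fine (VX_norm f).

Lemma VX0_VX (f : VX0) : VX f.
Proof. by have := VX0P f; rewrite inE => -[]. Qed.

Lemma VX0_normE (f : VX0) : (VX0_norm f)%:E = VX_norm f.
Proof. by rewrite fineK// VX_norm_fin//; exact: VX0_VX. Qed.

Lemma VX0_normD (f g : VX0) : VX0_norm (f + g) <= VX0_norm f + VX0_norm g.
Proof.
rewrite -lee_fin EFinD !VX0_normE.
exact: (sup_alphaXD _ _ partition01_nonempty).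
Qed.

Lemma VX0_normZ k (f : VX0) : VX0_norm (k *: f) = `|k| * VX0_norm f.
Proof.
apply: EFin_inj; rewrite EFinM !VX0_normE.
exact: (sup_alphaXZ _ _ partition01_nonempty).
Qed.

Lemma VX0_norm_pt (f : VX0) t : `|f t| * `|e 0%N| <= VX0_norm f.
Proof.
have ub s : partition01 s -> alphaX f s <= VX0_norm f.
  by move=> sP; rewrite -lee_fin VX0_normE; apply: ereal_sup_ubound; exists s.
have [f0 _] := VX0_VX f; have [t0|t0] := eqVneq t (zeroI R).
  rewrite t0 f0 normr0 mul0r -lee_fin VX0_normE; exact: VX_norm_ge0.
have [t1|t1] := eqVneq t (oneI R).
  have := ub [:: oneI R]; rewrite /alphaX /increments big_ord_recl big_ord0.
  rewrite addr0 /right_pt /left_pt/= f0 subr0 normrZ t1; apply.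
  by split => //=; rewrite ltr01.
have /andP[t_ge0 t_le1] : 0 <= val t <= 1.
  by have := valP t; rewrite inE/= in_itv.
have := ub [:: t; oneI R].
rewrite /alphaX /increments !big_ord_recl big_ord0 addr0.
rewrite /right_pt /left_pt/= f0 subr0 => H; apply: le_trans (H _).
  exact: basis_sum_ge.
have gt0 : 0 < val t.
  rewrite lt_neqAle t_ge0 andbT; apply: contra t0 => /eqP t0.
  by apply/eqP/val_inj; rewrite -t0.
have lt1 : val t < 1.
  rewrite lt_neqAle t_le1 andbT; apply: contra t1 => /eqP t1.
  by apply/eqP/val_inj; rewrite t1.
by split => //=; rewrite gt0 lt1.
Qed.

Lemma VX0_norm_eq0 (f : VX0) : VX0_norm f = 0 -> f = 0.
Proof.
move=> f0; apply/val_inj/funext => t /=; apply/eqP; rewrite -normr_le0.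
have := VX0_norm_pt f t; rewrite f0 pmulr_lle0// normr_gt0.
exact: basis_neq0.
Qed.

HB.instance Definition _ := Lmodule_isNormed.Build R VX0
  VX0_normD VX0_normZ VX0_norm_eq0.

Lemma delta_dual_pred (t : unit_interval R) :
  (fun f : VX0 => f t) \in @dual_pred R VX0.
Proof.
apply/asboolP; have lin : linear (fun f : VX0 => f t : R) by [].
split => //.
pose L : {linear VX0 -> R} := HB.pack (fun f : VX0 => f t)
  (GRing.isLinear.Build _ _ _ _ _ lin).
apply: (@bounded_linear_continuous _ _ _ L); apply/linear_boundedP.
have e0 : 0 < `|e 0%N| by rewrite normr_gt0 basis_neq0.
exists `|e 0%N|^-1; split => [|r er f]; first exact: num_real.
have : `|f t| <= `|e 0%N|^-1 * `|f| by rewrite mulrC ler_pdivlMr// VX0_norm_pt.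
move=> /le_trans; apply.
by apply: ler_wpM2r; [exact: (@normr_ge0 _ _ f)|exact: ltW].
Qed.

Definition delta (t : unit_interval R) : dual VX0 := Dual (delta_dual_pred t).

(* The identification of the bidual of VX0 with V_X, which sends F to the
   function t |-> F (delta t). *)
Definition bidual_function (F : dual (dual VX0)) : unit_interval R -> R :=
  fun t => F (delta t).

Definition functions_of (Y : set VX0) : set (unit_interval R -> R) :=
  [set VX0_fun f | f in Y].

(* The weak-star closure is taken in the bidual of VX0, in which Y is embedded
   by evaluation, and then transported by the identification above. *)
Definition weak_star_closure (Y : set VX0) : set (unit_interval R -> R) :=
  [set bidual_function F |
    F in @closure (weak_star (dual VX0)) [set evaluation f | f in Y]].

Definition C01 : set (unit_interval R -> R) := [set f | continuous f].

End VX.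

(* Main.v *)
(* Suppose that PCP fails on a weakly closed subset A of the ball. A bound on
   the number of disjoint intervals on which a function of the ball can oscillate
   by a given amount yields, inside every nonempty relatively weakly open subset
   of A, a smaller one of small uniform diameter. Its norm diameter is not small,
   so some member has large variation on very short intervals. Iterating, a weak*
   cluster point is a uniform limit, hence continuous, and retains this variation
   at all scales, so it is not in VX0.

   Conversely let F be a weak* limit of Y whose function f is continuous and not
   in Y. Helly's theorem gives bounded elements of Y agreeing with f on any given
   finite set; since they oscillate boundedly often, averages of well-chosen
   sequences of them are pointwise close to f, and Simons' inequality turns this
   into uniform closeness. If g_k converges to f uniformly fast enough, then on
   intervals of a given scale every g_k but one is either negligible or
   indistinguishable from f. The parts of the exceptional g_k live on disjoint
   scales, so by reflexivity of X and Simons' inequality suitable convex blocks w_j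
   of the g_k make them small. The increments of w_j are then those of f times
   weights increasing with j, and the unconditional basis makes all sums of
   th_j (w_(j+1) - w_j) with |th_j| <= 1 bounded. As f is not in Y the sequence w_j
   is not Cauchy, so these sums give a copy of the unit ball of c_0 in Y, which
   has no relatively weakly open subsets of small diameter. *)

(* Pointwise information must become norm information twice: from pointwise to uniform closeness,
   and from blocks that vanish one functional at a time to a convex combination small on all
   interval families at once. Simons' inequality does both. Suprema over its index set need not be
   attained, so it is phrased with limits along one fixed ultrafilter, which also supplies weak*
   limits in biduals. Convex combinations are iterated midpoints acting on scalar sequences, so that
   one combination applies alike to values, increments and weights. Variation is measured on finite
   families of disjoint intervals. Symmetry and unconditionality make this agree with the norm over
   partitions, and a family may be cut into its long and short members: at most [1 / d] intervals
   are longer than [d], so uniform smallness controls them, while membership in [VX0] controls the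
   short ones. Reflexivity of [X] enters in two ways: the norms of sums of [n] basis vectors are
   unbounded, which limits how often a bounded function can oscillate, and bounded blocks moving off
   to infinity are weakly null. *)
Require Import Defs.
From HB Require Import structures.
From mathcomp Require Import all_boot all_order all_algebra.
From mathcomp Require Import all_classical all_reals all_analysis.
From mathcomp Require Import ring lra zify.

Set Implicit Arguments.
Unset Strict Implicit.
Unset Printing Implicit Defensive.
Import Order.TTheory GRing.Theory Num.Theory.
Import numFieldNormedType.Exports.

Local Open Scope classical_set_scope.
Local Open Scope ring_scope.

(** * The Hahn-Banach theorem *)

Section HahnBanach.
Context (R : realType) (V : lmodType R).
Implicit Types (p q : V -> R).

Definition sublinear p :=
  (forall x y, p (x + y) <= p x + p y) /\
  (forall k x, 0 <= k -> p (k *: x) = k * p x).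

Lemma sublinear_opp_le p x : sublinear p -> - p (- x) <= p x.
Proof.
move=> [pD pZ]; have p0 : p 0 = 0 by rewrite -[0](scale0r 0) pZ// mul0r.
by have := pD x (- x); rewrite subrr p0; lra.
Qed.

(** Zorn's lemma for the reversed pointwise order. A chain is bounded by its pointwise infimum,
    which is finite because every sublinear [q] below [p] satisfies
    [q x >= - q (- x) >= - p (- x)]. *)
Lemma sublinear_minimal_below p : sublinear p ->
  exists2 q, sublinear q /\ (forall x, q x <= p x) &
    forall r, sublinear r -> (forall x, r x <= q x) -> r = q.
Proof.
move=> ps.
pose T := {q : V -> R | sublinear q /\ forall x, q x <= p x}.
pose P : T := exist _ p (conj ps (fun x => lexx _)).
pose le (q r : T) := `[< forall x, sval r x <= sval q x >].
have [//| | | |q qmax] := @Zorn T le.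
- by move=> t; apply/asboolP.
- move=> r s t /asboolP rs /asboolP st; apply/asboolP => x.
  exact: le_trans (st x) (rs x).
- move=> [s sP] [t tP] /asboolP/= st /asboolP/= ts; apply: eq_exist.
  by apply/funext => x; apply/eqP; rewrite eq_le st ts.
- move=> A Atot; have [->|/set0P[q0 Aq0]] := eqVneq A set0; first by exists P.
  pose v x := [set sval q x | q in (A : set T)].
  have lb x : has_lbound (v x).
    exists (- p (- x)) => _ [q Aq <-]; case: q Aq => q [qs qp]/= Aq.
    have := sublinear_opp_le (- x) qs; rewrite opprK => h.
    by have := sublinear_opp_le x qs; have := qp (- x); lra.
  have n0 x : v x !=set0 by exists (sval q0 x), q0.
  pose m x := inf (v x).
  have mle (q : T) x : A q -> m x <= sval q x.
    by move=> Aq; apply: ge_inf => //; exists q.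
  have mge x c : (forall q : T, A q -> c <= sval q x) -> c <= m x.
    by move=> cq; apply: lb_le_inf => // _ [q Aq <-]; exact: cq.
  have ms : sublinear m.
    split=> [x y|k x k0].
      (* Two members of a chain are comparable, so the smaller one serves for both [x] and [y]. *)
      suff H (q r : T) : A q -> A r -> m (x + y) <= sval q x + sval r y.
        rewrite -lerBlDr; apply: (mge) => q Aq; rewrite lerBlDr -lerBlDl.
        by apply: (mge) => r Ar; have := H _ _ Aq Ar; lra.
      move=> Aq Ar; have [qr|rq] := Atot _ _ Aq Ar.
        move/asboolP : qr => qr.
        apply: (le_trans (mle _ _ Ar)); have [[rD _] _] := svalP r.
        by apply: (le_trans (rD _ _)); rewrite lerD2r.
      move/asboolP : rq => rq.
      apply: (le_trans (mle _ _ Aq)); have [[qD _] _] := svalP q.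
      by apply: (le_trans (qD _ _)); rewrite lerD2l.
    have [->|kn0] := eqVneq k 0.
      rewrite scale0r mul0r; apply/eqP; rewrite eq_le; apply/andP; split.
        apply: (le_trans (mle _ _ Aq0)); have [[_ qZ] _] := svalP q0.
        by rewrite -(scale0r 0) qZ// mul0r.
      apply: (mge) => q _; have [[_ qZ] _] := svalP q.
      by rewrite -(scale0r 0) qZ// mul0r.
    have kp : 0 < k by rewrite lt_neqAle eq_sym kn0.
    apply/eqP; rewrite eq_le; apply/andP; split.
      rewrite -ler_pdivrMl//; apply: (mge) => q Aq; rewrite ler_pdivrMl//.
      have [[_ qZ] _] := svalP q; rewrite -qZ//; exact: mle.
    apply: (mge) => q Aq; have [[_ qZ] _] := svalP q; rewrite qZ//.
    by rewrite ler_pM2l// mle.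
  have mp x : m x <= p x.
    by apply: (le_trans (mle _ x Aq0)); have [_] := svalP q0; apply.
  have mP : sublinear m /\ forall x, m x <= p x by [].
  by exists (exist _ m mP) => q Aq; apply/asboolP => x /=; exact: mle.
exists (sval q); first by have := svalP q.
move=> r rs rq.
have [_ qp] := svalP q.
have rp x : r x <= p x by exact: le_trans (rq x) (qp x).
have rP : sublinear r /\ forall x, r x <= p x by [].
by have /(congr1 sval) := qmax (exist _ r rP) (introT (asboolP _) rq).
Qed.

(** At [t = 0] this gives [q <= p]. If [p] is minimal, then [q = p], and the bound at [t = 1] is the
    reverse of subadditivity in the direction [y]. *)
Lemma sublinear_directional_inf p y : sublinear p ->
  exists2 q, sublinear q & forall x t, 0 <= t -> q x <= p (x + t *: y) - t * p y.
Proof.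
move=> ps; have [pD pZ] := ps.
pose v x := [set p (x + t *: y) - t * p y | t in [set t | 0 <= t]].
have lb x : has_lbound (v x).
  exists (- p (- x)) => _ [t /= t0 <-]; rewrite lerBrDr -pZ//.
  by have := pD (- x) (x + t *: y); rewrite addKr; lra.
have n0 x : v x !=set0 by eexists; exists 0 => /=.
pose m x := inf (v x).
have mle x t : 0 <= t -> m x <= p (x + t *: y) - t * p y.
  by move=> t0; apply: ge_inf => //; exists t.
have mge x c : (forall t, 0 <= t -> c <= p (x + t *: y) - t * p y) -> c <= m x.
  by move=> H; apply: lb_le_inf => // _ [t t0 <-]; exact: H.
have m0 : m 0 = 0.
  apply/eqP; rewrite eq_le; apply/andP; split.
    have := mle 0 0 (lexx _); rewrite scale0r addr0 mul0r subr0.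
    by rewrite -(scale0r 0) pZ// mul0r.
  by apply: (mge) => t t0; rewrite add0r pZ// subrr.
exists m => //; split => [x z|k x].
  rewrite -lerBlDr; apply: (mge) => t t0; rewrite lerBlDr -lerBlDl.
  apply: (mge) => s s0; have := mle (x + z) (s + t) (addr_ge0 s0 t0).
  rewrite scalerDl [s *: y + _]addrC addrACA.
  by have := pD (x + t *: y) (z + s *: y); lra.
rewrite le_eqVlt => /predU1P[<-|kp]; first by rewrite scale0r mul0r m0.
apply/eqP; rewrite eq_le; apply/andP; split.
  rewrite -ler_pdivrMl//; apply: (mge) => t t0; rewrite ler_pdivrMl//.
  apply: (le_trans (mle _ (k * t) (mulr_ge0 (ltW kp) t0))).
  by rewrite -scalerA -scalerDr pZ ?(ltW kp)//; lra.
apply: (mge) => t t0; rewrite -ler_pdivlMl//.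
apply: (le_trans (mle _ (k^-1 * t) _)); first by rewrite mulr_ge0// invr_ge0 ltW.
have kn : k != 0 by rewrite gt_eqF.
rewrite ler_pdivlMl// mulrBr -(pZ k) ?(ltW kp)// scalerDr scalerA !mulrA.
by rewrite divff// !mul1r.
Qed.

(* A minimal sublinear functional below p is linear. *)
Lemma hahn_banach p x0 : sublinear p ->
  exists f : {linear V -> R}, (forall x, f x <= p x) /\ f x0 = p x0.
Proof.
(* A functional below [p1] is at most [- p x0] at [- x0]. Minimising below [p1] instead of [p]
   therefore forces the value [p x0] at [x0]. *)
move=> ps; have [p1 p1s p1p] := sublinear_directional_inf x0 ps.
have [q [qs qp1] qmin] := sublinear_minimal_below p1s.
have [qD qZ] := qs.
have p1le x : p1 x <= p x.
  by have := p1p x 0 (lexx _); rewrite scale0r addr0 mul0r subr0.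
have q0 : q 0 = 0 by rewrite -[0](scale0r 0) qZ// mul0r.
have addq x y : q (x + y) = q x + q y.
  apply/eqP; rewrite eq_le qD/=.
  have [r rs rq] := sublinear_directional_inf y qs.
  have -> : q x = r x.
    rewrite [r]qmin// => z.
    by have := rq z 0 (lexx _); rewrite scale0r addr0 mul0r subr0.
  by have := rq x 1 ler01; rewrite scale1r mul1r; lra.
have oppq x : q (- x) = - q x.
  by apply/eqP; rewrite -addr_eq0 addrC -addq subrr q0.
have lin : linear q.
  move=> k x y; rewrite addq; congr (_ + _); rewrite -[k *: q x]/(k * q x).
  have [k0|k0] := leP 0 k; first exact: qZ.
  rewrite -[k]opprK scaleNr oppq qZ ?mulNr//; lra.
pose f : {linear V -> R} := HB.pack q (GRing.isLinear.Build _ _ _ _ _ lin).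
exists f; split => [x|]; first exact: le_trans (qp1 x) (p1le x).
apply/eqP; rewrite eq_le /= (le_trans (qp1 x0) (p1le x0))/=.
have := p1p (- x0) 1 ler01; rewrite scale1r addNr mul1r.
have := qp1 (- x0); rewrite oppq.
have [_ pZ] := ps; have -> : p 0 = 0 by rewrite -[0](scale0r 0) pZ// mul0r.
lra.
Qed.

End HahnBanach.

(** * Limits along an ultrafilter *)

Section Ultralimit.

(** With one fixed ultrafilter finer than [\oo], all bounded real sequences have limits that depend
    linearly on the sequence. *)
Definition nat_ultra : set_system nat :=
  sval (cid (ultraFilterLemma (@eventually_filter))).

Lemma nat_ultraP : UltraFilter nat_ultra /\ \oo `<=` nat_ultra.
Proof. by rewrite /nat_ultra; case: cid. Qed.

#[global] Instance nat_ultra_ultra : UltraFilter nat_ultra.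
Proof. by have [] := nat_ultraP. Qed.

Lemma nat_ultra_eventually (P : set nat) : (\forall n \near \oo, P n) -> nat_ultra P.
Proof. by have [_] := nat_ultraP; apply. Qed.

Context (R : realType).
Implicit Types u v : nat -> R.

Definition ulim u : R := lim (u @ nat_ultra).

Lemma ulim_unique u (l : R) : u @ nat_ultra --> l -> ulim u = l.
Proof. exact: cvg_lim. Qed.

Lemma ulim_cvg u (M : R) : (forall n, `|u n| <= M) -> u @ nat_ultra --> ulim u.
Proof.
move=> uM; have [|l [_ ul]] := @segment_compact R (- M) M (u @ nat_ultra) _.
  have : nat_ultra setT by exact: filterT.
  by apply: filterS => n _ /=; rewrite in_itv/= -ler_norml.
suff ul' : u @ nat_ultra --> l by rewrite (ulim_unique ul').
move=> A lA; have [//|nA] := in_ultra_setVsetC (u @^-1` A) nat_ultra_ultra.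
by have [x []] := ul (~` A) A nA lA.
Qed.

Lemma ulim_le u (M c : R) : (forall n, `|u n| <= M) ->
  (\forall n \near \oo, u n <= c) -> ulim u <= c.
Proof.
move=> uM uc; apply: (cvgr_to_le (ulim_cvg uM)).
exact: nat_ultra_eventually.
Qed.

Lemma ulim_ge u (M c : R) : (forall n, `|u n| <= M) ->
  (\forall n \near \oo, c <= u n) -> c <= ulim u.
Proof.
move=> uM uc; apply: (cvgr_to_ge (ulim_cvg uM)).
exact: nat_ultra_eventually.
Qed.

Lemma ulim_norm_le u (M : R) : (forall n, `|u n| <= M) -> `|ulim u| <= M.
Proof.
move=> uM; rewrite ler_norml; apply/andP; split.
  by apply: (ulim_ge uM); near=> n; have := uM n; rewrite ler_norml => /andP[].
by apply: (ulim_le uM); near=> n; have := uM n; rewrite ler_norml => /andP[].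
Unshelve. all: by end_near. Qed.

Lemma ulim_eventually u (c : R) : (\forall n \near \oo, u n = c) -> ulim u = c.
Proof.
move=> uc; apply: ulim_unique; apply: cvg_near_cst.
exact: nat_ultra_eventually.
Qed.

Lemma ulimD u v (M N : R) : (forall n, `|u n| <= M) -> (forall n, `|v n| <= N) ->
  ulim (fun n => u n + v n) = ulim u + ulim v.
Proof.
by move=> uM vN; apply: ulim_unique; apply: cvgD; [exact: ulim_cvg uM|exact: ulim_cvg vN].
Qed.

Lemma ulimZ k u (M : R) : (forall n, `|u n| <= M) ->
  ulim (fun n => k * u n) = k * ulim u.
Proof.
by move=> uM; apply: ulim_unique; apply: cvgM; [exact: cvg_cst|exact: ulim_cvg uM].
Qed.

End Ultralimit.

(** * Simons' inequality *)

Section DyadicMeans.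
Context (R : realType).
Implicit Types (a b : nat -> R) (y z : (nat -> R) -> R).

(** Finite convex combinations of the coordinates from [n] on, built from midpoints only. They act
    on scalar sequences so that the same combination can be evaluated on many sequences, and each
    property follows by induction on midpoints. *)
Inductive dyadic_mean (n : nat) : ((nat -> R) -> R) -> Prop :=
| dyadic_mean_proj k : (n <= k)%N -> dyadic_mean n (fun a => a k)
| dyadic_mean_mid y z : dyadic_mean n y -> dyadic_mean n z ->
    dyadic_mean n (fun a => (y a + z a) / 2).

Lemma dyadic_mean_leq n m y : (n <= m)%N -> dyadic_mean m y -> dyadic_mean n y.
Proof.
move=> nm; elim => [k mk|{}y z _ ? _ ?]; last exact: dyadic_mean_mid.
exact/dyadic_mean_proj/(leq_trans nm).
Qed.

Lemma dyadic_mean_le n y a b : dyadic_mean n y ->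
  (forall k, (n <= k)%N -> a k <= b k) -> y a <= y b.
Proof. by move=> yn ab; elim: yn => [k /ab //|{}y z _ ? _ ?]; lra. Qed.

Lemma dyadic_mean_cst n y c : dyadic_mean n y -> y (fun=> c) = c.
Proof. by elim => [//|{}y z _ -> _ ->]; lra. Qed.

Lemma dyadic_mean_ub n y a c : dyadic_mean n y ->
  (forall k, (n <= k)%N -> a k <= c) -> y a <= c.
Proof. by move=> yn ac; rewrite -(dyadic_mean_cst c yn) (dyadic_mean_le yn). Qed.

Lemma dyadic_mean_lb n y a c : dyadic_mean n y ->
  (forall k, (n <= k)%N -> c <= a k) -> c <= y a.
Proof. by move=> yn ac; rewrite -(dyadic_mean_cst c yn) (dyadic_mean_le yn). Qed.

Lemma dyadic_mean_norm n y a M : dyadic_mean n y ->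
  (forall k, (n <= k)%N -> `|a k| <= M) -> `|y a| <= M.
Proof.
move=> yn aM; rewrite ler_norml (dyadic_mean_ub yn) ?(dyadic_mean_lb yn)//.
- by move=> k /aM; rewrite ler_norml => /andP[].
- by move=> k /aM; rewrite ler_norml => /andP[].
Qed.

Lemma dyadic_meanD n y a b : dyadic_mean n y ->
  y (fun k => a k + b k) = y a + y b.
Proof. by elim => [//|{}y z _ -> _ ->]; lra. Qed.

Lemma dyadic_meanZ n y c a : dyadic_mean n y ->
  y (fun k => c * a k) = c * y a.
Proof. by elim => [//|{}y z _ -> _ ->]; lra. Qed.

Lemma dyadic_mean_support n y : dyadic_mean n y ->
  exists2 q, (n <= q)%N &
    forall a b, (forall k, (n <= k < q)%N -> a k = b k) -> y a = y b.
Proof.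
elim => [k nk|{}y z _ [q nq yq] _ [r nr zr]].
  by exists k.+1 => [|a b]; [exact: leqW|apply; rewrite nk ltnSn].
exists (maxn q r) => [|a b ab]; first by rewrite leq_max nq.
by rewrite (yq _ b) 1?(zr _ b)// => k /andP[nk kq]; apply: ab;
  rewrite nk leq_max kq ?orbT.
Qed.

Lemma dyadic_mean_ulim n y (a : nat -> nat -> R) M : dyadic_mean n y ->
  (forall j k, `|a j k| <= M) ->
  y (fun k => ulim (fun j => a j k)) = ulim (fun j => y (a j)).
Proof.
move=> yn aM; elim: yn => [//|{}y z yn -> zn ->].
have yM j : `|y (a j)| <= M by exact: dyadic_mean_norm yn _.
have zM j : `|z (a j)| <= M by exact: dyadic_mean_norm zn _.
rewrite -(ulimD yM zM) mulrC -(@ulimZ _ _ _ (M + M)); last first.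
  by move=> j; rewrite (le_trans (ler_normD _ _))// lerD.
by congr ulim; apply/funext => j; rewrite mulrC.
Qed.

End DyadicMeans.

Section Simons.
Context (R : realType) (T : Type) (h : T -> nat -> R) (M : R) (t0 : T).
Hypothesis hM : forall t k, `|h t k| <= M.

Let S (u : (nat -> R) -> R) := sup [set u (h t) | t in setT].

Let bounded (u : (nat -> R) -> R) :=
  exists C, forall a, (forall k, `|a k| <= M) -> `|u a| <= C.

Let S_ge u t : bounded u -> u (h t) <= S u.
Proof.
move=> [C uC]; apply: ub_le_sup; last by exists t.
by exists C => _ [s _ <-]; exact: le_trans (ler_norm _) (uC _ (hM s)).
Qed.

Let S_le u c : (forall t, u (h t) <= c) -> S u <= c.
Proof.
by move=> uc; apply: ge_sup; [exists (u (h t0)), t0|move=> _ [t _ <-]].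
Qed.

Let bounded_lin u v c : bounded u -> bounded v -> bounded (fun a => u a + c * v a).
Proof.
move=> [C uC] [D vD]; exists (C + `|c| * D) => a aM.
rewrite (le_trans (ler_normD _ _))// lerD ?uC// normrM ler_wpM2l//.
exact: vD.
Qed.

Let bounded_mean n y : dyadic_mean n y -> bounded y.
Proof. by move=> yn; exists M => a aM; exact: dyadic_mean_norm yn _. Qed.

Let near_min n (u : (nat -> R) -> R) c d : bounded u -> 0 < d -> exists2 y, dyadic_mean n y &
  forall z, dyadic_mean n z -> S (fun a => u a + c * y a) <= S (fun a => u a + c * z a) + d.
Proof.
move=> ub d0; pose A := [set S (fun a => u a + c * y a) | y in dyadic_mean n].
have A0 : A !=set0 by eexists; exists (fun a => a n) => //; exact: dyadic_mean_proj.
have Alb : has_lbound A.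
  have [C uC] := ub; exists (- (C + `|c| * M)) => _ [y yn <-].
  have yb := bounded_lin c ub (bounded_mean yn).
  apply: le_trans (S_ge t0 yb).
  rewrite lerNl (le_trans (ler_norm _))// normrN (le_trans (ler_normD _ _))//.
  rewrite lerD ?uC// normrM ler_wpM2l//; exact: dyadic_mean_norm yn _.
have [_ [y yn <-] yd] := inf_adherent d0 (conj A0 Alb).
exists y => // z zn; apply: (le_trans (ltW yd)); rewrite lerD2r.
by apply: ge_inf => //; exists z.
Qed.

Variable n0 : nat.
(** The classical condition concerns points where suprema are attained. Here such points are
    replaced by ultralimits of the rows [h (g j)] along sequences [g] in [T]; constant sequences
    give back the points of [T]. *)
Hypothesis h_limsup : forall (g : nat -> T) eps, 0 < eps ->
  \forall k \near \oo, ulim (fun j => h (g j) k) <= eps.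

(* The y_n successively almost minimise the supremum over T of the partial sums
   of \sum_n 2^-n y_n; at an ultralimit a of points of T where the whole sum is
   as large as its supremum, every tail of the y_n must then be large. *)
Lemma simons eps : 0 < eps ->
  exists2 y, dyadic_mean n0 y & forall t, y (h t) <= eps.
Proof.
move=> eps0; apply: contrapT => /forall2NP contra.
have big y : dyadic_mean n0 y -> eps <= S y.
  move=> yn; have [//|/existsNP[t /negP]] := contra y; rewrite -ltNge => /ltW et.
  exact: le_trans et (S_ge t (bounded_mean yn)).
pose e n : R := 2^-1 ^+ n.
have e_gt0 n : 0 < e n by rewrite exprn_gt0.
have eS n : e n = 2 * e n.+1 by rewrite /e exprS; lra.
pose d := eps / 4.
have d0 : 0 < d by rewrite /d; lra.
(* The weights [e k] with [k >= n] add up to [2 * e n]: a competitor puts all the remaining weight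
   on a single mean. *)
pose good n u y := dyadic_mean (n0 + n) y /\ forall z, dyadic_mean (n0 + n) z ->
  S (fun a => u a + (2 * e n) * y a) <= S (fun a => u a + (2 * e n) * z a) + d * (e n) ^+ 2.
pose pick n u := xget (fun a : nat -> R => a n0) (good n u).
pose fix v n : (nat -> R) -> R :=
  if n is m.+1 then fun a => v m a + e m * pick m (v m) a else fun=> 0.
pose y n := pick n (v n).
have vS n a : v n.+1 a = v n a + e n * y n a by [].
have vgood n : bounded (v n) -> good n (v n) (y n).
  move=> vb; apply: xgetPex.
  have [|z zn zP] := @near_min (n0 + n) (v n) (2 * e n) (d * e n ^+ 2) vb _.
    by rewrite mulr_gt0// exprn_gt0.
  by exists z; split.
have vb n : bounded (v n).
  elim: n => [|n IH]; first by exists 0 => a _; rewrite normr0.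
  by apply: bounded_lin => //; apply: bounded_mean (vgood n IH).1.
have yn n : dyadic_mean (n0 + n) (y n) by exact: (vgood n (vb n)).1.
have ymin n z : dyadic_mean (n0 + n) z -> S (fun a => v n a + (2 * e n) * y n a) <=
    S (fun a => v n a + (2 * e n) * z a) + d * e n ^+ 2.
  exact: (vgood n (vb n)).2.
have tail n m a C : (n <= m)%N -> (forall k, (n0 + n <= k)%N -> a k <= C) ->
    v m a - v n a <= 2 * (e n - e m) * C.
  move=> nm aC; elim: m nm => [|m IH].
    by rewrite leqn0 => /eqP ->; rewrite !subrr mulr0 mul0r.
  rewrite leq_eqVlt => /predU1P[->|]; first by rewrite !subrr mulr0 mul0r.
  rewrite ltnS => nm; have := IH nm.
  have yC : y m a <= C.
    apply: (dyadic_mean_ub (yn m)) => k nk; apply: aC.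
    by rewrite (leq_trans _ nk)// leq_add2l.
  have : e m * y m a <= e m * C by rewrite ler_wpM2l// ltW.
  rewrite vS (eS m); lra.
have tail_norm n m a : (n <= m)%N -> (forall k, `|a k| <= M) ->
    `|v m a - v n a| <= 2 * (e n - e m) * M.
  move=> nm aM; elim: m nm => [|m IH].
    by rewrite leqn0 => /eqP ->; rewrite !subrr normr0 mulr0 mul0r.
  rewrite leq_eqVlt => /predU1P[->|]; first by rewrite !subrr normr0 mulr0 mul0r.
  rewrite ltnS => /IH {}IH.
  have yM : `|y m a| <= M by exact: dyadic_mean_norm (yn m) _.
  have : `|e m * y m a| <= e m * M by rewrite normrM gtr0_norm// ler_wpM2l// ltW.
  have -> : v m.+1 a - v n a = (v m a - v n a) + e m * y m a by rewrite vS; lra.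
  move=> H; rewrite (le_trans (ler_normD _ _))//.
  by move: IH H; rewrite (eS m); lra.
have M0 : 0 <= M by exact: le_trans (normr_ge0 _) (hM t0 0).
have e_small C x : 0 < x -> exists N, e N * C <= x.
  move=> x0; have [C0|C0] := leP C 0.
    by exists 0%N; rewrite (le_trans _ (ltW x0))// mulr_ge0_le0// ltW.
  have : e n @[n --> \oo] --> 0 by apply: cvg_expr; rewrite gtr0_norm; lra.
  move=> /cvgrPdist_le/(_ (x / C)) []; first by rewrite divr_gt0.
  move=> N _ /(_ N (leqnn _)); rewrite sub0r normrN gtr0_norm// => H.
  by exists N; rewrite -ler_pdivlMr.
have le_e x z C : (forall N, x <= z + e N * C) -> x <= z.
  move=> H; apply/ler_addgt0Pr => r r0; have [N NC] := e_small C r r0.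
  by rewrite (le_trans (H N))// lerD2l.
pose w a := ulim (fun n => v n a).
have v_norm n a : (forall k, `|a k| <= M) -> `|v n a| <= 2 * M.
  move=> aM; have := tail_norm 0%N n a (leq0n _) aM; rewrite subr0 => H.
  apply: (le_trans H); rewrite ler_wpM2r// ler_piMr// /e expr0.
  by rewrite lerBlDr lerDl ltW// e_gt0.
have w_ub n a C : (forall k, `|a k| <= M) -> (forall k, (n0 + n <= k)%N -> a k <= C) ->
    0 <= C -> w a <= v n a + 2 * e n * C.
  move=> aM aC C0; apply: (ulim_le (fun n => v_norm n a aM)); exists n => // m /= nm.
  rewrite -lerBlDl (le_trans (tail n m a C nm aC))// ler_wpM2r// ler_wpM2l//.
  by rewrite gerBl ltW.
have w_lb n a : (forall k, `|a k| <= M) -> v n a <= w a + 2 * e n * M.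
  move=> aM; rewrite -lerBlDr; apply: (ulim_ge (fun n => v_norm n a aM)).
  exists n => // m /= nm; have := tail_norm n m a nm aM.
  rewrite ler_norml => /andP[+ _]; have : 0 <= 2 * e m * M.
    by rewrite !mulr_ge0// ltW.
  lra.
have w_ub' n a : (forall k, `|a k| <= M) -> w a <= v n a + 2 * e n * M.
  by move=> aM; apply: w_ub => // k _; exact: le_trans (ler_norm _) (aM k).
have wb : bounded w.
  by exists (2 * M) => a aM; apply: ulim_norm_le => n; exact: v_norm.
pose s := S w.
(* The terms from [n] to [N], together with the remaining weight placed on [y N], amount to
   [2 * e n] times one mean [z], which is thus a competitor in the choice of [y n]. *)
have telescope n N : (n <= N)%N -> exists2 z, dyadic_mean (n0 + n) z &
    forall a, v N a + 2 * e N * y N a = v n a + 2 * e n * z a.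
  move=> nN; rewrite -(subnK nN); move: (N - n)%N => i {nN}.
  elim: i n => [|i IH] n; first by exists (y n).
  have [z zn zE] := IH n.+1; exists (fun a => (y n a + z a) / 2).
    apply: dyadic_mean_mid => //; apply: dyadic_mean_leq zn.
    by rewrite leq_add2l.
  by move=> a; rewrite addSnnS zE vS (eS n); lra.
have XS n : S (fun a => v n a + 2 * e n * y n a) <= s + d * e n ^+ 2.
  apply: (le_e _ _ (4 * M)) => i; pose N := (n + i)%N.
  have [z zn zE] := telescope n N (leq_addr _ _).
  apply: (le_trans (ymin n z zn)).
  have -> : (fun a => v n a + 2 * e n * z a) = (fun a => v N a + 2 * e N * y N a).
    by apply/funext => a; rewrite zE.
  rewrite -addrA [_ + e i * _]addrC addrA lerD2r; apply: S_le => t.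
  have := w_lb N (h t) (hM t); have := S_ge t wb; rewrite -/s.
  have : e N * y N (h t) <= e N * M.
    rewrite (ler_wpM2l (ltW (e_gt0 N)))//; apply: (dyadic_mean_ub (yn N)) => k _.
    exact: le_trans (ler_norm _) (hM t k).
  have : e N * M <= e i * M.
    by rewrite ler_wpM2r// /e ler_wiXn2l ?leq_addl//; lra.
  lra.
(* At stage 0 the whole weight 2 sits on [y 0], whose supremum is at least [eps] under the
   assumption to be refuted. *)
have s_ge : 2 * eps - d <= s.
  have := XS 0%N; have := big _ (dyadic_mean_leq (leq_addr 0 n0) (yn 0%N)).
  have e0 : e 0%N = 1 by rewrite /e expr0.
  rewrite e0 expr1n => b1 b2.
  suff : S (y 0%N) <= S (fun a => v 0%N a + 2 * 1 * y 0%N a) / 2 by lra.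
  apply: S_le => t; have := S_ge t (bounded_lin (2 * 1) (vb 0%N) (bounded_mean (yn 0%N))).
  by rewrite /=; lra.
(* [v n.+1] is the midpoint of [v n] and the nearly minimal [v n + 2 * e n * y n]. The tolerance
   [d * e n ^+ 2] is exactly what makes this recursion close. *)
have Sv n : S (v n) <= (1 - e n) * s + 2 * d * e n * (1 - e n).
  elim: n => [|n IH].
    by apply: S_le => t; rewrite /e expr0 subrr mul0r mulr0 addr0.
  suff : S (v n.+1) <= S (v n) / 2 + S (fun a => v n a + 2 * e n * y n a) / 2.
    have := XS n; have := eS n; set E := e n.+1; move=> ->; move: IH; rewrite eS -/E.
    nra.
  apply: S_le => t; rewrite vS.
  have := S_ge t (vb n).
  have := S_ge t (bounded_lin (2 * e n) (vb n) (bounded_mean (yn n))).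
  by rewrite /=; lra.
have attain j : exists t, s - e j <= w (h t).
  have wh : has_sup [set w (h t) | t in setT].
    split; first by exists (w (h t0)), t0.
    have [C wC] := wb; exists C => _ [t _ <-]; exact: le_trans (ler_norm _) (wC _ (hM t)).
  by have [_ [t _ <-] /ltW st] := sup_adherent (e_gt0 j) wh; exists t.
have [g gP] := choice attain.
pose a k := ulim (fun j => h (g j) k).
have aM k : `|a k| <= M by apply: ulim_norm_le => j; exact: hM.
have va n : v n a = ulim (fun j => v n (h (g j))).
  elim: n => [|n IH]; first by rewrite /= (@ulim_eventually _ _ 0)//; exact: nearW.
  rewrite vS IH (dyadic_mean_ulim (yn n) (fun j => hM (g j))).
  have yM j : `|y n (h (g j))| <= M by exact: dyadic_mean_norm (yn n) _.
  rewrite -(ulimZ _ yM) -(@ulimD _ _ _ (2 * M) (e n * M))// => j.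
    exact: v_norm.
  by rewrite normrM gtr0_norm// ler_wpM2l// ltW.
have vM n j : `|v n (h (g j))| <= 2 * M by exact: v_norm.
have va_le n : v n a <= S (v n).
  by rewrite va; apply: (ulim_le (vM n)); apply: nearW => j; exact: S_ge.
have va_ge n : s - 2 * e n * M <= v n a.
  apply: (le_e _ _ 1) => i; rewrite -lerBlDr va; apply: (ulim_ge (vM n)).
  exists i => // j /= ij; have := gP j; have := w_ub' n (h (g j)) (hM _).
  have : e j <= e i by rewrite /e ler_wiXn2l//; lra.
  by lra.
have wa_ge : s <= w a.
  apply: (le_e _ _ (4 * M)) => n; have := va_ge n; have := w_lb n a aM; lra.
have d0' : 0 < eps / 4 by lra.
(* Far coordinates of [a] are at most [eps / 4], so the tail of [w a] beyond [K] is at most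
   [e K * eps / 2]. Inserting [Sv] and dividing by [e K] yields [s < eps], against [s_ge]. *)
have [K _ Ka] := h_limsup g d0'.
have := w_ub K a (eps / 4) aM; move=> /(_ _ (ltW d0')) H.
have {H} : w a <= v K a + 2 * e K * (eps / 4).
  by apply: H => k Kk; apply: Ka; rewrite /= (leq_trans _ Kk)// leq_addl.
have := va_le K; have := Sv K; have := e_gt0 K; rewrite /d in s_ge *.
have : e K <= 1 by rewrite /e exprn_ile1; lra.
nra.
Qed.

End Simons.

(** * Functionals and symmetric bases *)

Section DualConstruction.
Context (R : realType) (E : normedModType R).

Lemma dual_of_bounded (f : E -> R) (C : R) : linear f ->
  (forall x, `|f x| <= C * `|x|) -> exists phi : dual E, forall x, phi x = f x.
Proof.
move=> lf fC.
pose L : {linear E -> R} := HB.pack f (GRing.isLinear.Build _ _ _ _ _ lf).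
have fP : f \in @dual_pred R E.
  apply/asboolP; split => //.
  apply: (@bounded_linear_continuous _ _ _ L); apply/linear_boundedP.
  exists C; split => [|r Cr x]; first exact: num_real.
  by apply: (le_trans (fC x)); rewrite ler_wpM2r// ltW.
by exists (Dual fP).
Qed.

End DualConstruction.

Section BidualLimit.
Context (R : realType) (E : normedModType R).

(** A sequential substitute for weak* compactness of balls of the bidual: the ultralimit of the
    values is linear and bounded in [phi]. *)
Lemma bidual_ulim (x : nat -> E) (M : R) : (forall n, `|x n| <= M) ->
  exists F : dual (dual E), forall phi : dual E, F phi = ulim (fun n => phi (x n)).
Proof.
move=> xM; have phiM (phi : dual E) n : `|phi (x n)| <= opnorm phi * M.
  apply: (le_trans (opnormP phi _)); rewrite ler_wpM2l//.
  exact: (@normr_ge0 _ _ phi).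
suff [] : linear (fun phi : dual E => ulim (fun n => phi (x n))) /\
    forall phi : dual E, `|ulim (fun n => phi (x n))| <= M * `|phi|.
  by move=> l b; exact: (dual_of_bounded l b).
split=> [k phi psi|phi].
  rewrite -[k *: ulim _]/(k * _) -(ulimZ k (phiM phi)) -(@ulimD _ _ _ (`|k| * (opnorm phi * M)) _ _ (phiM psi))//.
  by move=> n; rewrite normrM ler_wpM2l.
by rewrite mulrC; apply: ulim_norm_le.
Qed.

Lemma hahn_banach_norm (x0 : E) : exists phi : dual E,
  (forall x, `|phi x| <= `|x|) /\ phi x0 = `|x0|.
Proof.
have ns : sublinear (fun x : E => `|x|).
  by split=> [|k x k0]; [exact: ler_normD|rewrite normrZ ger0_norm].
have [f [fn fx0]] := hahn_banach x0 ns.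
have fb x : `|f x| <= 1 * `|x|.
  by rewrite mul1r ler_norml fn andbT lerNl -linearN (le_trans (fn _))// normrN.
have [phi phiE] := dual_of_bounded (linearP f) fb.
by exists phi; split => [x|]; rewrite phiE// (le_trans (fb x))// mul1r.
Qed.

End BidualLimit.

(** Symmetry of the basis is stated for permutations of all naturals, while intervals are placed by
    injections. Each new value is corrected by composing with one transposition. *)
Lemma injection_extends_to_bijection (n : nat) (k : nat -> nat) :
  {in [pred i | i < n]%N &, injective k} ->
  exists2 p : nat -> nat, bijective p & forall i, (i < n)%N -> p i = k i.
Proof.
elim: n => [|n IH] inj; first by exists id => //; exact: (Bijective (g := id)).
have [|p bp pk] := IH.
  by move=> i j; rewrite !inE => ip jp; apply: inj; rewrite inE ltnW.
pose t (x y z : nat) := if z == x then y else if z == y then x else z.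
have tK x y : involutive (t x y).
  move=> z; rewrite /t; case: (eqVneq z x) => [->|zx].
    by rewrite eqxx; case: eqVneq.
  by case: (eqVneq z y) => [->|zy]; rewrite ?eqxx// (negbTE zx) (negbTE zy).
exists (t (p n) (k n) \o p).
  by apply: bij_comp bp; exists (t (p n) (k n)); exact: tK.
move=> i; rewrite ltnS leq_eqVlt => /predU1P[->|ni]; first by rewrite /= /t eqxx.
rewrite /= /t ifF; last first.
  by apply/negbTE; rewrite (bij_eq bp) ltn_eqF.
rewrite ifF ?pk//; apply/negbTE/eqP => /inj; rewrite !inE ltnSn ltnS (ltnW ni).
by move=> /(_ isT isT) ini; rewrite ini ltnn in ni.
Qed.

Section BasisNorm.
Context (R : realType) (X : normedModType R) (e : symmetric_basis X).

Lemma norm_basis_reindex (n : nat) (a : nat -> R) (k : nat -> nat) :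
  {in [pred i | i < n]%N &, injective k} ->
  `|\sum_(i < n) a i *: e (k i)| = `|\sum_(i < n) a i *: e i|.
Proof.
move=> /injection_extends_to_bijection[p bp pk].
rewrite -(@basis_one_symmetric _ _ e n a (fun=> false) p bp); congr `|_|.
by apply: eq_bigr => i _; rewrite expr0 mul1r pk.
Qed.

(** Coordinates are replaced one at a time: if [a m = t * b m] with [|t| <= 1], the new vector is a
    convex combination, with weights [(1 + t) / 2] and [(1 - t) / 2], of the old one and its sign
    flip at [m], which have equal norms. *)
Lemma norm_basis_abs_le (n : nat) (a b : nat -> R) :
  (forall i, (i < n)%N -> `|a i| <= `|b i|) ->
  `|\sum_(i < n) a i *: e i| <= `|\sum_(i < n) b i *: e i|.
Proof.
move=> ab; pose c m i := if (i < m)%N then a i else b i.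
suff H m : (m <= n)%N -> `|\sum_(i < n) c m i *: e i| <= `|\sum_(i < n) b i *: e i|.
  have := H n (leqnn n); congr (`|_| <= _).
  by apply: eq_bigr => i _; rewrite /c ltn_ord.
elim: m => [|m IH] mn; first by rewrite le_eqVlt; apply/orP; left.
apply: le_trans (IH (ltnW mn)); pose j := Ordinal mn.
have flip : `|\sum_(i < n) (if i == j then - c m i else c m i) *: e i|
    = `|\sum_(i < n) c m i *: e i|.
  have := @basis_one_symmetric _ _ e n (c m) (fun i => i == m) id (Bijective (fun=> erefl) (fun=> erefl)).
  move=> <-; congr `|_|; apply: eq_bigr => i _; congr (_ *: _).
  by rewrite -(inj_eq val_inj)/=; case: eqP => _; rewrite ?mulN1r ?mul1r.
have [t t1 at_b] : exists2 t, `|t| <= 1 & a m = t * b m.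
  have [b0|b0] := eqVneq (b m) 0.
    exists 0; rewrite ?normr0// mul0r; apply/eqP; rewrite -normr_le0.
    by rewrite (le_trans (ab m mn))// b0 normr0.
  exists (a m / b m); last by rewrite divfK.
  by rewrite normrM normfV ler_pdivrMr ?normr_gt0// mul1r ab.
set u := \sum_(i < n) _ *: _ in flip; set v := \sum_(i < n) _ *: _ in flip.
have -> : \sum_(i < n) c m.+1 i *: e i = ((1 - t) / 2) *: u + ((1 + t) / 2) *: v.
  rewrite /u /v !scaler_sumr -big_split; apply: eq_bigr => i _ /=.
  rewrite !scalerA -scalerDl; congr (_ *: _); rewrite /c.
  case: (eqVneq i j) => [->|ij] /=; first by rewrite ltnSn ltnn at_b; lra.
  rewrite ltnS leq_eqVlt; have /negbTE -> /= : val i != m by rewrite -[m]/(val j) (inj_eq val_inj).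
  by lra.
rewrite (le_trans (ler_normD _ _))// !normrZ flip -mulrDl.
have : -1 <= t <= 1 by rewrite -ler_norml.
move=> /andP[t1' t1''].
have -> : `|1 - t| = 1 - t by rewrite ger0_norm//; lra.
have -> : `|1 + t| = 1 + t by rewrite ger0_norm//; lra.
rewrite (_ : `|2^-1| = 2^-1) ?ger0_norm ?invr_ge0//.
have -> : (1 - t) / 2 + (1 + t) / 2 = 1 by lra.
by rewrite mul1r.
Qed.

(** By symmetry the positions of the coefficients do not matter, so a bare list suffices and
    sublists need no reindexing. *)
Definition bnorm (l : seq R) : R := `|\sum_(i < size l) l`_i *: e i|.

Lemma bnorm_ge0 l : 0 <= bnorm l. Proof. exact: normr_ge0. Qed.

Lemma bnorm_insert0 l1 l2 : bnorm (l1 ++ 0 :: l2) = bnorm (l1 ++ l2).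
Proof.
rewrite /bnorm; set n := size (l1 ++ l2).
have sz : size (l1 ++ 0 :: l2) = n.+1 by rewrite /n !size_cat /= addnS.
have szn : (size l1 < n.+1)%N by rewrite ltnS /n size_cat leq_addr.
rewrite sz (bigD1_ord (Ordinal szn))//= nth_cat ltnn subnn scale0r add0r.
rewrite -(@norm_basis_reindex n (nth 0 (l1 ++ l2)) (bump (size l1))); last first.
  by move=> i j _ _; rewrite /bump; do 2 case: leqP => ?; lia.
congr `|_|; apply: eq_bigr => i _; congr (_ *: _).
rewrite !nth_cat /bump; case: (leqP (size l1) i) => i1.
  by rewrite add1n ltnNge leqW//= subSn//= ltnNge i1.
by rewrite add0n i1.
Qed.

Lemma bnorm_map_le (T : eqType) (l : seq T) (u v : T -> R) :
  (forall x, x \in l -> `|u x| <= `|v x|) -> bnorm (map u l) <= bnorm (map v l).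
Proof.
move=> uv; rewrite /bnorm !size_map; apply: norm_basis_abs_le => i il.
case: l uv il => [//|x0 l] uv il.
by rewrite !(nth_map x0)//; apply: uv; rewrite mem_nth.
Qed.

Lemma bnorm_mapD (T : Type) (l : seq T) (u v : T -> R) :
  bnorm (map (fun x => u x + v x) l) <= bnorm (map u l) + bnorm (map v l).
Proof.
rewrite /bnorm !size_map (le_trans _ (ler_normD _ _))// -big_split/=.
rewrite le_eqVlt; apply/orP; left; apply/eqP; congr `|_|; apply: eq_bigr => i _.
by case: l i => [|x0 l] i; [case: i|rewrite !(nth_map x0)// -scalerDl].
Qed.

Lemma bnorm_mapZ (T : Type) (l : seq T) k (u : T -> R) :
  bnorm (map (fun x => k * u x) l) = `|k| * bnorm (map u l).
Proof.
rewrite /bnorm !size_map -normrZ scaler_sumr; congr `|_|; apply: eq_bigr => i _.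
by case: l i => [|x0 l] i; [case: i|rewrite !(nth_map x0)// scalerA].
Qed.

Lemma bnorm_map_filter (T : Type) (l : seq T) (P : pred T) (u : T -> R) :
  bnorm (map u [seq x <- l | P x]) = bnorm (map (fun x => if P x then u x else 0) l).
Proof.
suff H p : bnorm (p ++ map u [seq x <- l | P x]) =
    bnorm (p ++ map (fun x => if P x then u x else 0) l) by exact: (H [::]).
elim: l p => [//|x l IH] p /=; case: ifPn => Px /=; first by rewrite -!cat_rcons IH.
by rewrite bnorm_insert0 IH.
Qed.

Lemma bnorm_cat_le l1 l2 m : bnorm (l1 ++ l2) <= bnorm (l1 ++ m ++ l2).
Proof.
elim: m => [//|x m IH]; apply: (le_trans IH).
rewrite -bnorm_insert0 /bnorm !size_cat/= !size_cat; apply: norm_basis_abs_le => i _.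
rewrite !nth_cat; case: ltnP => // il; case: (i - size l1)%N => [|j] //=.
by rewrite normr0.
Qed.

Lemma bnorm_subseq l m : subseq l m -> bnorm l <= bnorm m.
Proof.
suff H p : subseq l m -> bnorm (p ++ l) <= bnorm (p ++ m) by exact: (H [::]).
elim: m l p => [|x m IH] l p; first by rewrite subseq0 => /eqP ->.
case: l => [|y l] /=; first by rewrite cats0 -{1}[p]cats0 -{1}[x :: m]cats0 => _; exact: bnorm_cat_le.
case: eqP => [->|_] lm; first by rewrite -!cat_rcons; exact: IH.
by apply: (le_trans (IH _ p lm)); rewrite -[x :: m]/([:: x] ++ m); exact: bnorm_cat_le.
Qed.

Lemma bnorm_map_filter_le (T : eqType) (l : seq T) (P : pred T) (u : T -> R) :
  bnorm (map u [seq x <- l | P x]) <= bnorm (map u l).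
Proof. by apply: bnorm_subseq; apply: map_subseq; exact: filter_subseq. Qed.

Lemma bnorm_map_split (T : Type) (l : seq T) (P : pred T) (u : T -> R) :
  bnorm (map u l) <= bnorm (map u [seq x <- l | P x]) + bnorm (map u [seq x <- l | ~~ P x]).
Proof.
rewrite !bnorm_map_filter (le_trans _ (bnorm_mapD _ _ _))//.
rewrite le_eqVlt; apply/orP; left; apply/eqP; congr bnorm; apply: eq_map => x /=.
by case: (P x); rewrite ?addr0 ?add0r.
Qed.

Lemma norm_basisE n : `|e n| = `|e 0%N|.
Proof.
have := @norm_basis_reindex 1 (fun=> 1) (fun=> n).
rewrite !big_ord1 !scale1r; apply.
by move=> i j; rewrite !inE !ltnS !leqn0 => /eqP -> /eqP ->.
Qed.

Lemma norm_basis_gt0 : 0 < `|e 0%N|.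
Proof. by rewrite normr_gt0 basis_neq0. Qed.

Lemma bnorm_map_le_size (T : eqType) (l : seq T) (u : T -> R) c :
  (forall x, x \in l -> `|u x| <= c) -> bnorm (map u l) <= (size l)%:R * c * `|e 0%N|.
Proof.
move=> uc; rewrite /bnorm size_map (le_trans (ler_norm_sum _ _ _))//.
have -> : (size l)%:R * c * `|e 0%N| = \sum_(i < size l) c * `|e 0%N|.
  by rewrite sumr_const card_ord -[RHS]mulr_natl mulrA.
apply: ler_sum => i _; rewrite normrZ norm_basisE ler_wpM2r//.
case: l uc i => [|x0 l] uc i; first by case: i.
by rewrite (nth_map x0)//; apply: uc; rewrite mem_nth.
Qed.

Lemma bnorm_map_ge (T : eqType) (l : seq T) (u : T -> R) x :
  x \in l -> `|u x| * `|e 0%N| <= bnorm (map u l).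
Proof.
move=> xl; have : subseq [:: x] l by rewrite sub1seq.
move=> /(map_subseq u)/bnorm_subseq; apply: le_trans.
by rewrite /bnorm big_ord1 normrZ.
Qed.

Lemma bnorm_map_ge_nseq (T : eqType) (l : seq T) (u : T -> R) c : 0 <= c ->
  (forall x, x \in l -> c <= `|u x|) -> c * bnorm (nseq (size l) 1) <= bnorm (map u l).
Proof.
move=> c0 cu; apply: le_trans (@bnorm_map_le _ l (fun=> c * 1) u _); last first.
  by move=> x xl; rewrite mulr1 ger0_norm ?cu.
rewrite bnorm_mapZ ger0_norm// le_eqVlt; apply/orP; left; apply/eqP; congr (_ * bnorm _).
by elim: l {cu} => [//|x l /= ->].
Qed.

Lemma bnorm_map_mean (T : Type) (l : seq T) n y (r : nat -> T -> R) :
  dyadic_mean n y ->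
  bnorm (map (fun x => y (fun k => r k x)) l) <= y (fun k => bnorm (map (r k) l)).
Proof.
elim => [//|{}y z _ IHy _ IHz].
have -> : [seq (y (r^~ x) + z (r^~ x)) / 2 | x <- l]
    = [seq 2^-1 * (y (r^~ x) + z (r^~ x)) | x <- l].
  by apply: eq_map => x; rewrite mulrC.
rewrite bnorm_mapZ ger0_norm ?invr_ge0// mulrC ler_pM2r ?invr_gt0//.
by rewrite (le_trans (bnorm_mapD _ _ _))// lerD.
Qed.

End BasisNorm.

(** * Coordinate functionals, and blocks in a reflexive space *)

Section Coordinates.
Context (R : realType) (X : normedModType R) (e : symmetric_basis X).

Definition coord (x : X) : nat -> R := sval (cid (basis_schauder e x)).

Lemma coord_cvg x : series (fun n => coord x n *: e n) @ \oo --> x.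
Proof. by rewrite /coord; case: cid => a []. Qed.

Lemma coord_unique x a : series (fun n => a n *: e n) @ \oo --> x -> coord x = a.
Proof. by rewrite /coord; case: cid => b [_ bu] /= /bu. Qed.

Lemma coord_linear i : linear (coord^~ i).
Proof.
move=> k x y; suff -> : coord (k *: x + y) = (fun i => k * coord x i + coord y i) by [].
apply: coord_unique.
rewrite (_ : series _ = fun n => k *: series (fun n => coord x n *: e n) n
    + series (fun n => coord y n *: e n) n); last first.
  apply/funext => n; rewrite /series/= scaler_sumr -big_split/=.
  by apply: eq_bigr => j _; rewrite scalerDl scalerA.
by apply: cvgD; [apply: cvgZl_tmp|]; exact: coord_cvg.
Qed.

Lemma coord_basis j i : coord (e j) i = (i == j)%:R.
Proof.
suff -> : coord (e j) = (fun i => (i == j)%:R) by [].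
apply: coord_unique; apply: cvg_near_cst; exists j.+1 => // n /= jn.
rewrite /series/= big_mkord (bigD1 (Ordinal jn))//= eqxx scale1r.
rewrite big1 ?addr0// => k kj; rewrite (_ : (k == j :> nat) = false) ?scale0r//.
by apply/negbTE; move: kj; rewrite -(inj_eq val_inj).
Qed.

Lemma coord_sum_le x (s : seq nat) : uniq s ->
  `|\sum_(i <- s) coord x i *: e i| <= `|x|.
Proof.
move=> us; apply: (cvgr_to_ge (cvg_norm (@coord_cvg x))).
exists (\max_(i <- s) i).+1 => // n /= sn.
have -> : \sum_(i <- s) coord x i *: e i
    = \sum_(i < n) (if (i : nat) \in s then coord x i else 0) *: e i.
  rewrite -(big_mkord xpredT (fun i => (if i \in s then coord x i else 0) *: e i)).
  rewrite [RHS](eq_bigr (fun i => if i \in s then coord x i *: e i else 0)); last first.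
    by move=> i _; case: ifP => // _; rewrite scale0r.
  rewrite -[RHS]big_mkcond -[RHS]big_filter; apply: perm_big; apply: uniq_perm => //.
    by rewrite filter_uniq// iota_uniq.
  move=> i; rewrite mem_filter mem_index_iota leq0n/=.
  case: (boolP (i \in s)) => // si; rewrite (leq_ltn_trans _ sn)//.
  by rewrite (big_rem i)//= leq_maxl.
rewrite /series/= big_mkord; pose a i := if i \in s then coord x i else 0.
apply: (@norm_basis_abs_le _ _ e n a (coord x)) => i _; rewrite /a.
by case: ifP => //; rewrite normr0.
Qed.

Lemma coord_le x i : `|coord x i| * `|e 0%N| <= `|x|.
Proof.
have := @coord_sum_le x [:: i] isT.
by rewrite big_seq1 normrZ (norm_basisE e i).
Qed.

Lemma coord_dual i : exists phi : dual X, forall x, phi x = coord x i.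
Proof.
apply: (@dual_of_bounded _ _ (coord^~ i) (`|e 0%N|^-1)); first exact: coord_linear.
by move=> x; rewrite mulrC ler_pdivlMr ?norm_basis_gt0// coord_le.
Qed.

Lemma coord_eq0 x : (forall i, coord x i = 0) -> x = 0.
Proof.
move=> x0; apply/esym; have := @coord_cvg x; apply: cvg_unique => //.
apply: cvg_near_cst; apply: nearW => n; rewrite /series/= big1// => i _.
by rewrite x0 scale0r.
Qed.

Lemma coord_sum (I : Type) (s : seq I) (a : I -> R) (k : I -> nat) i :
  coord (\sum_(j <- s) a j *: e (k j)) i = \sum_(j <- s) a j * (i == k j)%:R.
Proof.
have [phi phiE] := coord_dual i.
rewrite -phiE linear_sum; apply: eq_bigr => j _.
by rewrite linearZ/= phiE coord_basis.
Qed.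

Hypothesis Xrefl : reflexive_space X.

(** Otherwise an ultralimit of the sums of the first [n] basis vectors would be, by reflexivity, a
    vector of [X] with all coordinates 1, whose expansion cannot converge. *)
Lemma bnorm_nseq_unbounded C : exists N, C < bnorm e (nseq N 1).
Proof.
apply: contrapT => /forallNP H.
pose x n := \sum_(0 <= j < n) 1 *: e j.
have xE n : `|x n| = bnorm e (nseq n 1).
  rewrite /x /bnorm size_nseq big_mkord; congr `|_|.
  by apply: eq_bigr => i _; rewrite nth_nseq ltn_ord.
have xC n : `|x n| <= C by rewrite xE leNgt; apply/negP; exact: H.
have [F FE] := bidual_ulim xC; have [y Fy] := Xrefl F.
have y1 i : coord y i = 1.
  have [phi phiE] := coord_dual i.
  rewrite -phiE -[phi y]/(evaluation y phi) -Fy FE; apply: ulim_eventually.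
  exists i.+1 => // n /= ni; rewrite phiE /x coord_sum.
  rewrite (bigD1_seq i) ?iota_uniq ?mem_index_iota//= eqxx mulr1 big1 ?addr0// => j ji.
  by rewrite eq_sym (negbTE ji) mulr0.
have : series (fun n => coord y n *: e n) @ \oo --> y by exact: coord_cvg.
move=> yc; have /cvg_series_cvg_0 : cvgn (series (fun n => coord y n *: e n)).
  by apply/cvg_ex; exists y.
move=> /cvgr0Pnorm_lt/(_ _ (norm_basis_gt0 e))[n _ /(_ n (leqnn _))].
by rewrite y1 scale1r (norm_basisE e n) ltxx.
Qed.

(* Bounded block sequences are weakly null in a reflexive space; the functionals
   and the blocks are first replaced by ultralimits. *)
Lemma block_pairing_limsup (S : nat -> seq nat) (b : nat -> nat -> R)
    (xi : nat -> dual X) (M : R) :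
  (forall s, \forall k \near \oo, s \notin S k) -> (forall k, uniq (S k)) ->
  (forall j x, `|xi j x| <= `|x|) ->
  (forall j k, `|\sum_(s <- S k) b j s *: e s| <= M) ->
  forall eps, 0 < eps ->
    \forall k \near \oo, ulim (fun j => xi j (\sum_(s <- S k) b j s *: e s)) <= eps.
Proof.
move=> Sinf Su xi1 bM eps eps0.
have [x xE] : exists x : dual X, forall z, x z = ulim (fun j => xi j z).
  apply: (@dual_of_bounded _ _ (fun z => ulim (fun j => xi j z)) 1).
    move=> k y z; rewrite -[k *: ulim _]/(k * _) -(ulimZ k (xi1^~ y)).
    rewrite -(@ulimD _ _ _ (`|k| * `|y|) _ _ (xi1^~ z)); last first.
      by move=> j; rewrite normrM ler_wpM2l.
    by congr ulim; apply/funext => j; rewrite linearP.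
  by move=> z; rewrite mul1r; apply: ulim_norm_le => j; exact: xi1.
have bB k s j : s \in S k -> `|b j s| <= M / `|e 0%N|.
  move=> sS; rewrite ler_pdivlMr ?norm_basis_gt0//; apply: le_trans (bM j k).
  rewrite -[b j s](_ : coord (\sum_(s <- S k) b j s *: e s) s = _) ?coord_le//.
  rewrite (coord_sum (S k) (b j) id) (bigD1_seq s)//= eqxx mulr1 big1 ?addr0// => i si.
  by rewrite eq_sym (negbTE si) mulr0.
pose b' s := ulim (b^~ s).
pose y k := \sum_(s <- S k) b' s *: e s.
(* For fixed [k] the sum is finite, so the ultralimit of the products splits into ultralimits of
   coefficients and of functionals. *)
have pairing (phi : nat -> dual X) (psi : X -> R) k : (forall j z, `|phi j z| <= `|z|) ->
    (forall z, psi z = ulim (fun j => phi j z)) ->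
    ulim (fun j => phi j (\sum_(s <- S k) b j s *: e s)) = \sum_(s <- S k) b' s * psi (e s).
  move=> phi1 psiE; apply: ulim_unique.
  rewrite (_ : (fun j => _) = fun j => \sum_(s <- S k) b j s * phi j (e s)); last first.
    apply/funext => j; rewrite linear_sum; apply: eq_bigr => s _.
    by rewrite linearZ.
  under eq_cvg do rewrite big_seq.
  rewrite big_seq; apply: cvg_big => [|s sS]; first exact: add_continuous.
  apply: cvgM; first by apply: (@ulim_cvg _ _ (M / `|e 0%N|)) => j; exact: (bB k).
  by rewrite psiE; exact: ulim_cvg (fun j => phi1 j (e s)).
have yM k : `|y k| <= M.
  have [phi [phi1 phiy]] := hahn_banach_norm (y k).
  rewrite -phiy /y linear_sum.
  rewrite (eq_bigr (fun s => b' s * phi (e s))); last by move=> s _; rewrite linearZ.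
  rewrite -(pairing (fun=> phi) phi k) //; last first.
    by move=> z; rewrite (@ulim_eventually _ _ (phi z))//; exact: nearW.
  rewrite (le_trans (ler_norm _))//; apply: ulim_norm_le => j.
  exact: le_trans (phi1 _) (bM j k).
have xy k : x (y k) = ulim (fun j => xi j (\sum_(s <- S k) b j s *: e s)).
  rewrite (pairing xi x k)// /y linear_sum; apply: eq_bigr => s _.
  by rewrite linearZ.
(* Otherwise blocks [y (kap m)] with [kap m >= m] pair with [x] above [eps]. Their weak ultralimit
   lies in [X] and has only zero coordinates, as each index leaves the supports. *)
apply: contrapT => nev.
have /choice[kap kapP] : forall m, exists k, (m <= k)%N /\ eps < x (y k).
  move=> m; apply: contrapT => /forallNP H; apply: nev; exists m => // k /= mk.
  by rewrite -xy leNgt; apply/negP => ek; apply: (H k).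
have [F FE] := bidual_ulim (fun m => yM (kap m)); have [z Fz] := Xrefl F.
have z0 : z = 0.
  apply: coord_eq0 => i; have [phi phiE] := coord_dual i.
  rewrite -phiE -[phi z]/(evaluation z phi) -Fz FE; apply: ulim_eventually.
  have [K _ KS] := Sinf i; exists K => // m /= Km.
  rewrite phiE /y (coord_sum _ b' id) big_seq big1// => s sS.
  case: eqP => [is_|]; last by rewrite mulr0.
  by have := KS (kap m) (leq_trans Km (kapP m).1); rewrite is_ sS.
have : eps <= F x.
  rewrite FE; apply: (@ulim_ge _ _ (opnorm x * M)).
    by move=> m; rewrite (le_trans (opnormP _ _))// ler_wpM2l//; exact: (@normr_ge0 _ _ x).
  by apply: nearW => m; exact: ltW (kapP m).2.
by rewrite Fz /= z0 linear0 leNgt eps0.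
Qed.

End Coordinates.

(** * Families of disjoint intervals *)

Section IntervalFamilies.
Context (R : realType).
Notation I := (unit_interval R).
Implicit Types (p a b : I) (x : I * I) (l : seq (I * I)) (f g : I -> R).

Definition incr f x : R := f x.2 - f x.1.

Definition len x : R := val x.2 - val x.1.

(* fam p l: the intervals of l are nondegenerate, lie to the right of p, and
   are listed from left to right with disjoint interiors. *)
Fixpoint fam p l : bool :=
  if l is x :: l' then (val p <= val x.1) && (val x.1 < val x.2) && fam x.2 l'
  else true.

Lemma val_ge0 a : 0 <= val a.
Proof. by have := valP a; rewrite inE/= in_itv/= => /andP[]. Qed.

Lemma val_le1 a : val a <= 1.
Proof. by have := valP a; rewrite inE/= in_itv/= => /andP[]. Qed.

Lemma unit_interval_pt (t : R) : 0 <= t -> t <= 1 -> exists a, val a = t.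
Proof.
move=> t0 t1; have tI : t \in `[0 : R, 1]%classic by rewrite inE/= in_itv/= t0.
by exists (exist _ t tI).
Qed.

Lemma fam_weaken p q l : val q <= val p -> fam p l -> fam q l.
Proof.
by case: l => [//|x l] qp /= /andP[/andP[px ->] ->]; rewrite (le_trans qp px).
Qed.

Lemma fam_filter P p l : fam p l -> fam p [seq x <- l | P x].
Proof.
elim: l p => [//|x l IH] p /= /andP[/andP[px xx] xl]; case: ifP => _ /=.
  by rewrite px xx IH.
by apply: (@fam_weaken x.2); rewrite ?IH// (le_trans px)// ltW.
Qed.

Lemma fam_lt p l x : fam p l -> x \in l -> val x.1 < val x.2.
Proof.
elim: l p => [//|y l IH] p /= /andP[/andP[_ yy] yl].
by rewrite inE => /predU1P[->//|]; exact: IH yl.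
Qed.

Lemma fam_ge p l x : fam p l -> x \in l -> val p <= val x.1.
Proof.
elim: l p => [//|y l IH] p /= /andP[/andP[py yy] yl].
rewrite inE => /predU1P[->//|/(IH _ yl)]; apply: le_trans.
by rewrite (le_trans py)// ltW.
Qed.

Lemma fam_long_size p l (d : R) : fam p l -> (forall x, x \in l -> d <= len x) ->
  (size l)%:R * d <= 1 - val p.
Proof.
elim: l p => [|y l IH] p /=; first by rewrite mul0r subr_ge0 val_le1.
move=> /andP[/andP[py yy] yl] ld.
have := IH _ yl (fun x xl => ld x (@mem_behead _ (y :: l) x xl)).
have := ld y (mem_head _ _); rewrite /len -(natr1 (size l)) /=; lra.
Qed.

Lemma fam_uniq p l : fam p l -> uniq l.
Proof.
elim: l p => [//|y l IH] p /= /andP[/andP[py yy] yl].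
rewrite (IH _ yl) andbT; apply/negP => /(fam_ge yl).
by rewrite leNgt yy.
Qed.

Lemma fam_inj_left p l x y : fam p l -> x \in l -> y \in l ->
  val x.1 < val y.2 -> val y.1 < val x.2 -> x = y.
Proof.
elim: l p => [//|z l IH] p /= /andP[/andP[pz zz] zl].
rewrite !inE => /predU1P[->|xl] /predU1P[->|yl] //; last exact: IH zl xl yl.
  by have := fam_ge zl yl; move=> /le_lt_trans h _ /h; rewrite ltxx.
by have := fam_ge zl xl; move=> /le_lt_trans h /h; rewrite ltxx.
Qed.

Let pairs p (s : seq I) := zip (p :: s) s.

Let pairs_cat p s q s' : pairs p (s ++ q :: s') =
  pairs p s ++ (last p s, q) :: pairs q s'.
Proof. by elim: s p => [//|a s IH] p /=; rewrite /pairs /= -/(pairs _ _) IH. Qed.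

Let chain (d : R) : rel I := fun a b => (val a < val b) && (val b - val a <= d).

Let chain_to d p a : 0 < d -> val p <= val a ->
  exists2 s, path (chain d) p s & last p s = a.
Proof.
move=> d0 pa; have [n pan] : exists n, val a - val p <= n%:R * d.
  exists (Num.truncn ((val a - val p) / d)).+1.
  by rewrite -ler_pdivrMr// ltW// truncnS_gt.
elim: n p pa pan => [|n IH] p pa pan.
  exists [::] => //=; apply/val_inj/eqP; rewrite eq_le pa/=.
  by move: pan; rewrite mul0r subr_le0.
have [ap|ap] := leP (val a - val p) d.
  move: pa; rewrite le_eqVlt => /predU1P[/val_inj ->|pa]; first by exists [::].
  by exists [:: a] => //=; rewrite /chain pa ap.
have [||q qE] := @unit_interval_pt (val p + d).
- by rewrite addr_ge0 ?val_ge0// ltW.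
- by have := val_le1 a; lra.
have [||s sp sl] := IH q.
- by rewrite qE; lra.
- by move: pan; rewrite qE -(natr1 n); lra.
by exists (q :: s) => //=; rewrite sp andbT /chain qE; apply/andP; split; lra.
Qed.

(** The gaps between the intervals are subdivided into steps of length at most [d], so [l] becomes a
    sublist of the cells of a fine chain ending at 1. *)
Let fam_chain d p l : 0 < d -> fam p l -> (forall x, x \in l -> len x <= d) ->
  exists s, [/\ path (chain d) p s, last p s = oneI R & subseq l (pairs p s)].
Proof.
move=> d0; elim: l p => [|x l IH] p.
  move=> _ _; have [|s sp sl] := chain_to d0 (_ : val p <= val (oneI R)).
    exact: val_le1.
  by exists s; split => //; exact: sub0seq.
move=> /= /andP[/andP[px xx] xl] ld.
have [s1 s1p s1l] := chain_to d0 px.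
have [s2 [s2p s2l s2s]] := IH _ xl (fun y yl => ld y (@mem_behead _ (x :: l) y yl)).
exists (s1 ++ x.2 :: s2); rewrite cat_path last_cat /= s1p s1l s2p s2l.
split => //; first by rewrite /chain xx andbT ld ?mem_head.
rewrite pairs_cat s1l -[x :: l]cat0s cat_subseq ?sub0seq//= -surjective_pairing.
by rewrite eqxx.
Qed.

Context (X : normedModType R) (e : symmetric_basis X).

Definition dvar f l : R := bnorm e (map (incr f) l).

Lemma fam_partition s : partition01 s -> fam (zeroI R) (zip (zeroI R :: s) s).
Proof.
have H p s' : path <%R (val p) (map val s') -> fam p (zip (p :: s') s').
  elim: s' p => [//|a s' IH] p /=.
  by move=> /andP[pa /IH ->]; rewrite lexx pa.
by move=> [/(H (zeroI R))].
Qed.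

Lemma alphaX_dvar f s : alphaX e f s = dvar f (zip (zeroI R :: s) s).
Proof.
rewrite /alphaX /dvar /bnorm size_map size_zip /= (minn_idPr _)//; congr `|_|.
apply: eq_bigr => i _; congr (_ *: _).
rewrite (nth_map (zeroI R, zeroI R)) ?size_zip/= ?(minn_idPr _)//.
rewrite /incr /right_pt /left_pt -(nth_take (n0 := size s) _ (ltn_ord i) (_ :: _)).
have -> : zip (zeroI R :: s) s = zip (take (size s) (zeroI R :: s)) s.
  by elim: s (zeroI R) {i} => [//|a s IH] p /=; rewrite -IH.
by rewrite nth_zip// size_takel//=.
Qed.

(** Completing a family to a partition only adds coefficients, which cannot lower the norm. This
    lets families replace partitions, also at small mesh. *)
Lemma dvar_le_partition d l : 0 < d -> fam (zeroI R) l ->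
  (forall x, x \in l -> len x <= d) ->
  exists2 s, partition01 s /\ mesh s <= d & forall f, dvar f l <= alphaX e f s.
Proof.
move=> d0 lf ld; have [s [sp sl ls]] := fam_chain d0 lf ld.
exists s; last first.
  by move=> f; rewrite alphaX_dvar; apply: bnorm_subseq; apply: map_subseq.
split; first split.
- suff : path <%R (val (zeroI R)) (map val s) by [].
  by rewrite path_map; apply: sub_path sp => a b /= /andP[].
- suff : last (val (zeroI R)) (map val s) == 1 by [].
  by rewrite last_map sl.
- apply: bigmax_le; first exact: ltW.
  by move=> i _; have /andP[] := pathP (zeroI R) sp i (ltn_ord i).
Qed.

Lemma len_le1 x : len x <= 1.
Proof. by rewrite /len; have := val_ge0 x.1; have := val_le1 x.2; lra. Qed.

Lemma dvar_le_VX0_norm (f : VX0 e) l : fam (zeroI R) l -> dvar f l <= `|f|.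
Proof.
move=> lf; have [s [sp _] fs] := dvar_le_partition ltr01 lf (fun x _ => len_le1 x).
apply: (le_trans (fs f)); rewrite -lee_fin -[(`|f|)%:E]/((VX0_norm f)%:E) VX0_normE.
by apply: ereal_sup_ubound; exists s.
Qed.

Lemma VX0_norm_le (f : VX0 e) C : (forall l, fam (zeroI R) l -> dvar f l <= C) ->
  `|f| <= C.
Proof.
move=> fC; rewrite -lee_fin -[(`|f|)%:E]/((VX0_norm f)%:E) VX0_normE.
apply: ge_ereal_sup => _ [s sp <-]; rewrite lee_fin alphaX_dvar.
exact/fC/fam_partition.
Qed.

Lemma dvar_fine f eps : VX0_set e f -> 0 < eps -> exists2 d, 0 < d &
  forall l, fam (zeroI R) l -> (forall x, x \in l -> len x <= d) -> dvar f l <= eps.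
Proof.
move=> [_ fl] eps0.
have : nbhs 0%E [set y : \bar R | (y < eps%:E)%E].
  by apply: open_nbhs_nbhs; split; [exact: open_ereal_lt_ereal|rewrite /= lte_fin].
move=> /fl [d /= d0 df]; exists (d / 2); first by rewrite divr_gt0.
move=> l lf ld; have d20 : 0 < d / 2 by rewrite divr_gt0.
have [s sp fs] := dvar_le_partition d20 lf ld.
apply: (le_trans (fs f)); rewrite -lee_fin.
apply: (@le_trans _ _ (mesh_alphaX e f (d / 2))).
  by apply: ereal_sup_ubound; exists s.
apply: ltW; apply: df => //=; rewrite sub0r normrN gtr0_norm//; lra.
Qed.

Lemma VX0_set_fine f : f (zeroI R) = 0 ->
  (exists M, forall l, fam (zeroI R) l -> dvar f l <= M) ->
  (forall eps, 0 < eps -> exists2 d, 0 < d & forall l, fam (zeroI R) l ->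
    (forall x, x \in l -> len x <= d) -> dvar f l <= eps) -> VX0_set e f.
Proof.
move=> f0 [M fM] f_fine; split; first split => //.
  apply: (@le_lt_trans _ _ M%:E); last exact: ltry.
  apply: ge_ereal_sup => _ [s sp <-]; rewrite lee_fin alphaX_dvar.
  exact/fM/fam_partition.
have sup_le d eps : (forall l, fam (zeroI R) l -> (forall x, x \in l -> len x <= d) ->
    dvar f l <= eps) -> (mesh_alphaX e f d <= eps%:E)%E.
  move=> H; apply: ge_ereal_sup => _ [s [sp sd] <-]; rewrite lee_fin alphaX_dvar.
  apply: H; first exact: fam_partition.
  move=> x /(nthP (zeroI R, zeroI R))[i]; rewrite size_zip /= (minn_idPr _)// => si <-.
  rewrite -[zip _ _](_ : zip (take (size s) (zeroI R :: s)) s = _); last first.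
    by elim: s (zeroI R) {sp sd i si} => [//|a s IH] p /=; rewrite IH.
  rewrite nth_zip ?size_takel//= /len /= nth_take//.
  apply: le_trans sd; rewrite /mesh.
  by apply: (le_bigmax _ (fun i : 'I_(size s) => val (right_pt s i) - val (left_pt s i))
    (Ordinal si)).
have small (eps : R) : 0 < eps -> \forall d \near 0^'+,
    (0 <= mesh_alphaX e f d)%E /\ (mesh_alphaX e f d <= eps%:E)%E.
  move=> /f_fine[d d0 df]; near=> t; split.
    by apply: sup_alphaX_ge0; exact: mesh_partition01_nonempty.
  apply: sup_le => l lf lt; apply: df => // x /lt /le_trans; apply.
  by near: t; exact: nbhs_right_le.
have fin (eps : R) : 0 < eps -> \forall d \near 0^'+, mesh_alphaX e f d \is a fin_num.
  move=> eps0; near=> t; have [m0 m1] : (0 <= mesh_alphaX e f t)%E /\ (mesh_alphaX e f t <= eps%:E)%E.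
    by near: t; exact: small.
  by rewrite ge0_fin_numE// (le_lt_trans m1)// ltry.
apply/fine_cvgP; split; first exact: fin ltr01.
apply/cvgrPdist_le => eps eps0; near=> t; rewrite sub0r normrN.
have [m0 m1] : (0 <= mesh_alphaX e f t)%E /\ (mesh_alphaX e f t <= eps%:E)%E.
    by near: t; exact: small.
have tf : mesh_alphaX e f t \is a fin_num by near: t; exact: fin ltr01.
by rewrite ger0_norm ?fine_ge0// -lee_fin fineK.
Unshelve. all: by end_near. Qed.

Lemma VX0_uniformly_continuous (f : VX0 e) eps : 0 < eps -> exists2 d, 0 < d &
  forall a b, `|val a - val b| <= d -> `|f a - f b| <= eps.
Proof.
move=> eps0; have e0 := norm_basis_gt0 e.
have [|d d0 df] := @dvar_fine f (eps * `|e 0%N|) (set_mem (VX0P f)).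
  by rewrite mulr_gt0.
have H a b : val a < val b -> val b - val a <= d -> `|f b - f a| <= eps.
  move=> ab bad; rewrite -(ler_pM2r e0); apply: le_trans (df [:: (a, b)] _ _).
  - by apply: (@bnorm_map_ge _ _ _ _ _ _ (a, b)); rewrite mem_head.
  - by rewrite /= ab val_ge0.
  - by move=> x; rewrite inE => /eqP ->.
exists d => // a b abd; have [ab|ba|/val_inj ->] := ltgtP (val a) (val b).
- by rewrite distrC H//; move: abd; rewrite distrC; apply/le_trans/ler_norm.
- by rewrite H//; move: abd; apply/le_trans/ler_norm.
- by rewrite subrr normr0 ltW.
Qed.

Lemma VX0_pt_le (f : VX0 e) t : `|f t| <= `|f| / `|e 0%N|.
Proof. by rewrite ler_pdivlMr ?norm_basis_gt0//; exact: VX0_norm_pt. Qed.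

(** Increments of size at least [eta] on [k] intervals give variation at least [eta] times the norm
    of a sum of [k] basis vectors, which is unbounded in [k]. *)
Lemma fam_oscillation (M eta : R) : reflexive_space X -> 0 < eta -> exists N,
  forall f, (forall l, fam (zeroI R) l -> dvar f l <= M) ->
  forall l, fam (zeroI R) l -> (forall x, x \in l -> eta <= `|incr f x|) ->
  (size l < N)%N.
Proof.
move=> Xr eta0; have [N MN] := bnorm_nseq_unbounded e Xr (M / eta).
exists N => f fM l lf leta; rewrite ltnNge; apply/negP => Nl.
have := bnorm_map_ge_nseq e (ltW eta0) leta.
have : bnorm e (nseq N 1) <= bnorm e (nseq (size l) 1).
  rewrite -[nseq N 1]cats0 -(subnKC Nl) nseqD; apply: bnorm_subseq.
  by apply: cat_subseq => //; exact: sub0seq.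
rewrite ltr_pdivrMr// in MN; have := fM l lf; rewrite /dvar.
nra.
Qed.

End IntervalFamilies.

(** * Weak topologies *)

Section InitialFamily.
Context (S : choiceType) (J : Type) (V : topologicalType) (f : J -> S -> V).

Let W : topologicalType :=
  sup_topology (fun j => Topological.class (initial_topology (f j))).

Lemma sup_initial_continuous j : continuous (f j : W -> V).
Proof.
move=> x; have := (@cvg_sup _ _ (fun j => Topological.class (initial_topology (f j))) (nbhs (x : W)) x _).1.
move=> /(_ _ (@cvg_id _ _) j) xj.
apply: cvg_trans (@initial_continuous _ _ (f j) x).
by apply: cvg_app.
Qed.

Lemma sup_initial_cvg (T : Type) (F : set_system T) (u : T -> S) (x : S) : Filter F ->
  (forall j, f j (u t) @[t --> F] --> f j x) -> u t @[t --> F] --> (x : W).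
Proof.
move=> FF fu.
apply/(@cvg_sup _ _ (fun j => Topological.class (initial_topology (f j)))).
move=> j A; rewrite nbhsE => -[B [[C Co CB] Bx] BA].
have : nbhs (f j x) C by apply: open_nbhs_nbhs; split => //; rewrite -CB in Bx.
move=> /(fu j); rewrite /nbhs/=; apply: filterS => t Ct; apply: BA.
by rewrite -CB.
Qed.

End InitialFamily.

Section WeakTopologies.
Context (R : realType) (E : normedModType R).

Lemma weak_continuous (phi : dual E) : continuous (phi : weak E -> R).
Proof. exact: (@sup_initial_continuous E _ _ (@dual_fun R E) phi). Qed.

Lemma weak_cvg (T : Type) (F : set_system T) (u : T -> E) (x : E) : Filter F ->
  (forall phi : dual E, phi (u t) @[t --> F] --> phi x) -> u t @[t --> F] --> (x : weak E).
Proof. exact: (@sup_initial_cvg E _ _ (@dual_fun R E)). Qed.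

Lemma weak_star_continuous (x : E) : continuous ((fun f : dual E => f x) : weak_star E -> R).
Proof. exact: (@sup_initial_continuous _ _ _ (fun x (f : dual E) => f x) x). Qed.

Lemma weak_star_cvg (T : Type) (F : set_system T) (u : T -> dual E) (f : dual E) : Filter F ->
  (forall x, u t x @[t --> F] --> f x) -> u t @[t --> F] --> (f : weak_star E).
Proof. exact: (@sup_initial_cvg _ _ _ (fun x (f : dual E) => f x)). Qed.

End WeakTopologies.

Section UnitIntervalTopology.
Context (R : realType).
Notation I := (unit_interval R).

Lemma unit_interval_continuousP (f : I -> R) a : {for a, continuous f} <->
  forall eps : R, 0 < eps -> exists2 d : R, 0 < d &
    forall b : I, `|val a - val b| < d -> `|f a - f b| < eps.
Proof.
split=> [fa eps eps0|fa].
  have : nbhs a (f @^-1` [set y | `|f a - y| < eps]).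
    by apply: fa; exact: (nbhsx_ballx (f a) eps eps0).
  rewrite nbhsE => -[B [[C Co CB] Ba] BA].
  have : nbhs (val a) C by apply: open_nbhs_nbhs; split => //; rewrite -CB in Ba.
  move=> /nbhs_ballP[d /= d0 dC]; exists d => // b ab; apply: BA.
  by rewrite -CB /=; apply: dC.
have FF := @nbhs_filter I a.
apply/cvgrPdist_lt => eps /fa[d d0 df].
have : nbhs a ((val : I -> R) @^-1` ball (val a) d).
  by apply: (@initial_continuous _ _ (set_val : I -> R) a); exact: nbhsx_ballx.
by apply: (@filterS _ _ (@nbhs_filter I a)) => b /df.
Qed.

End UnitIntervalTopology.

(** * Weakly open sets of small uniform diameter *)

Lemma seq_positive_lower_bound (R : realType) (T : eqType) (l : seq T) (u : T -> R) :
  (forall x, x \in l -> 0 < u x) ->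
  exists2 tau, 0 < tau & forall x, x \in l -> tau <= u x.
Proof.
elim: l => [|y l IH] u0; first by exists 1.
have [|tau t0 tl] := IH; first by move=> x xl; apply: u0; rewrite inE xl orbT.
exists (Num.min tau (u y)); first by rewrite lt_min t0 u0 ?mem_head.
by move=> x; rewrite inE ge_min => /predU1P[->|/tl ->]; rewrite ?lexx ?orbT.
Qed.

Section BumpInsertion.
Context (R : realType).
Notation I := (unit_interval R).

Lemma seq_floor (P : seq I) (z t : I) : z \in P -> val z <= val t ->
  exists2 p, p \in P & val p <= val t /\ forall q, q \in P -> val q <= val t -> val q <= val p.
Proof.
move=> zP zt.
suff H (Q : seq I) : z \in Q -> exists2 p, p \in Q & forall q, q \in Q -> val q <= val p.
  have [|p] := H [seq q <- P | val q <= val t]; first by rewrite mem_filter zt.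
  rewrite mem_filter => /andP[pt pP] pmax; exists p => //; split => // q qP qt.
  by apply: pmax; rewrite mem_filter qt.
elim: Q z {zP zt} => [//|a Q IH] z _; case: Q IH => [|b Q] IH.
  by exists a; rewrite ?mem_head// => q; rewrite inE => /eqP ->.
have [p pQ pmax] := IH b (mem_head _ _).
have [pa|ap] := leP (val p) (val a).
  exists a; rewrite ?mem_head// => q; rewrite inE => /predU1P[->//|/pmax].
  by move/le_trans; apply.
exists p; first by rewrite inE pQ orbT.
by move=> q; rewrite inE => /predU1P[->|/pmax//]; exact: ltW.
Qed.

Lemma seq_ceil (P : seq I) (z t : I) : z \in P -> val t <= val z ->
  exists2 p, p \in P & val t <= val p /\ forall q, q \in P -> val t <= val q -> val p <= val q.
Proof.
move=> zP zt.
suff H (Q : seq I) : z \in Q -> exists2 p, p \in Q & forall q, q \in Q -> val p <= val q.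
  have [|p] := H [seq q <- P | val t <= val q]; first by rewrite mem_filter zt.
  rewrite mem_filter => /andP[pt pP] pmax; exists p => //; split => // q qP qt.
  by apply: pmax; rewrite mem_filter qt.
elim: Q z {zP zt} => [//|a Q IH] z _; case: Q IH => [|b Q] IH.
  by exists a; rewrite ?mem_head// => q; rewrite inE => /eqP ->.
have [p pQ pmax] := IH b (mem_head _ _).
have [pa|ap] := leP (val a) (val p).
  exists a; rewrite ?mem_head// => q; rewrite inE => /predU1P[->//|/pmax].
  exact: le_trans.
exists p; first by rewrite inE pQ orbT.
by move=> q; rewrite inE => /predU1P[->|/pmax//]; exact: ltW.
Qed.

Lemma exists_net (d : R) : 0 < d -> exists G : seq I, forall t : I,
  (exists2 q, q \in G & val q <= val t /\ val t - val q <= d) /\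
  (exists2 q, q \in G & val t <= val q /\ val q - val t <= d).
Proof.
move=> d0; pose n := (Num.truncn d^-1).+1.
have n0 : 0 < n%:R :> R by rewrite ltr0n.
have nd : n%:R^-1 <= d.
  by rewrite -[leRHS]invrK lef_pV2 ?posrE ?invr_gt0// ltW// truncnS_gt.
pose q (k : nat) : I := insubd (oneI R) (k%:R / n%:R).
have qE k : (k <= n)%N -> val (q k) = k%:R / n%:R.
  move=> kn; rewrite /q val_insubd ifT// inE/= in_itv/= divr_ge0//=.
  by rewrite ler_pdivrMr// mul1r ler_nat.
exists [seq q k | k <- iota 0 n.+1] => t.
pose k := Num.truncn (val t * n%:R).
have t0 := val_ge0 t; have t1 := val_le1 t.
have tn0 : 0 <= val t * n%:R by rewrite mulr_ge0.
have kt : k%:R <= val t * n%:R by have /andP[] := truncn_itv tn0.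
have tk : val t * n%:R < k.+1%:R by have /andP[] := truncn_itv tn0.
have kn : (k <= n)%N.
  by rewrite -(ler_nat R) (le_trans kt)// ler_piMl.
have qin i : (i <= n)%N -> q i \in [seq q k | k <- iota 0 n.+1].
  by move=> i_n; apply/mapP; exists i => //; rewrite mem_iota add0n leq0n ltnS.
split.
  exists (q k); rewrite ?qin// qE//; split; first by rewrite ler_pdivrMr.
  apply: le_trans nd; rewrite lerBlDr -(ler_pM2r n0) mulrDl mulVf ?gt_eqF//.
  by rewrite divfK ?gt_eqF// addrC natr1 ltW.
have [tt|tt] := ltP (val t) 1.
  have kn' : (k < n)%N by rewrite -(ltr_nat R) (le_lt_trans kt)// gtr_pMl.
  exists (q k.+1); rewrite ?qin// qE//; split; first by rewrite ler_pdivlMr// ltW.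
  apply: le_trans nd; rewrite lerBlDr -(ler_pM2r n0) mulrDl mulVf ?gt_eqF//.
  by rewrite divfK ?gt_eqF// -natr1 addrC lerD2l.
have tE : t = q n.
  apply/val_inj; rewrite qE// divff ?gt_eqF//; apply/eqP; rewrite eq_le tt.
  by rewrite t1.
by exists (q n); rewrite ?qin// -tE subrr lexx ltW.
Qed.

(** No endpoint of [l] lies strictly between [p] and [p'], so at most one interval covers this gap.
    Dropping it and adding the two halves of the gap still increases the count. *)
Lemma fam_insert (q p t p' : I) (l : seq (I * I)) : fam q l -> val q <= val p ->
  val p < val t -> val t < val p' ->
  (forall x, x \in l -> (val x.1 <= val p \/ val p' <= val x.1) /\
                       (val x.2 <= val p \/ val p' <= val x.2)) ->
  exists l', [/\ fam q l', (size l < size l')%N &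
    forall x, x \in l' -> [\/ x \in l, x = (p, t) | x = (t, p')]].
Proof.
move=> + + pt tp'; elim: l q => [|x l IH] q /=.
  move=> _ qp _; exists [:: (p, t); (t, p')]; split => //=.
    by rewrite qp pt lexx tp'.
  by move=> x; rewrite !inE => /orP[/eqP ->|/eqP ->]; [apply: Or32|apply: Or33].
move=> /andP[/andP[qx xx] xl] qp lP.
have lP' y : y \in l -> (val y.1 <= val p \/ val p' <= val y.1) /\
                       (val y.2 <= val p \/ val p' <= val y.2).
  by move=> yl; apply: lP; rewrite inE yl orbT.
have [x1 x2] := lP x (mem_head _ _); case: x2 => [x2p|px2].
  have [l' [l'f sl' l'P]] := IH _ xl x2p lP'.
  exists (x :: l'); split => //=; first by rewrite qx xx.
  move=> y; rewrite inE => /predU1P[->|/l'P[yl|->|->]].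
  - by apply: Or31; rewrite mem_head.
  - by apply: Or31; rewrite inE yl orbT.
  - exact: Or32.
  - exact: Or33.
case: x1 => [x1p|px1].
  exists [:: (p, t), (t, p') & l]; split => //=.
    by rewrite qp pt lexx tp' (fam_weaken px2 xl).
  move=> y; rewrite !inE => /orP[/eqP ->|/orP[/eqP ->|yl]].
  - exact: Or32.
  - exact: Or33.
  - by apply: Or31; rewrite yl orbT.
exists [:: (p, t), (t, p'), x & l]; split => //=.
  by rewrite qp pt lexx tp' px1 xx xl.
move=> y; rewrite !inE => /orP[/eqP ->|/orP[/eqP ->|yl]].
- exact: Or32.
- exact: Or33.
- exact: Or31.
Qed.

End BumpInsertion.

Section SmallSupDiameter.
Context (R : realType) (X : normedModType R) (e : symmetric_basis X).
Context (Y : submodClosed (VX0 e)).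
Notation I := (unit_interval R).
Notation E := (subspace_of Y).
Implicit Types (g : E) (A O : set E).

Definition sfun (g : E) : I -> R := VX0_fun (subspace_val g).

Lemma sfunD (g h : E) t : sfun (g + h) t = sfun g t + sfun h t.
Proof. by []. Qed.

Lemma sfunZ k (g : E) t : sfun (k *: g) t = k * sfun g t.
Proof.
have E1 : subspace_val (k *: g) = k *: subspace_val g by reflexivity.
have E2 (f : VX0 e) : VX0_fun (k *: f) t = k * VX0_fun f t by reflexivity.
by rewrite /sfun E1 E2.
Qed.

Lemma sfunB (g h : E) t : sfun (g - h) t = sfun g t - sfun h t.
Proof. by []. Qed.

Lemma subspace_delta (t : I) : exists phi : dual E, forall g, phi g = sfun g t.
Proof.
have lin : linear (fun g : E => sfun g t).
  by move=> k x y; rewrite sfunD sfunZ.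
apply: (dual_of_bounded lin (C := `|e 0%N|^-1)) => g.
by rewrite mulrC; exact: (VX0_pt_le (subspace_val g) t).
Qed.

Lemma weak_open_pts (P : seq I) g0 (tau : R) :
  @open (weak E) [set g : E | forall p, p \in P -> `|sfun g p - sfun g0 p| < tau].
Proof.
elim: P => [|a P IH].
  rewrite (_ : [set _ | _] = setT); first exact: openT.
  by apply/seteqP; split.
have [phi phiE] := subspace_delta a.
rewrite (_ : [set _ | _] = (phi : weak E -> R) @^-1` ball (phi g0) tau
    `&` [set g : E | forall p, p \in P -> `|sfun g p - sfun g0 p| < tau]).
  apply: openI => //; apply: open_comp; last exact: ball_open.
  by move=> x _; exact: weak_continuous.
apply/seteqP; split => g /=.
  move=> H; split; last by move=> p pP; apply: H; rewrite inE pP orbT.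
  by rewrite /ball /= distrC !phiE H ?mem_head.
move=> [+ H] p; rewrite inE /ball /= distrC !phiE => ga /predU1P[->//|]; exact: H.
Qed.

(* Among the points of A `&` O, take g and a family l of intervals on which g
   increases by more than eta/8 in absolute value, with l as long as possible.
   A function of A near g on a fine finite set containing the endpoints of l
   cannot deviate from g elsewhere, since the resulting bump would make the
   family longer. *)
Lemma small_sup_diameter A O eta : reflexive_space X ->
  (forall g, A g -> `|g| <= 1) -> @open (weak E) O -> A `&` O !=set0 -> 0 < eta ->
  exists O', [/\ @open (weak E) O', O' `<=` O, A `&` O' !=set0 &
    forall g g', (A `&` O') g -> (A `&` O') g' ->
      forall t, `|sfun g t - sfun g' t| <= eta].
Proof.
(* Every member will be within [4 * h] of [g], so any two differ by at most [8 * h = eta]. *)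
move=> Xr A1 Oo AO0 eta0; pose h := eta / 8.
have h0 : 0 < h by rewrite divr_gt0.
have [N NP] := fam_oscillation e 1 Xr h0.
pose Q n := exists g l, [/\ (A `&` O) g, fam (zeroI R) l, size l = n &
  forall x, x \in l -> h < `|incr (sfun g) x|].
have QN n : Q n -> (n <= N)%N.
  move=> [g [l [[Ag _] lf <- lh]]]; apply: ltnW; apply: (NP (sfun g)) => //.
    by move=> l' l'f; apply: le_trans (A1 g Ag); exact: dvar_le_VX0_norm.
  by move=> x /lh /ltW.
have Q0 : exists n, `[< Q n >].
  by have [g Og] := AO0; exists 0%N; apply/asboolP; exists g, [::].
have QN' n : `[< Q n >] -> (n <= N)%N by move/asboolP/QN.
case: (ex_maxnP Q0 QN') => n /asboolP[g [l [[Ag Og] lf sl lh]]] nmax.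
have [d d0 gd] := VX0_uniformly_continuous (subspace_val g) h0.
have [G GP] := exists_net d0.
(* Half the slack above [h]: moving both endpoint values by less than [tau0] keeps the increments on
   [l] strictly above [h]. *)
have [|tau0 tau00 tauP] := @seq_positive_lower_bound R _ l (fun x => (`|incr (sfun g) x| - h) / 2).
  by move=> x /lh xh; rewrite divr_gt0// subr_gt0.
pose tau := Num.min tau0 h.
have tau_gt0 : 0 < tau by rewrite lt_min tau00.
(* The points 0 and 1 give every [t] neighbours in [P], the net [G] brings these within [d] of [t],
   where [g] moves by at most [h], and the endpoints of [l] protect the existing family. *)
pose P := [:: zeroI R, oneI R & G ++ map fst l ++ map snd l].
pose O' := O `&` [set g' : E | forall p, p \in P -> `|sfun g' p - sfun g p| < tau].
have PG q : q \in G -> q \in P by move=> qG; rewrite !inE mem_cat qG !orbT.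
have P1 x : x \in l -> x.1 \in P.
  by move=> xl; rewrite !inE !mem_cat (map_f fst xl) !orbT.
have P2 x : x \in l -> x.2 \in P.
  by move=> xl; rewrite !inE !mem_cat (map_f snd xl) !orbT.
have close g' t : (A `&` O') g' -> `|sfun g' t - sfun g t| <= 4 * h.
  move=> [Ag' [Og' g'P]]; rewrite leNgt; apply/negP => far.
  have [p pP [pt pmax]] := @seq_floor _ P (zeroI R) t (mem_head _ _) (val_ge0 t).
  have [|p' p'P [tp' pmin]] := @seq_ceil _ P (oneI R) t _ (val_le1 t).
    by rewrite !inE eqxx orbT.
  have tauh : tau <= h by rewrite ge_min lexx orbT.
  have notP q : q \in P -> val q != val t.
    move=> qP; apply/eqP => /val_inj qt; have := g'P q qP; rewrite qt.
    by move: far tauh h0; clear; lra.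
  have {}pt : val p < val t by rewrite lt_neqAle notP.
  have {}tp' : val t < val p' by rewrite lt_neqAle eq_sym notP.
  have gp : `|sfun g t - sfun g p| <= h.
    apply: gd; have [[q qG [qt tq]] _] := GP t.
    have := pmax q (PG q qG) qt.
    by rewrite ger0_norm ?subr_ge0 ?(ltW pt)//; move: tq; clear; lra.
  have gp' : `|sfun g t - sfun g p'| <= h.
    apply: gd; have [_ [q qG [qt tq]]] := GP t.
    have := pmin q (PG q qG) qt.
    by rewrite ler0_norm ?subr_le0 ?(ltW tp')//; move: tq; clear; lra.
  have big q : q \in P -> `|sfun g t - sfun g q| <= h -> h < `|sfun g' t - sfun g' q|.
    move=> qP gq; have := g'P q qP.
    have -> : sfun g' t - sfun g' q = (sfun g' t - sfun g t) -
      (- (sfun g t - sfun g q) + (sfun g' q - sfun g q)) by ring.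
    have := lerB_dist (sfun g' t - sfun g t)
      (- (sfun g t - sfun g q) + (sfun g' q - sfun g q)).
    have := ler_normD (- (sfun g t - sfun g q)) (sfun g' q - sfun g q).
    by rewrite normrN; move: far gq tauh h0; clear; lra.
  have [|l' [l'f ll' l'P]] := @fam_insert _ (zeroI R) p t p' l lf (val_ge0 p) pt tp'.
    move=> x xl; split.
    - by have [xt|tx] := leP (val x.1) (val t); [left; apply: pmax => //; exact: P1|
        right; apply: pmin; [exact: P1|exact: ltW]].
    - by have [xt|tx] := leP (val x.2) (val t); [left; apply: pmax => //; exact: P2|
        right; apply: pmin; [exact: P2|exact: ltW]].
  have : `[< Q (size l') >].
    apply/asboolP; exists g', l'; split => // x /l'P[xl|->|->].
    - have := tauP x xl; have := g'P _ (P1 x xl); have := g'P _ (P2 x xl).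
      have : tau <= tau0 by rewrite ge_min lexx.
      rewrite /incr; set a := sfun g' _; set b := sfun g _.
      set c := sfun g' _; set a' := sfun g _ => tt ab cd.
      have -> : a - c = (b - a') - ((c - a') - (a - b)) by ring.
      have := lerB_dist (b - a') ((c - a') - (a - b)).
      have := ler_normB (c - a') (a - b); move: tt ab cd; clear; lra.
    - by rewrite /incr /=; apply: big.
    - by rewrite /incr /= distrC; apply: big.
  by move=> /nmax; rewrite leqNgt -sl ll'.
exists O'; split.
- by apply: openI => //; exact: weak_open_pts.
- by move=> ? [].
- by exists g; split => //; split => // p _; rewrite subrr normr0.
- move=> g1 g2 g1O g2O t; have := close g1 t g1O; have := close g2 t g2O.
  have := ler_normB (sfun g1 t - sfun g t) (sfun g2 t - sfun g t).
  have -> : (sfun g1 t - sfun g t) - (sfun g2 t - sfun g t) =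
    sfun g1 t - sfun g2 t by ring.
  by rewrite /h; lra.
Qed.

End SmallSupDiameter.

(** * From a failure of PCP to a continuous limit outside the subspace *)

Section PCPSufficient.
Context (R : realType) (X : normedModType R) (e : symmetric_basis X).
Context (Y : submodClosed (VX0 e)).
Notation I := (unit_interval R).
Notation E := (subspace_of Y).
Implicit Types (g : E) (A O : set E).

Lemma subspace_normE g : `|g| = `|subspace_val g|.
Proof. by []. Qed.

Lemma dvar_near (f g : I -> R) (l : seq (I * I)) tau :
  (forall x, x \in l -> `|g x.1 - f x.1| <= tau /\ `|g x.2 - f x.2| <= tau) ->
  dvar e f l <= dvar e g l + (size l)%:R * (2 * tau) * `|e 0%N|.
Proof.
move=> H; have -> : dvar e f l = bnorm e [seq incr g x + (incr f x - incr g x) | x <- l].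
  by congr bnorm; apply: eq_map => x; lra.
apply: (le_trans (bnorm_mapD _ _ _ _)); rewrite lerD2l.
apply: bnorm_map_le_size => x /H[x1 x2]; rewrite /incr.
have -> : f x.2 - f x.1 - (g x.2 - g x.1) = (g x.1 - f x.1) - (g x.2 - f x.2) by lra.
by have := ler_normB (g x.1 - f x.1) (g x.2 - f x.2); lra.
Qed.

Lemma diameter_ge A eps : ~ (diameter A < eps%:E)%E -> 0 < eps ->
  exists g g', [/\ A g, A g' & eps / 2 < `|g - g'|].
Proof.
move=> dA eps0; apply: contrapT => H; apply: dA.
apply: (@le_lt_trans _ _ (eps / 2)%:E); last by rewrite lte_fin; lra.
apply: ge_ereal_sup => _ [[g g'] [/= Ag Ag'] <-]; rewrite lee_fin leNgt.
by apply/negP => gg; apply: H; exists g, g'.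
Qed.

(** Once the uniform diameter is small, a difference of two members is negligible on intervals
    longer than [d], since there are at most [1 / d] of them. Its norm must then come from short
    intervals, and one of the two members inherits half of that variation. *)
Lemma fine_variation_step A eps n O : reflexive_space X ->
  (forall g, A g -> `|g| <= 1) -> 0 < eps ->
  (forall O, @open (weak E) O -> A `&` O !=set0 -> ~ (diameter (A `&` O) < eps%:E)%E) ->
  @open (weak E) O -> A `&` O !=set0 ->
  exists V', [/\ @open (weak E) V', V' `<=` O, A `&` V' !=set0,
    forall g g', (A `&` V') g -> (A `&` V') g' ->
      forall t, `|sfun g t - sfun g' t| <= n.+1%:R^-1 &
    exists2 l, fam (zeroI R) l /\ (forall x, x \in l -> len x <= n.+1%:R^-1) &
      forall g, (A `&` V') g -> eps / 16 <= dvar e (sfun g) l].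
Proof.
move=> Xr A1 eps0 Adiam Oo AO0; set d : R := n.+1%:R^-1.
have d0 : 0 < d by rewrite invr_gt0.
have e0 := norm_basis_gt0 e.
(* The second bound makes at most [1 / d] long intervals, with increments at most [2 * eta] each,
   contribute at most [eps / 8]. *)
pose eta := Num.min d (eps * d / (16 * `|e 0%N|)).
have eta0 : 0 < eta by rewrite lt_min d0 divr_gt0 ?mulr_gt0.
have etad : eta <= d by rewrite ge_min lexx.
have eta_eps : eta * `|e 0%N| <= d * eps / 16.
  rewrite -ler_pdivlMr// (_ : d * eps / 16 / `|e 0%N| = eps * d / (16 * `|e 0%N|)).
    by rewrite ge_min lexx orbT.
  by rewrite invfM !mulrA [d * _]mulrC; lra.
have [V1 [V1o V1O AV1 V1sup]] := small_sup_diameter Xr A1 Oo AO0 eta0.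
have [y [y' [V1y V1y' yy]]] := diameter_ge (Adiam V1 V1o AV1) eps0.
have [l lf lyy] : exists2 l, fam (zeroI R) l & eps / 2 < dvar e (sfun (y - y')) l.
  apply: contrapT => H; have : `|subspace_val (y - y')| <= eps / 2.
    apply: VX0_norm_le => l lf; rewrite leNgt; apply/negP => ll; apply: H.
    by exists l.
  by move: yy; rewrite subspace_normE; lra.
pose short x := len x <= d.
pose l1 := [seq x <- l | short x].
have l1f : fam (zeroI R) l1 by exact: fam_filter.
have long_small : dvar e (sfun (y - y')) [seq x <- l | ~~ short x] <= eps / 8.
  set l2 := [seq x <- l | ~~ short x]; have l2f : fam (zeroI R) l2 by exact: fam_filter.
  have : (size l2)%:R * d <= 1 - val (zeroI R).
    apply: (fam_long_size l2f) => x; rewrite mem_filter => /andP[+ _].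
    by rewrite -ltNge => /ltW.
  rewrite /= subr0 => sl2.
  apply: (@le_trans _ _ ((size l2)%:R * (2 * eta) * `|e 0%N|)).
    apply: bnorm_map_le_size => x _; rewrite /incr.
    have -> : sfun (y - y') x.2 - sfun (y - y') x.1 =
      (sfun y x.2 - sfun y' x.2) - (sfun y x.1 - sfun y' x.1).
      by rewrite !sfunB; lra.
    have := V1sup y y' V1y V1y' x.1; have := V1sup y y' V1y V1y' x.2.
    by have := ler_normB (sfun y x.2 - sfun y' x.2) (sfun y x.1 - sfun y' x.1); lra.
  have : (size l2)%:R * (eta * `|e 0%N|) <= (size l2)%:R * (d * eps / 16).
    by rewrite ler_wpM2l.
  have : (size l2)%:R * d * (eps / 16) <= 1 * (eps / 16).
    by rewrite ler_wpM2r//; lra.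
  lra.
have short_big : 3 * eps / 8 <= dvar e (sfun (y - y')) l1.
  by have := bnorm_map_split e l short (incr (sfun (y - y'))); move: lyy long_small;
    rewrite /dvar; lra.
(* Of the initial [eps / 2], the long intervals took [eps / 8] and halving leaves [3 * eps / 16].
   Passing from [x] to its weak neighbours below costs another [eps / 8]. *)
have [x V1x xl] : exists2 x, (A `&` V1) x & 3 * eps / 16 <= dvar e (sfun x) l1.
  have : dvar e (sfun (y - y')) l1 <= dvar e (sfun y) l1 + dvar e (sfun y') l1.
    have -> : dvar e (sfun (y - y')) l1 =
      bnorm e [seq incr (sfun y) x + -1 * incr (sfun y') x | x <- l1].
      by congr bnorm; apply: eq_map => x; rewrite /incr !sfunB; lra.
    apply: (le_trans (bnorm_mapD _ _ _ _)); rewrite bnorm_mapZ.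
    by rewrite normrN normr1 mul1r.
  have [yl|yl] := leP (3 * eps / 16) (dvar e (sfun y) l1); first by exists y.
  by exists y' => //; lra.
pose tau := eps / (16 * (size l1).+1%:R * `|e 0%N|).
have s0 : 0 < (size l1).+1%:R :> R by rewrite ltr0n.
have tau0 : 0 < tau by rewrite divr_gt0// !mulr_gt0.
pose P := map fst l1 ++ map snd l1.
exists (V1 `&` [set g : E | forall p, p \in P -> `|sfun g p - sfun x p| < tau]); split.
- by apply: openI => //; exact: weak_open_pts.
- by move=> g [/V1O].
- exists x; split; first exact: V1x.1.
  by split; [exact: V1x.2|move=> p _; rewrite subrr normr0].
- move=> g g' [Ag [V1g _]] [Ag' [V1g' _]] t.
  by rewrite (le_trans _ etad)// V1sup.
exists l1.
  by split=> // z; rewrite mem_filter => /andP[].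
move=> g [Ag [V1g gP]].
have : dvar e (sfun x) l1 <= dvar e (sfun g) l1 + (size l1)%:R * (2 * tau) * `|e 0%N|.
  apply: dvar_near => z zl; split; apply: ltW; apply: gP; rewrite mem_cat.
    by rewrite (map_f fst zl).
  by rewrite (map_f snd zl) orbT.
have : (size l1)%:R * (2 * tau) * `|e 0%N| <= eps / 8.
  have -> : (size l1)%:R * (2 * tau) * `|e 0%N| = ((size l1)%:R / (size l1).+1%:R) * (eps / 8).
    rewrite /tau; field.
    by rewrite !gt_eqF.
  rewrite ler_piMl//; first by lra.
  by rewrite ler_pdivrMr// mul1r ler_nat.
lra.
Qed.

Lemma PCP_of_no_continuous_limit : reflexive_space X ->
  (weak_star_closure [set f : VX0 e | f \in Y]
      `\` functions_of [set f : VX0 e | f \in Y]) `&` @C01 R = set0 ->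
  PCP_space E.
Proof.
move=> Xr noF A A1 A0 _ eps eps0; apply: contrapT => H.
have Adiam O : @open (weak E) O -> A `&` O !=set0 -> ~ (diameter (A `&` O) < eps%:E)%E.
  by move=> Oo AO dO; apply: H; exists O.
have {}A1 g : A g -> `|g| <= 1 by move=> /A1.
pose T := {O : set E | @open (weak E) O /\ A `&` O !=set0}.
have /choice[next nextP] : forall p : nat * T, exists V' : T,
   [/\ sval V' `<=` sval p.2,
    forall g g', (A `&` sval V') g -> (A `&` sval V') g' ->
      forall t, `|sfun g t - sfun g' t| <= p.1.+1%:R^-1 &
    exists2 l, fam (zeroI R) l /\ (forall x, x \in l -> len x <= p.1.+1%:R^-1) &
      forall g, (A `&` sval V') g -> eps / 16 <= dvar e (sfun g) l].
  move=> [n [V [Vo AV]]] /=.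
  have [V' [V'o V'O AV' V's V'l]] := fine_variation_step n Xr A1 eps0 Adiam Vo AV.
  by exists (exist _ V' (conj V'o AV')); split.
have AT : A `&` setT !=set0 by rewrite setIT.
(* Stage [n] of this decreasing sequence fixes one family of mesh at most [n.+1%:R^-1] on which all
   later points have variation at least [eps / 16]. *)
pose fix U n : T := if n is m.+1 then next (m, U m) else exist _ setT (conj openT AT).
have UP n := nextP (n, U n).
have Usub m n : (m <= n)%N -> sval (U n) `<=` sval (U m).
  move=> /subnK <-; elim: (n - m)%N => [//|i IH]; rewrite addSn.
  by have [sub _ _] := UP (i + m)%N; exact: subset_trans sub IH.
have /choice[x xP] : forall n, exists g, (A `&` sval (U n.+1)) g.
  by move=> n; have [_ [g]] := svalP (U n.+1); exists g.
have xU m n : (m <= n)%N -> (A `&` sval (U m.+1)) (x n).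
  move=> mn; have [Ax Ux] := xP n; split => //; exact: Usub Ux.
have x1 n : `|subspace_val (x n)| <= 1 by exact: A1 (xP n).1.
have [F FE] := bidual_ulim x1.
pose f := bidual_function F.
have fE t : f t = ulim (fun n => sfun (x n) t) by rewrite /f /bidual_function FE.
have xM t n : `|sfun (x n) t| <= 1 / `|e 0%N|.
  by rewrite (le_trans (VX0_pt_le _ _))// ler_wpM2r// invr_ge0.
have xf n t : `|sfun (x n) t - f t| <= n.+1%:R^-1.
  have H1 m : (n <= m)%N -> `|sfun (x n) t - sfun (x m) t| <= n.+1%:R^-1.
    by move=> nm; have [_ + _] := UP n; apply; exact: xU.
  rewrite ler_distlC fE; apply/andP; split.
    apply: (ulim_ge (xM t)); exists n => // m /= /H1.
    by rewrite ler_distlC => /andP[].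
  apply: (ulim_le (xM t)); exists n => // m /= /H1.
  by rewrite ler_distlC => /andP[].
have inv_small (r : R) : 0 < r -> exists n, n.+1%:R^-1 <= r.
  move=> r0; exists (Num.truncn r^-1).
  by rewrite -[leRHS]invrK lef_pV2 ?posrE ?invr_gt0// ltW// truncnS_gt.
have fcont : continuous f.
  move=> a; apply/unit_interval_continuousP => r r0.
  have r4 : 0 < r / 4 by lra.
  have [n nr] := inv_small _ r4.
  have [d d0 xd] := VX0_uniformly_continuous (subspace_val (x n)) r4.
  exists d => // b /ltW /xd.
  change (`|sfun (x n) a - sfun (x n) b| <= r / 4 -> `|f a - f b| < r).
  have := le_trans (xf n a) nr; have := le_trans (xf n b) nr.
  have -> : f a - f b = (sfun (x n) b - f b) - (sfun (x n) a - f a)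
    + (sfun (x n) a - sfun (x n) b) by lra.
  have := ler_normD (sfun (x n) b - f b - (sfun (x n) a - f a)) (sfun (x n) a - sfun (x n) b).
  have := ler_normB (sfun (x n) b - f b) (sfun (x n) a - f a).
  lra.
have Fcl : weak_star_closure [set f : VX0 e | f \in Y] f.
  exists F => //; move=> B FB.
  have : evaluation (subspace_val (x n)) @[n --> nat_ultra] --> (F : weak_star (dual (VX0 e))).
    apply: weak_star_cvg => phi /=; rewrite FE.
    apply: (@ulim_cvg _ _ (opnorm phi * 1)) => n.
    rewrite (le_trans (opnormP _ _))// ler_wpM2l//; exact: (@normr_ge0 _ _ phi).
  move=> /(_ _ FB) FB'.
  have [n Bn] := @filter_ex _ nat_ultra _ ((fun n => evaluation (subspace_val (x n))) @^-1` B) FB'.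
  exists (evaluation (subspace_val (x n))).
  by split => //; exists (subspace_val (x n)) => //; exact: subspace_valP.
have [g Yg gf] : functions_of [set f : VX0 e | f \in Y] f.
  apply: contrapT => nf; have : (set0 : set (I -> R)) f by rewrite -noF.
  exact.
have eps32 : 0 < eps / 32 by lra.
have [d d0 gd] := dvar_fine (set_mem (VX0P g)) eps32.
have [n nd] := inv_small _ d0.
have [_ _ [l [lf ln] lx]] := UP n.
have e0 := norm_basis_gt0 e.
have s0 : 0 < (size l).+1%:R :> R by rewrite ltr0n.
have q0 : 0 < eps / (128 * (size l).+1%:R * `|e 0%N|) by rewrite divr_gt0// !mulr_gt0.
(* The family [l] depends on [n] only, so [m] can be chosen after it, making [x m] so close to [f]
   that [l] sees a difference of at most [eps / 64]. Then [eps / 16 <= eps / 32 + eps / 64], a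
   contradiction. *)
have [m0 mq] := inv_small _ q0; pose m := maxn n m0.
have x_big := lx (x m) (xU _ _ (leq_maxl _ _)).
pose C := (size l)%:R * (2 * (eps / (128 * (size l).+1%:R * `|e 0%N|))) * `|e 0%N|.
have x_f : dvar e (sfun (x m)) l <= dvar e f l + C.
  have mm : m.+1%:R^-1 <= eps / (128 * (size l).+1%:R * `|e 0%N|).
    by rewrite (le_trans _ mq)// lef_pV2 ?posrE// ler_nat ltnS leq_maxr.
  by apply: dvar_near => z _; split; rewrite distrC (le_trans (xf _ _)).
have C_le : C <= eps / 64.
  have -> : C = ((size l)%:R / (size l).+1%:R) * (eps / 64).
    by rewrite /C; field; rewrite !gt_eqF.
  by rewrite ler_piMl ?divr_ge0 ?(ltW eps0)// ler_pdivrMr// mul1r ler_nat.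
have := gd l lf (fun z zl => le_trans (ln z zl) nd); rewrite gf => f_small.
by move: C x_big x_f C_le f_small eps0 => C; clear; lra.
Qed.

End PCPSufficient.

(** * Helly's theorem *)

Section DualArithmetic.
Context (R : realType) (V : normedModType R).

Lemma dual_appZ (phi : dual V) k x : phi (k *: x) = k * phi x.
Proof. by rewrite linearZ. Qed.

Lemma dual_appB (phi : dual V) x y : phi (x - y) = phi x - phi y.
Proof. by rewrite linearB. Qed.

Lemma dual_appD (phi : dual V) x y : phi (x + y) = phi x + phi y.
Proof. by rewrite linearD. Qed.

Lemma dualB (phi psi : dual V) x : (phi - psi) x = phi x - psi x. Proof. by []. Qed.

End DualArithmetic.

Section Helly.
Context (R : realType) (V : normedModType R) (Y : submodClosed V).
Implicit Types (phi psi chi : dual V) (s : seq (dual V)) (G : dual (dual V)).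

Lemma submod_rpredN (x : V) : x \in Y -> - x \in Y.
Proof. by move=> xY; rewrite -scaleN1r rpredZ. Qed.

Lemma submod_rpredB (x y : V) : x \in Y -> y \in Y -> x - y \in Y.
Proof. by move=> xY yY; rewrite rpredD ?submod_rpredN. Qed.

(* The functional psi stands for a linear combination of the members of s. *)
Lemma functional_in_span s phi :
  (forall y, y \in Y -> (forall chi, chi \in s -> chi y = 0) -> phi y = 0) ->
  exists2 psi : dual V, (forall y, y \in Y -> phi y = psi y) &
    forall G x, (forall chi, chi \in s -> G chi = chi x) -> G psi = psi x.
Proof.
elim: s phi => [|chi s IH] phi phi0.
  exists 0 => [y yY|G x _]; last by rewrite linear0.
  by rewrite phi0.
have [[y0 [y0Y y0s y0chi]]|no] := pselect (exists y0, [/\ y0 \in Y,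
    (forall psi, psi \in s -> psi y0 = 0) & chi y0 != 0]).
  have [|psi psiY psiG] := IH (phi - (phi y0 / chi y0) *: chi).
    move=> y yY ys.
    have yy0 : y - (chi y / chi y0) *: y0 \in Y by rewrite submod_rpredB// rpredZ.
    have : phi (y - (chi y / chi y0) *: y0) = 0.
      apply: phi0 => // xi; rewrite inE => /predU1P[->|xis].
        by rewrite dual_appB dual_appZ divfK// subrr.
      by rewrite dual_appB dual_appZ (ys xi)// (y0s xi)// mulr0 subrr.
    rewrite dual_appB dual_appZ dualB dualZ => <-; congr (_ - _).
    by rewrite mulrAC [in RHS]mulrAC [chi y * _]mulrC.
  exists (psi + (phi y0 / chi y0) *: chi) => [y yY|G x Gx].
    by rewrite dualD -psiY// dualB subrK.
  rewrite dual_appD dual_appZ dualD dualZ (psiG G x) ?Gx ?mem_head//.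
  by move=> xi xis; apply: Gx; rewrite inE xis orbT.
have [|psi psiY psiG] := IH phi.
  move=> y yY ys; apply: phi0 => // xi; rewrite inE => /predU1P[->|/ys//].
  by apply/eqP/negP => /negP chiy; apply: no; exists y.
exists psi => // G x Gx; apply: psiG => xi xis.
by apply: Gx; rewrite inE xis orbT.
Qed.

Variable F : dual (dual V).
Hypothesis FY : @closure (weak_star (dual V)) [set evaluation f | f in [set f | f \in Y]] F.

(** Were [F] nonzero at [phi - psi], a weak* neighbourhood of [F] given by this one functional would
    miss [Y]. *)
Lemma closure_annihilator phi psi : (forall y, y \in Y -> phi y = psi y) -> F phi = F psi.
Proof.
move=> H; apply/eqP; rewrite -subr_eq0 -linearB/=; apply/negP => /negP n0.
pose chi := phi - psi.
have : nbhs (F : weak_star (dual V)) ((fun G : dual (dual V) => G chi) @^-1` ball (F chi) `|F chi|).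
  apply: (@weak_star_continuous R (dual V) chi F); apply: nbhsx_ballx.
  by rewrite normr_gt0.
move=> /FY[_ [[y yY <-]]].
change (`|F chi - chi y| < `|F chi| -> False).
by rewrite [chi y]dualB H// subrr subr0 ltxx.
Qed.

(** Exact interpolation without control of the norm. A functional that cannot be adjusted
    independently of [s] is on [Y] a combination of [s], where agreement is automatic. *)
Lemma closure_interpolation s : exists2 y, y \in Y & forall chi, chi \in s -> F chi = chi y.
Proof.
elim: s => [|chi s [y yY ys]]; first by exists 0 => //; exact: rpred0.
have [[y0 [y0Y y0s y0chi]]|no] := pselect (exists y0, [/\ y0 \in Y,
    (forall psi, psi \in s -> psi y0 = 0) & chi y0 != 0]).
  exists (y + ((F chi - chi y) / chi y0) *: y0); first by rewrite rpredD// rpredZ.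
  move=> xi; rewrite dual_appD dual_appZ inE => /predU1P[->|xis].
    by rewrite divfK// addrC subrK.
  by rewrite (ys xi)// (y0s xi)// mulr0 addr0.
exists y => // xi; rewrite inE => /predU1P[->|/ys//].
have [|psi psiY psiG] := @functional_in_span s chi.
  by move=> z zY zs; apply/eqP/negP => /negP chiz; apply: no; exists z.
by rewrite (closure_annihilator psiY) (psiG F y)// psiY.
Qed.

Let kernel s : set V := [set y | y \in Y /\ forall chi, chi \in s -> chi y = 0].

(** The quotient seminorm modulo the common kernel of [s] in [Y]. *)
Let dist s (x : V) := inf [set `|x - y| | y in kernel s].

Let kernel0 s : kernel s 0.
Proof. by split => [|chi _]; [exact: rpred0|rewrite linear0]. Qed.

Let dist_le s x y : kernel s y -> dist s x <= `|x - y|.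
Proof.
move=> sy; apply: ge_inf; last by exists y.
by exists 0 => _ [z _ <-].
Qed.

Let dist_attained s x (d : R) : 0 < d -> exists2 y, kernel s y & `|x - y| < dist s x + d.
Proof.
move=> d0; have [|_ [y sy <-] yd] := @inf_adherent _ [set `|x - y| | y in kernel s] d d0.
  split; first by exists `|x - 0|, 0.
  by exists 0 => _ [z _ <-].
by exists y.
Qed.

Let dist_sublinear s : sublinear (dist s).
Proof.
have D x z : dist s (x + z) <= dist s x + dist s z.
  apply/ler_addgt0Pr => d d0; have d20 : 0 < d / 2 by lra.
  have [y [yY ys] xy] := dist_attained s x d20.
  have [y' [yY' ys'] zy] := dist_attained s z d20.
  have : kernel s (y + y').
    split; first exact: rpredD.
    by move=> chi chis; rewrite dual_appD ys// ys'// addr0.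
  move=> /(dist_le (x + z)); have := ler_normD (x - y) (z - y').
  rewrite opprD [in X in _ -> X -> _]addrACA; lra.
have Z k x : 0 < k -> dist s (k *: x) <= k * dist s x.
  move=> k0; rewrite -ler_pdivrMl//; apply/ler_addgt0Pr => d d0.
  have [y [yY ys] /ltW xy] := dist_attained s x d0.
  rewrite (le_trans _ xy)// ler_pdivrMl//.
  have : kernel s (k *: y).
    split; first exact: rpredZ.
    by move=> chi chis; rewrite dual_appZ ys// mulr0.
  by move=> /(dist_le (k *: x)); rewrite -scalerBr normrZ gtr0_norm.
have D0 : dist s 0 = 0.
  apply/eqP; rewrite eq_le; apply/andP; split.
    by rewrite (le_trans (dist_le 0 (kernel0 s)))// subr0 normr0.
  apply: lb_le_inf; last by move=> _ [z _ <-].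
  by exists `|0 - 0 : V|, 0.
split=> // k x; rewrite le_eqVlt => /predU1P[<-|k0].
  by rewrite scale0r mul0r.
apply/eqP; rewrite eq_le Z//= -ler_pdivlMl//.
have kV0 : 0 < k^-1 by rewrite invr_gt0.
by have := Z k^-1 (k *: x) kV0; rewrite scalerA mulVf ?gt_eqF// scale1r.
Qed.

(* Goldstine's theorem for finitely many functionals at a time, with exact
   interpolation. *)
Lemma helly s : exists g, [/\ g \in Y, `|g| <= opnorm F + 1 &
  forall chi, chi \in s -> F chi = chi g].
Proof.
have [g0 g0Y g0s] := closure_interpolation s.
(* The functional [f] norms [g0] in the quotient and vanishes on the kernel, hence agrees on [Y]
   with a combination of [s]. Since [F] and [g0] agree on it, the distance of [g0] to the kernel is
   a value of [F], at most [opnorm F]. *)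
have [f [fle fg0]] := hahn_banach g0 (dist_sublinear s).
have dist_norm x : dist s x <= `|x| by have := dist_le x (kernel0 s); rewrite subr0.
have fb x : `|f x| <= 1 * `|x|.
  rewrite mul1r ler_norml (le_trans (fle x))// andbT lerNl -linearN.
  by rewrite (le_trans (fle _))// (le_trans (dist_norm _))// normrN.
have [phi phiE] := dual_of_bounded (linearP f) fb.
have f_kernel y : kernel s y -> f y <= 0.
  by move=> sy; rewrite (le_trans (fle y))// (le_trans (dist_le y sy))// subrr normr0.
have [|psi psiY psiG] := @functional_in_span s phi.
  move=> y yY ys; rewrite phiE; apply/eqP; rewrite eq_le f_kernel//=.
  have : kernel s (- y).
    by split; [exact: submod_rpredN|move=> chi chis; rewrite linearN/= ys// oppr0].
  by move=> /f_kernel; rewrite linearN/= oppr_le0.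
have : dist s g0 <= opnorm F.
  rewrite -fg0 -phiE psiY// -(psiG F g0)// -(closure_annihilator psiY).
  rewrite (le_trans (ler_norm _))// opnorm_ge//.
  by apply: opnorm_le => x x1; rewrite phiE (le_trans (fb x))// mul1r.
have [y [yY ys] gy] := dist_attained s g0 ltr01.
exists (g0 - y); split; first by rewrite submod_rpredB.
  lra.
by move=> chi chis; rewrite dual_appB ys// subr0 g0s.
Qed.

End Helly.

(** * Uniform approximation *)

Lemma ulim_le_ultra (R : realType) (u : nat -> R) (M c : R) : (forall n, `|u n| <= M) ->
  (\forall n \near nat_ultra, u n <= c) -> ulim u <= c.
Proof. by move=> uM; exact: (cvgr_to_le (ulim_cvg uM)). Qed.

(** Realises a mean by an actual member of [Y]. The last clause covers all linear maps, so it can be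
    used directly with point evaluations. *)
Lemma dyadic_mean_vector (R : realType) (V : normedModType R) (Y : submodClosed V)
    (w : nat -> V) M n y : dyadic_mean n y ->
  (forall k, w k \in Y) -> (forall k, `|w k| <= M) ->
  exists v, [/\ v \in Y, `|v| <= M &
    forall phi : V -> R, linear phi -> phi v = y (fun k => phi (w k))].
Proof.
move=> yn wY wM; elim: yn => [k _|{}y z _ [v [vY vM vy]] _ [v' [vY' vM' vy']]].
  by exists (w k); split.
exists (2^-1 *: (v + v')); split; first by rewrite rpredZ// rpredD.
  rewrite normrZ ger0_norm ?invr_ge0// ler_pdivrMl// (le_trans (ler_normD _ _))//.
  lra.
move=> phi lphi; rewrite -vy// -vy'//.
pose L : {linear V -> R} := HB.pack phi (GRing.isLinear.Build _ _ _ _ _ lphi).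
by rewrite -[phi]/(L : V -> R) linearZ linearD mulrC.
Qed.

(** The point 1 is listed separately because it has no room on its right: exact interpolation there
    keeps it from being an exceptional point. *)
Lemma unit_interval_dense_sequence (R : realType) : exists q : nat -> unit_interval R,
  (exists i, q i = oneI R) /\
  forall a b : unit_interval R, val a < val b -> exists i, val a < val (q i) /\ val (q i) < val b.
Proof.
pose q i : unit_interval R :=
  if i is j.+1 then insubd (oneI R) (ratr (odflt 0%Q (unpickle j)) : R) else oneI R.
exists q; split; first by exists 0%N.
move=> a b ab; have [r] := rat_in_itvoo ab; rewrite in_itv/= => /andP[ar rb].
exists (pickle r).+1; rewrite /q pickleK /= !val_insubd ifT ?ar//.
rewrite inE/= in_itv/=; apply/andP; split.
  exact: ltW (le_lt_trans (val_ge0 a) ar).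
exact: ltW (lt_le_trans rb (val_le1 b)).
Qed.

Section UniformApproximation.
Context (R : realType) (X : normedModType R) (e : symmetric_basis X).
Context (Y : submodClosed (VX0 e)).
Notation I := (unit_interval R).
Variables (f : I -> R) (M : R).
Hypothesis Xr : reflexive_space X.
Hypothesis fc : continuous f.
Hypothesis interp : forall T : seq I, exists g : VX0 e,
  [/\ g \in Y, `|g| <= M & forall t, t \in T -> g t = f t].

Lemma interpolated_dvar_le l : fam (zeroI R) l -> dvar e f l <= M.
Proof.
move=> lf; have [g [_ gM gf]] := interp (map fst l ++ map snd l).
apply: le_trans gM; apply: le_trans (dvar_le_VX0_norm g lf).
rewrite /dvar le_eqVlt; apply/orP; left; apply/eqP; congr bnorm.
apply/eq_in_map => x xl; rewrite /incr !gf// mem_cat.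
  by rewrite (map_f fst xl).
by rewrite (map_f snd xl) orbT.
Qed.

Let B := 2 * M / `|e 0%N|.

Let M0 : 0 <= M.
Proof. by have [g [_ gM _]] := interp [::]; exact: le_trans (normr_ge0 _) gM. Qed.

Let B0 : 0 <= B. Proof. by rewrite /B divr_ge0// mulr_ge0. Qed.

Let close_B (g : VX0 e) t : `|g| <= M -> `|g t - f t| <= B.
Proof.
move=> gM; have [g' [_ g'M g'f]] := interp [:: t].
rewrite -g'f ?mem_head// (le_trans (ler_normB _ _))//.
have H (h : VX0 e) : `|h| <= M -> `|h t| <= M / `|e 0%N|.
  by move=> hM; rewrite (le_trans (VX0_pt_le h t))// ler_wpM2r// invr_ge0.
by have := H g gM; have := H g' g'M; rewrite /B; lra.
Qed.

Variable q : nat -> I.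
Hypothesis q1 : exists i, q i = oneI R.
Hypothesis qdense : forall a b : I, val a < val b ->
  exists i, val a < val (q i) /\ val (q i) < val b.

Let leT : rel I := fun a b => val a <= val b.

(** Each exceptional point gets an interval to its right, ending at a listed point before the next
    one and so close that [f] moves by at most [h]. The index bound [n] says how far along [q] a
    function must interpolate to agree with [f] at these ends. *)
Let right_fam (h : R) (D : seq I) : 0 < h -> sorted leT D -> uniq D ->
  (forall t, t \in D -> val t < 1) ->
  exists l (n : nat), [/\ forall p, (forall t, t \in D -> val p <= val t) -> fam p l,
    size l = size D & forall x, x \in l -> [/\ x.1 \in D,
      (exists2 i, (i < n)%N & x.2 = q i) & `|f x.1 - f x.2| <= h]].
Proof.
move=> h0; elim: D => [|t D IH]; first by exists [::], 0%N.
move=> /= tD /andP[tnD uD] D1.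
have tle : all (leT t) D.
  by apply: order_path_min tD => a b c; exact: le_trans.
have [|||l [n [lf sl lP]]] := IH.
- exact: path_sorted tD.
- exact: uD.
- by move=> s sD; apply: D1; rewrite inE sD orbT.
have [d d0 fd] := (unit_interval_continuousP f t).1 (@fc t) h h0.
have t1 : val t < 1 by apply: D1; rewrite mem_head.
have [|d' d'0 d'P] := @seq_positive_lower_bound R _ D (fun s => val s - val t).
  move=> s sD; rewrite subr_gt0 lt_neqAle; apply/andP; split.
    by apply: contra tnD => /eqP/val_inj ->.
  exact: (allP tle s sD).
pose r := Num.min (1 - val t) (Num.min d d').
have r0 : 0 < r by rewrite !lt_min d0 d'0 subr_gt0 t1.
have [b bE] : exists b : I, val b = val t + r.
  apply: unit_interval_pt; first by rewrite addr_ge0 ?val_ge0// ltW.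
  by rewrite -lerBrDl ge_min lexx.
have [i [ti ib]] : exists i, val t < val (q i) /\ val (q i) < val b.
  by apply: qdense; rewrite bE ltrDl.
have rd : r <= d by rewrite !ge_min lexx !orbT.
have rd' : r <= d' by rewrite !ge_min lexx !orbT.
exists ((t, q i) :: l), (maxn n i.+1); split => /=; [|by rewrite sl|].
- move=> p pD; rewrite pD ?mem_head// ti /=; apply: lf => s sD.
  have := d'P s sD; have := ib; rewrite bE; move: rd'; set a := val s; lra.
- move=> x; rewrite inE => /predU1P[->/=|xl].
    split; [by rewrite mem_head|by exists i => //; rewrite leq_maxr|].
    apply/ltW/fd; rewrite ltr0_norm ?subr_lt0//.
    by move: ib rd; rewrite bE; set a := val (q i); lra.
  have [xD [j jn xj] xh] := lP x xl; split => //.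
    by rewrite inE xD orbT.
  by exists j => //; rewrite leq_max jn.
Qed.

(* D is a largest set of points at which some sequence interpolating f on D0
   and on longer and longer initial segments of q stays eta away from f. *)
Let peaks (D0 : seq I) (eta : R) : 0 < eta -> exists (g : nat -> VX0 e) (D : seq I),
  (forall n, [/\ g n \in Y, `|g n| <= M & forall t, t \in D0 -> g n t = f t]) /\
  forall t, t \notin D -> \forall n \near \oo, `|g n t - f t| <= eta.
Proof.
move=> eta0; pose good (g : nat -> VX0 e) := forall n, [/\ g n \in Y, `|g n| <= M,
  (forall t, t \in D0 -> g n t = f t) & forall i, (i < n)%N -> g n (q i) = f (q i)].
pose P k := exists g D, [/\ good g, uniq D, size D = k &
  forall t, t \in D -> forall n, eta < `|g n t - f t|].
have h0 : 0 < eta / 2 by lra.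
have [N NP] := fam_oscillation e M Xr h0.
(* At each point of [D] the function [g n] is [eta] away from [f], at the right end of its interval
   it equals [f], and [f] moves by at most [eta / 2]. This forces increments of at least [eta / 2]
   on disjoint intervals. *)
have PN k : `[< P k >] -> (k <= N)%N.
  move=> /asboolP[g [D [gg uD <- Dg]]].
  have D1 t : t \in D -> val t < 1.
    move=> tD; rewrite lt_neqAle val_le1 andbT; apply/eqP => t1.
    have [i qi] := q1; have [_ _ _ /(_ i (ltnSn i))] := gg i.+1.
    have -> : q i = t by rewrite qi; apply/val_inj; rewrite /= t1.
    by move=> gt; have := Dg t tD i.+1; rewrite gt subrr normr0 ltNge ltW.
  have leTt : total leT by move=> a b; exact: le_total.
  have [||l [n [lf sl lP]]] := right_fam h0 (sort_sorted leTt D).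
  - by rewrite sort_uniq.
  - by move=> t; rewrite mem_sort; exact: D1.
  rewrite -(size_sort leT D) -sl; apply: ltnW.
  have [_ gM _ gq] := gg n.
  apply: (NP (g n)).
  - by move=> l' l'f; exact: le_trans (dvar_le_VX0_norm _ l'f) gM.
  - by apply: lf => t _; exact: val_ge0.
  - move=> x /lP[]; rewrite mem_sort => xD [i i_n xi] xh.
    have Dx := Dg _ xD n; rewrite distrC in Dx.
    rewrite /incr; have -> : g n x.2 = f x.2 by rewrite xi gq.
    have -> : f x.2 - g n x.1 = (f x.1 - g n x.1) - (f x.1 - f x.2) by lra.
    by have := lerB_dist (f x.1 - g n x.1) (f x.1 - f x.2); lra.
have P0 : exists k, `[< P k >].
  exists 0%N; apply/asboolP.
  have /choice[g gP] : forall n, exists g : VX0 e, [/\ g \in Y, `|g| <= M,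
    (forall t, t \in D0 -> g t = f t) & forall i, (i < n)%N -> g (q i) = f (q i)].
    move=> n; have [g [gY gM gf]] := interp (D0 ++ map q (iota 0 n)).
    exists g; split => // [t tD|i i_n]; apply: gf; rewrite mem_cat ?tD//.
    by rewrite map_f ?orbT// mem_iota.
  by exists g, [::].
case: (ex_maxnP P0 PN) => k /asboolP[g [D [gg uD sD Dg]]] kmax.
exists g, D; split=> [n|t tD]; first by have [] := gg n.
apply: contrapT => nev.
(* A subsequence staying away from [f] at a new [t] still interpolates at enough points, because
   [kap m >= m]; it would enlarge [D]. *)
have /choice[kap kapP] : forall m, exists n, (m <= n)%N /\ eta < `|g n t - f t|.
  move=> m; apply: contrapT => /forallNP H; apply: nev; exists m => // n /= mn.
  by rewrite leNgt; apply/negP => gn; apply: (H n).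
have : `[< P k.+1 >].
  apply/asboolP; exists (g \o kap), (t :: D); split => //=.
  - move=> n; have [gY gM gD0 gq] := gg (kap n); split => // i i_n.
    by apply: gq; exact: leq_trans i_n (kapP n).1.
  - by rewrite tD.
  - by rewrite sD.
  - move=> s; rewrite inE => /predU1P[-> n|sD' n]; first exact: (kapP n).2.
    exact: Dg.
by move=> /kmax; rewrite ltnn.
Qed.

(** Each new sequence interpolates [f] exactly at the exceptional points of the earlier ones, so any
    [t] is exceptional for at most one summand and the crude bound [B] is paid only once. *)
Let averaged (eta : R) (m : nat) : 0 < eta -> exists (h : nat -> VX0 e) (D : seq I),
  (forall n, h n \in Y /\ `|h n| <= m%:R * M) /\
  forall t, (\forall n \near \oo, `|h n t - m%:R * f t| <= m%:R * eta + B) /\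
    (t \notin D -> \forall n \near \oo, `|h n t - m%:R * f t| <= m%:R * eta).
Proof.
move=> eta0; elim: m => [|m [h [D [hY hD]]]].
  exists (fun=> 0), [::]; split => [n|t].
    by rewrite rpred0 normr0 mul0r.
  have E0 : `|(0 : VX0 e) t - 0%:R * f t| = 0 by rewrite mul0r subr0 normr0.
  by split=> [|_]; apply: nearW => n; rewrite E0 mul0r ?add0r.
have [g [D' [gY gD']]] := peaks D eta0.
have E1 n t : (h n + g n) t - m.+1%:R * f t = (h n t - m%:R * f t) + (g n t - f t).
  rewrite -[(h n + g n) t]/(h n t + g n t) -natr1; ring.
exists (fun n => h n + g n), (D ++ D'); split => [n|t].
  have [hnY hnM] := hY n; have [gnY gnM _] := gY n; split; first exact: rpredD.
  by rewrite (le_trans (ler_normD _ _))// -(natr1 m) mulrDl mul1r lerD.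
split; last first.
  rewrite mem_cat negb_or => /andP[tD tD']; have [_ /(_ tD)] := hD t.
  move=> h1; have g1 := gD' t tD'; near=> n.
  rewrite E1 (le_trans (ler_normD _ _))// -(natr1 m) mulrDl mul1r lerD//.
    by near: n.
  by near: n.
have [tD|tD] := boolP (t \in D).
  have [h1 _] := hD t; near=> n.
  have [_ _ /(_ t tD) gt] := gY n.
  rewrite E1 gt subrr addr0 (@le_trans _ _ (m%:R * eta + B))//; first by near: n.
  by rewrite lerD2r ler_pM2r// ler_nat.
have [_ /(_ tD)] := hD t => h1; near=> n.
rewrite E1 (le_trans (ler_normD _ _))// lerD//.
  rewrite (@le_trans _ _ (m%:R * eta))//; first by near: n.
  by rewrite ler_pM2r// ler_nat.
by have [_ gM _] := gY n; exact: close_B.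
Unshelve. all: by end_near. Qed.

(** After division by [m] the single exceptional error is [B / m], at most [eta / 2]. *)
Let pointwise (eta : R) : 0 < eta -> exists g : nat -> VX0 e,
  (forall n, g n \in Y /\ `|g n| <= M) /\
  forall t, \forall n \near \oo, `|g n t - f t| <= eta.
Proof.
move=> eta0; have h0 : 0 < eta / 2 by lra.
pose m := (Num.truncn (B / (eta / 2))).+1.
have m0 : 0 < m%:R :> R by rewrite ltr0n.
have Bm : B <= m%:R * (eta / 2) by rewrite -ler_pdivrMr// ltW// truncnS_gt.
have [h [D [hY hD]]] := averaged m h0.
exists (fun n => m%:R^-1 *: h n); split => [n|t].
  have [hnY hnM] := hY n; split; first by rewrite rpredZ.
  by rewrite normrZ gtr0_norm ?invr_gt0// ler_pdivrMl.
have [h1 _] := hD t; apply: filterS h1 => n h1.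
rewrite -[(_ *: h n) t]/(m%:R^-1 * h n t).
have -> : m%:R^-1 * h n t - f t = m%:R^-1 * (h n t - m%:R * f t).
  by rewrite mulrBr mulrA mulVf ?gt_eqF// mul1r.
rewrite normrM gtr0_norm ?invr_gt0// ler_pdivrMl// (le_trans h1)//.
lra.
Qed.

(** The ultralimit condition of Simons' inequality holds by compactness: the points of [[0, 1]]
    converge along the ultrafilter to some [t], and by continuity the ultralimit of the differences
    is governed by the difference at [t]. *)
Lemma uniform_approximation (eta : R) : 0 < eta -> exists g : VX0 e,
  [/\ g \in Y, `|g| <= M & forall t, `|g t - f t| <= eta].
Proof.
move=> eta0; have h0 : 0 < eta / 2 by lra.
have [g [gY g_near]] := pointwise h0.
(* The sign makes the one-sided inequality two-sided; subtracting [eta / 2] turns pointwise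
   closeness into a nonpositive upper limit. *)
pose h (x : I * bool) k := (-1) ^+ x.2 * (g k x.1 - f x.1) - eta / 2.
have hB x k : `|h x k| <= B + eta / 2.
  rewrite (le_trans (ler_normB _ _))// normrM normr_sign mul1r.
  by rewrite (gtr0_norm h0) lerD2r; apply: close_B; exact: (gY k).2.
have [|y yn yh] := @simons R (I * bool)%type h (B + eta / 2) (zeroI R, true) hB 0 _ (eta / 2) h0.
  move=> x eps eps0.
  have vB n : `|val (x n).1| <= 1 by rewrite ger0_norm ?val_ge0 ?val_le1.
  have [t tE] : exists t : I, val t = ulim (fun n => val (x n).1).
    apply: unit_interval_pt.
      by apply: (ulim_ge vB); apply: nearW => n; exact: val_ge0.
    by apply: (ulim_le vB); apply: nearW => n; exact: val_le1.
  have xt := ulim_cvg vB; rewrite -tE in xt.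
  have cont_lim (u : I -> R) : {for t, continuous u} -> forall r, 0 < r ->
      \forall n \near nat_ultra, `|u t - u (x n).1| < r.
    move=> /unit_interval_continuousP uc r /uc[d d0 ud].
    move/cvgrPdist_lt : xt => /(_ d d0); apply: filterS => n; exact: ud.
  apply: filterS (g_near t) => k gt.
  apply: (ulim_le_ultra (fun n => hB (x n) k)).
  have gc : {for t, continuous (g k)}.
    apply/unit_interval_continuousP => r r0; have r20 : 0 < r / 2 by lra.
    have [d d0 gd] := VX0_uniformly_continuous (g k) r20.
    exists d => // b /ltW/gd; lra.
  have e20 : 0 < eps / 2 by lra.
  have := cont_lim _ gc _ e20; have := cont_lim _ (@fc t) _ e20.
  apply: filterS2 => n fn gn; rewrite /h lerBlDr.
  rewrite (le_trans (ler_norm _))// normrM normr_sign mul1r.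
  have := ler_normD (g k t - f t) ((f t - f (x n).1) - (g k t - g k (x n).1)).
  have := ler_normB (f t - f (x n).1) (g k t - g k (x n).1).
  have -> : (g k t - f t) + ((f t - f (x n).1) - (g k t - g k (x n).1)) =
    g k (x n).1 - f (x n).1 by lra.
  lra.
have [v [vY vM vy]] := dyadic_mean_vector yn (fun k => (gY k).1) (fun k => (gY k).2).
exists v; split => // t.
have vt : v t = y (fun k => g k t) by apply: (vy (fun f : VX0 e => f t)).
have H (b : bool) : (-1) ^+ b * (v t - f t) <= eta.
  have := yh (t, b); rewrite /h /=.
  have -> : y (fun k => (-1) ^+ b * (g k t - f t) - eta / 2) =
      (-1) ^+ b * (v t - f t) - eta / 2.
    rewrite (dyadic_meanD (fun k => (-1) ^+ b * (g k t - f t)) (fun=> - (eta / 2)) yn).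
    rewrite (dyadic_mean_cst _ yn) (dyadic_meanZ _ (fun k => g k t - f t) yn).
    by rewrite (dyadic_meanD (fun k => g k t) (fun=> - f t) yn) (dyadic_mean_cst _ yn) -vt.
  lra.
rewrite ler_norml; have := H true; have := H false.
by rewrite expr0 expr1 mul1r mulN1r => ? ?; apply/andP; split; lra.
Qed.

End UniformApproximation.

(** * Disjoint scales *)

Lemma dyadic_mean_sum (R : realType) (n : nat) (y : (nat -> R) -> R) (T : Type) (s : seq T)
    (a : T -> nat -> R) : dyadic_mean n y ->
  y (fun k => \sum_(i <- s) a i k) = \sum_(i <- s) y (a i).
Proof.
move=> yn; elim: s => [|i s IH].
  rewrite big_nil -[RHS](dyadic_mean_cst 0 yn); congr y; apply/funext => k.
  by rewrite big_nil.
rewrite big_cons -IH -(dyadic_meanD _ _ yn); congr y; apply/funext => k.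
by rewrite big_cons.
Qed.

Section Bands.
Context (R : realType) (X : normedModType R) (e : symmetric_basis X).
Notation I := (unit_interval R).
Variables (g : nat -> VX0 e) (M : R) (d : nat -> R).
Hypothesis Xr : reflexive_space X.
Hypothesis gM : forall k, `|g k| <= M.
Hypothesis d0 : d 0%N = 1.
Hypothesis d_gt0 : forall k, 0 < d k.
Hypothesis d_half : forall k, d k.+1 <= d k / 2.
Implicit Types (x : I * I) (l : seq (I * I)).

Definition band (k : nat) x := (d k.+1 < len x) && (len x <= d k).

Definition band_incr (k : nat) x : R := if band k x then incr (g k) x else 0.

Let d_mono k m : (k <= m)%N -> d m <= d k.
Proof.
move=> /subnK <-; elim: (m - k)%N => [//|i IH]; rewrite addSn.
by apply: le_trans IH; apply: le_trans (d_half _) _; have := d_gt0 (i + k); lra.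
Qed.

Let d_pow k : d k <= 2^-1 ^+ k.
Proof.
elim: k => [|k IH]; first by rewrite d0 expr0.
by apply: (le_trans (d_half k)); rewrite exprS; move: IH; set a := _ ^+ k; lra.
Qed.

Let band_exists x : val x.1 < val x.2 -> exists k, band k x.
Proof.
move=> xx; have len0 : 0 < len x by rewrite subr_gt0.
have ex : exists k, d k.+1 < len x.
  have : (2^-1 : R) ^+ n @[n --> \oo] --> 0 by apply: cvg_expr; rewrite gtr0_norm; lra.
  move=> /cvgrPdist_lt/(_ _ len0)[n _ /(_ n.+1 (leqnSn _))].
  rewrite sub0r normrN ger0_norm ?exprn_ge0// => H; exists n.
  exact: le_lt_trans (d_pow _) H.
have [k dk kmin] := ex_minnP ex; exists k; rewrite /band dk /=.
case: k dk kmin => [|k] dk kmin; first by rewrite d0 len_le1.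
by rewrite leNgt; apply/negP => /kmin; rewrite ltnn.
Qed.

Let band_unique k m x : band k x -> band m x -> k = m.
Proof.
wlog km : k m / (k <= m)%N.
  by move=> H; have [|/ltnW mk] := leqP k m; [exact: H|move=> ? ?; apply/esym/H].
move=> /andP[dk _] /andP[_ dm]; apply/eqP; rewrite eqn_leq km leqNgt.
apply/negP => /d_mono mk; have := lt_le_trans dk dm.
by rewrite ltNge mk.
Qed.

Let bd x : nat := xget 0%N [set k | band k x].

Let bdP x : val x.1 < val x.2 -> band (bd x) x.
Proof. by move=> /band_exists[k kx]; exact: (@xgetPex _ 0%N [set k | band k x]) (ex_intro _ k kx). Qed.

Let rank x : nat := Num.truncn (val x.1 / d (bd x).+1).

(* Two disjoint intervals in the same band have left endpoints more than
   d (k.+1) apart, hence distinct slots. *)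
Let slot x : nat := pickle (bd x, rank x).

Let slot_inj p l : fam p l -> {in l &, injective slot}.
Proof.
move=> lf x y xl yl; move=> /(pcan_inj (@pickleK _))[bxy rxy].
have xx := fam_lt lf xl; have yy := fam_lt lf yl.
apply: (fam_inj_left lf xl yl).
- have /andP[yb _] := bdP yy; move: rxy; rewrite /rank bxy => rxy.
  have D := d_gt0 (bd y).+1.
  have /andP[_] : (Num.truncn (val x.1 / d (bd y).+1))%:R <= val x.1 / d (bd y).+1
      < (Num.truncn (val x.1 / d (bd y).+1)).+1%:R.
    by rewrite truncn_itv// divr_ge0 ?val_ge0// ltW.
  have /andP[+ _] : (Num.truncn (val y.1 / d (bd y).+1))%:R <= val y.1 / d (bd y).+1
      < (Num.truncn (val y.1 / d (bd y).+1)).+1%:R.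
    by rewrite truncn_itv// divr_ge0 ?val_ge0// ltW.
  rewrite rxy ler_pdivlMr// ltr_pdivrMr// -natr1 mulrDl mul1r.
  by move: yb; rewrite /len; set a := val x.1; set b := val y.1; set c := val y.2; lra.
- have /andP[xb _] := bdP xx; move: rxy; rewrite /rank -bxy => rxy.
  have D := d_gt0 (bd x).+1.
  have /andP[+ _] : (Num.truncn (val x.1 / d (bd x).+1))%:R <= val x.1 / d (bd x).+1
      < (Num.truncn (val x.1 / d (bd x).+1)).+1%:R.
    by rewrite truncn_itv// divr_ge0 ?val_ge0// ltW.
  have /andP[_] : (Num.truncn (val y.1 / d (bd x).+1))%:R <= val y.1 / d (bd x).+1
      < (Num.truncn (val y.1 / d (bd x).+1)).+1%:R.
    by rewrite truncn_itv// divr_ge0 ?val_ge0// ltW.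
  rewrite rxy ler_pdivlMr// ltr_pdivrMr// -natr1 mulrDl mul1r.
  by move: xb; rewrite /len; set a := val x.1; set b := val y.1; set c := val x.2; lra.
Qed.

(** A finite list that contains the slots of all intervals of band [k]: left endpoints are at most
    1, so ranks are at most the integer part of [1 / d k.+1]. *)
Let slots (k : nat) : seq nat :=
  [seq pickle (k, r) | r <- iota 0 (Num.truncn (d k.+1)^-1).+1].

Let slots_uniq k : uniq (slots k).
Proof. by rewrite map_inj_uniq ?iota_uniq// => r s /(pcan_inj (@pickleK _))[]. Qed.

Let slots_finite s : \forall k \near \oo, s \notin slots k.
Proof.
exists (if @unpickle (nat * nat)%type s is Some (k, _) then k.+1 else 0%N) => // k /= sk.
by apply/negP => /mapP[r _ sE]; move: sk; rewrite sE pickleK ltnn.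
Qed.

Let slot_mem k x : val x.1 < val x.2 -> (slot x \in slots k) = band k x.
Proof.
move=> xx; have bx := bdP xx; apply/idP/idP => [/mapP[r _]|kx].
  by rewrite /slot => /(pcan_inj (@pickleK _))[<- _].
have bk := band_unique bx kx; apply/mapP; exists (rank x); last by rewrite /slot bk.
rewrite mem_iota add0n leq0n /= ltnS /rank bk; apply: le_truncn.
by rewrite ler_pdivrMr// mulVf ?gt_eqF// val_le1.
Qed.

Let vec l (u : I * I -> R) : X := \sum_(i < size l) u (nth (zeroI R, zeroI R) l i) *: e i.

Let vec_norm l u : `|vec l u| = bnorm e (map u l).
Proof.
rewrite /bnorm size_map; congr `|_|; apply: eq_bigr => i _.
by rewrite (nth_map (zeroI R, zeroI R)).
Qed.

Let vec_slot p l u : fam p l -> `|\sum_(x <- l) u x *: e (slot x)| = bnorm e (map u l).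
Proof.
move=> lf; rewrite -vec_norm /vec.
rewrite -(@norm_basis_reindex _ _ e (size l) (fun i => u (nth (zeroI R, zeroI R) l i))
  (fun i => slot (nth (zeroI R, zeroI R) l i))); last first.
  move=> i j; rewrite !inE => il jl /(slot_inj lf).
  move=> /(_ (mem_nth _ il) (mem_nth _ jl)) /eqP.
  by rewrite nth_uniq ?(fam_uniq lf)// => /eqP.
by rewrite (big_nth (zeroI R, zeroI R)) big_mkord.
Qed.

Let band_incr_le k l : fam (zeroI R) l -> bnorm e (map (band_incr k) l) <= M.
Proof.
move=> lf; rewrite -(bnorm_map_filter _ _ (band k) (incr (g k))).
apply: le_trans (gM k); apply: le_trans (dvar_le_VX0_norm (g k) lf).
exact: bnorm_map_filter_le.
Qed.

(** Pairing with functionals of norm at most 1 turns the norm, over all families, into the supremum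
    of scalars that Simons' inequality handles. *)
Let T := ({l | fam (zeroI R) l} * {phi : dual X | forall z, `|phi z| <= `|z|})%type.

Let pairing (t : T) (k : nat) : R := sval t.2 (vec (sval t.1) (band_incr k)).

(** The families vary with [j], but slots place each interval at a basis vector determined by its
    band and rank alone. Band [k] then always lives on the fixed block [slots k], and weak nullity
    of blocks applies. *)
Let pairing_limsup (t : nat -> T) eps : 0 < eps ->
  \forall k \near \oo, ulim (fun j => pairing (t j) k) <= eps.
Proof.
move=> eps0.
pose l j := sval (t j).1; pose phi j := sval (t j).2.
have lf j : fam (zeroI R) (l j) by exact: svalP (t j).1.
have phi1 j z : `|phi j z| <= `|z| by exact: svalP (t j).2 z.
(* [xi j] is [phi j] read through the slots: it uses only the coordinates of [z] at the slots of
   [l j], hence keeps norm at most 1. *)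
have /choice[xi xiE] : forall j, exists xi : dual X,
    forall z, xi z = phi j (vec (l j) (fun x => coord e z (slot x))).
  move=> j; apply: (@dual_of_bounded _ _ _ 1) => [k y z|z].
    rewrite -[k *: phi j _]/(k * phi j _) -dual_appZ -dual_appD; congr (phi j _).
    rewrite /vec scaler_sumr -big_split; apply: eq_bigr => i _ /=.
    by rewrite coord_linear scalerDl scalerA.
  rewrite mul1r (le_trans (phi1 j _))// vec_norm -(vec_slot _ (lf j)).
  rewrite -(big_map slot xpredT (fun s => coord e z s *: e s)) coord_sum_le//.
  by rewrite map_inj_in_uniq ?(fam_uniq (lf j))//; exact: slot_inj (lf j).
have xi1 j z : `|xi j z| <= `|z|.
  rewrite xiE (le_trans (phi1 j _))// vec_norm -(vec_slot _ (lf j)).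
  rewrite -(big_map slot xpredT (fun s => coord e z s *: e s)) coord_sum_le//.
  by rewrite map_inj_in_uniq ?(fam_uniq (lf j))//; exact: slot_inj (lf j).
pose b j s := \sum_(x <- l j | slot x == s) incr (g (bd x)) x.
have bE j k : \sum_(s <- slots k) b j s *: e s = \sum_(x <- l j) band_incr k x *: e (slot x).
  rewrite /b (eq_bigr (fun s => \sum_(x <- l j | slot x == s) incr (g (bd x)) x *: e s)); last first.
    by move=> s _; rewrite scaler_suml.
  rewrite (exchange_big_dep xpredT) //= big_seq [RHS]big_seq; apply: eq_bigr => x xl.
  have xx := fam_lt (lf j) xl; rewrite /band_incr -(slot_mem k xx).
  rewrite (eq_bigl (fun s => s == slot x)); last by move=> s; rewrite eq_sym.
  case: (boolP (slot x \in slots k)) => [sx|sx]; last first.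
    rewrite scale0r big_seq_cond big1// => s /andP[sS /eqP sE].
    by rewrite -sE sS in sx.
  rewrite -big_filter.
  have -> : [seq s <- slots k | s == slot x] = [:: slot x].
    exact: filter_pred1_uniq (slots_uniq k) sx.
  rewrite big_seq1.
  have kx : band k x by rewrite -slot_mem.
  by rewrite (band_unique (bdP xx) kx).
have bM j k : `|\sum_(s <- slots k) b j s *: e s| <= M.
  by rewrite bE (vec_slot _ (lf j)) band_incr_le.
have := block_pairing_limsup Xr slots_finite slots_uniq xi1 bM eps0.
apply: filterS => k; congr (_ <= _); congr ulim; apply/funext => j.
rewrite xiE bE /pairing; congr (phi j _); apply: eq_bigr => i _; congr (_ *: _).
set x0 := nth _ _ _; have x0l : x0 \in l j by rewrite mem_nth.
rewrite coord_sum (bigD1_seq x0) ?(fam_uniq (lf j))//= eqxx mulr1 big_seq_cond.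
rewrite big1 ?addr0// => x /andP[xl xx0]; case: eqP => [/(slot_inj (lf j))|]; last by rewrite mulr0.
by move=> /(_ x0l xl) xE; rewrite xE eqxx in xx0.
Qed.

Lemma small_band_mean n eps : 0 < eps -> exists2 y, dyadic_mean n y &
  forall l, fam (zeroI R) l -> bnorm e [seq y (fun k => band_incr k x) | x <- l] <= eps.
Proof.
move=> eps0.
have pM t k : `|pairing t k| <= M.
  rewrite /pairing (le_trans (svalP t.2 _))// vec_norm band_incr_le//.
  exact: svalP t.1.
have t0 : T.
  split; first by exists [::].
  by exists 0 => z; rewrite normr0.
have [y yn yP] := simons t0 pM n pairing_limsup eps0.
exists y => // l lf.
have [phi [phi1 phiE]] := hahn_banach_norm (vec l (fun x => y (fun k => band_incr k x))).
rewrite -vec_norm -phiE.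
have := yP (exist _ l lf, exist _ phi phi1); apply: le_trans.
rewrite /pairing /= /vec linear_sum.
rewrite (_ : (fun k => _) = fun k => \sum_(i < size l)
    phi (e i) * band_incr k (nth (zeroI R, zeroI R) l i)); last first.
  apply/funext => k; rewrite linear_sum; apply: eq_bigr => i _.
  by rewrite [RHS]mulrC; exact: dual_appZ.
rewrite (dyadic_mean_sum _ _ yn) le_eqVlt; apply/orP; left; apply/eqP.
apply: eq_bigr => i _; rewrite (dyadic_meanZ _ _ yn) [RHS]mulrC.
exact: dual_appZ.
Qed.

End Bands.

(** * Convex blocks with increasing weights *)

Section BlockMeans.
Context (R : realType) (X : normedModType R) (e : symmetric_basis X).
Context (Y : submodClosed (VX0 e)).
Notation I := (unit_interval R).
Notation h n := ((2^-1 : R) ^+ n).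
Variables (f : I -> R) (M : R).
Hypothesis Xr : reflexive_space X.
Hypothesis f_dvar : forall l, fam (zeroI R) l -> dvar e f l <= M.
Hypothesis approx : forall eta : R, 0 < eta -> exists g : VX0 e,
  [/\ g \in Y, `|g| <= M & forall t, `|g t - f t| <= eta].
Implicit Types (x : I * I) (l : seq (I * I)).

Let h_gt0 n : 0 < h n. Proof. by rewrite exprn_gt0. Qed.

Let hS n : h n = 2 * h n.+1. Proof. by rewrite exprS; set a := _ ^+ n; lra. Qed.

Let h_le m n : (m <= n)%N -> h n <= h m.
Proof. by move=> mn; rewrite ler_wiXn2l//; lra. Qed.

(** The choices alternate: [g k] is taken uniformly so close to [f] that the at most [1 / d k]
    intervals longer than [d k] do not distinguish them; then [d k.+1] is taken so small that [g k],
    lying in [VX0], is negligible at that scale. *)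
Lemma approximating_sequence : exists (g : nat -> VX0 e) (d : nat -> R),
  [/\ d 0%N = 1, forall k, 0 < d k, forall k, d k.+1 <= d k / 2,
    forall k, [/\ g k \in Y, `|g k| <= M & forall t, `|g k t - f t| <= h k] &
    forall k l, fam (zeroI R) l ->
      ((forall x, x \in l -> d k < len x) ->
         bnorm e [seq incr (g k) x - incr f x | x <- l] <= h k) /\
      ((forall x, x \in l -> len x <= d k.+1) -> dvar e (g k) l <= h k)].
Proof.
have e0 := norm_basis_gt0 e.
pose P := {d : R | 0 < d}.
pose mk (d : R) (D : 0 < d) : P := exist _ d D.
have /choice[next nextP] : forall p : nat * P, exists q : VX0 e * P,
    [/\ sval q.2 <= sval p.2 / 2,
     [/\ q.1 \in Y, `|q.1| <= M & forall t, `|q.1 t - f t| <= h p.1] &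
     forall l, fam (zeroI R) l ->
      ((forall x, x \in l -> sval p.2 < len x) ->
         bnorm e [seq incr q.1 x - incr f x | x <- l] <= h p.1) /\
      ((forall x, x \in l -> len x <= sval q.2) -> dvar e q.1 l <= h p.1)].
  move=> [k [d d0]] /=.
  pose eta := Num.min (h k) (h k * d / (2 * `|e 0%N|)).
  have eta0 : 0 < eta by rewrite lt_min h_gt0 divr_gt0 ?mulr_gt0.
  have [g [gY gM gf]] := approx eta0.
  have [d' d'0 gd'] := dvar_fine (set_mem (VX0P g)) (h_gt0 k).
  have D0 : 0 < Num.min d' (d / 2) by rewrite lt_min d'0 divr_gt0.
  exists (g, mk _ D0); split => /=; first by rewrite ge_min lexx orbT.
    by split => // t; rewrite (le_trans (gf t))// ge_min lexx.
  move=> l lf; split => [ld|ld].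
    have gf2 x : `|incr g x - incr f x| <= 2 * eta.
      rewrite /incr; have -> : g x.2 - g x.1 - (f x.2 - f x.1) = (g x.2 - f x.2) - (g x.1 - f x.1) by lra.
      by have := gf x.1; have := gf x.2; have := ler_normB (g x.2 - f x.2) (g x.1 - f x.1); lra.
    apply: (le_trans (bnorm_map_le_size e (fun x _ => gf2 x))).
    have sd : (size l)%:R * d <= 1.
      have := fam_long_size lf (fun x xl => ltW (ld x xl)); move/le_trans; apply.
      by rewrite subr0.
    have eta_d : 2 * eta * `|e 0%N| <= h k * d.
      have : eta <= h k * d / (2 * `|e 0%N|) by rewrite ge_min lexx orbT.
      by rewrite ler_pdivlMr ?mulr_gt0// => ?; rewrite mulrAC [2 * _ * _]mulrC.
    rewrite -mulrA (le_trans (ler_wpM2l (ler0n _ _) eta_d))// mulrCA.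
    by rewrite ler_piMr// ltW.
  by apply: gd' => // x /ld/le_trans; apply; rewrite ge_min lexx.
(* The pair [u n] holds [g n] together with [d n.+1]; [d] is therefore read off with a shift and
   starts at 1. *)
pose fix u n : VX0 e * P := if n is m.+1 then next (m.+1, (u m).2)
  else next (0%N, mk 1 ltr01).
pose d n := if n is m.+1 then sval (u m).2 else 1.
have uE n : exists D : 0 < d n, u n = next (n, mk (d n) D).
  case: n => [|n]; first by exists ltr01.
  have H (q : P) : exists D : 0 < sval q, q = mk (sval q) D by case: q => a D; exists D.
  have [D E] := H (u n).2; exists D; rewrite /d -[mk _ _]E //.
exists (fun n => (u n).1), d; split => //.
- by move=> k; case: (uE k).
- by move=> k; have [D uk] := uE k; have [] := nextP (k, mk (d k) D); rewrite -uk.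
- by move=> k; have [D uk] := uE k; have [] := nextP (k, mk (d k) D); rewrite -uk.
- by move=> k l; have [D uk] := uE k; have [_ _] := nextP (k, mk (d k) D);
    rewrite -uk; apply.
Qed.

(* Up to small errors, the increments of w j are those of f times a weight
   C j x in [0, 1] which increases with j. *)
Definition monotone_weights (w : nat -> VX0 e) (C : nat -> I * I -> R) :=
  [/\ forall j x, 0 <= C j x <= 1, forall j x, C j x <= C j.+1 x &
    forall j l, fam (zeroI R) l ->
      bnorm e [seq incr (w j) x - C j x * incr f x | x <- l] <= 3 * h j].

(** The weight [C j x] is the mean over a block of indices [k] of the indicator of [d k < len x].
    These indicators increase with [k] and successive blocks are disjoint and ordered, so the
    weights increase with [j]. The error is [2 * h j] outside the bands and [h j] from the averaged
    bands. *)
Lemma monotone_weights_exist : exists (w : nat -> VX0 e) C,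
  (forall j, [/\ w j \in Y, `|w j| <= M & forall t, `|w j t - f t| <= h j]) /\
  monotone_weights w C.
Proof.
have [g [d [d0 d_gt0 d_half gP g_fam]]] := approximating_sequence.
have gM k : `|g k| <= M by case: (gP k).
pose c (k : nat) x : R := ((d k < len x)%R)%:R.
have d_mono k m : (k <= m)%N -> d m <= d k.
  move=> /subnK <-; elim: (m - k)%N => [//|i IH]; rewrite addSn.
  by apply: le_trans IH; apply: le_trans (d_half _) _; have := d_gt0 (i + k)%N; lra.
have c_mono k m x : (k <= m)%N -> c k x <= c m x.
  move=> km; rewrite /c; case: (ltP (d k) (len x)) => // dk.
  by rewrite (le_lt_trans (d_mono _ _ km) dk).
have c01 k x : 0 <= c k x <= 1 by rewrite /c; case: (_ < _); rewrite ?lexx ?ler01.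
pose rest k x := incr (g k) x - c k x * incr f x - band_incr g d k x.
have rest_le k l : fam (zeroI R) l -> bnorm e (map (rest k) l) <= 2 * h k.
  move=> lf; have -> : map (rest k) l = [seq
      (if len x <= d k.+1 then incr (g k) x else 0) +
      (if d k < len x then incr (g k) x - incr f x else 0) | x <- l].
    apply: eq_map => x; rewrite /rest /c /band_incr /band.
    have dk := d_half k; have dk0 := d_gt0 k.
    case: (leP (len x) (d k.+1)) => x1 /=; case: (ltP (d k) (len x)) => x2 /=; lra.
  apply: (le_trans (bnorm_mapD _ _ _ _)).
  rewrite -(bnorm_map_filter e l (fun x => len x <= d k.+1) (incr (g k))).
  rewrite -(bnorm_map_filter e l (fun x => d k < len x) (fun x => incr (g k) x - incr f x)).
  have [_ g1] := g_fam k _ (fam_filter (fun x => len x <= d k.+1) lf).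
  have [g2 _] := g_fam k _ (fam_filter (fun x => d k < len x) lf).
  have : dvar e (g k) [seq x <- l | len x <= d k.+1] <= h k.
    by apply: g1 => x; rewrite mem_filter => /andP[].
  have : bnorm e [seq incr (g k) x - incr f x | x <- [seq x <- l | d k < len x]] <= h k.
    by apply: g2 => x; rewrite mem_filter => /andP[].
  by rewrite /dvar; lra.
have /choice[next nextP] : forall p : nat * nat, exists q : ((nat -> R) -> R) * nat,
    [/\ dyadic_mean p.2 q.1, (p.2 < q.2)%N,
     forall a b, (forall k, (p.2 <= k < q.2)%N -> a k = b k) -> q.1 a = q.1 b &
     forall l, fam (zeroI R) l ->
       bnorm e [seq q.1 (fun k => band_incr g d k x) | x <- l] <= h p.1].
  move=> [j p] /=; have [y yp yb] := small_band_mean Xr gM d0 d_gt0 d_half p (h_gt0 j).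
  (* Using [q.+1] makes the block boundaries strictly increasing, whence [n <= p n] and the errors
     [h k] within block [n] are at most [h n]. *)
  have [q pq yq] := dyadic_mean_support yp; exists (y, q.+1); split => //=.
  by move=> a b ab; apply: yq => k /andP[pk kq]; apply: ab; rewrite pk ltnW.
pose fix u n : ((nat -> R) -> R) * nat := if n is m.+1 then next (m.+1, (u m).2)
  else next (0%N, 0%N).
pose p n := if n is m.+1 then (u m).2 else 0%N.
pose y n := (u n).1.
have uE n : u n = next (n, p n) by case: n.
have yP n : [/\ dyadic_mean (p n) (y n), (p n < p n.+1)%N,
     forall a b, (forall k, (p n <= k < p n.+1)%N -> a k = b k) -> y n a = y n b &
     forall l, fam (zeroI R) l ->
       bnorm e [seq y n (fun k => band_incr g d k x) | x <- l] <= h n].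
  by have := nextP (n, p n); rewrite -uE.
have pn n : (n <= p n)%N.
  by elim: n => [//|n IH]; apply: leq_ltn_trans IH _; case: (yP n).
have gY k : g k \in Y by case: (gP k).
have /choice[w wP] : forall j, exists v, [/\ v \in Y, `|v| <= M &
    forall phi : VX0 e -> R, linear phi -> phi v = y j (fun k => phi (g k))].
  by move=> j; have [yj _ _ _] := yP j; exact: dyadic_mean_vector yj gY gM.
have w_pt j t : w j t = y j (fun k => g k t).
  by have [_ _ /(_ (fun g : VX0 e => g t))] := wP j; apply.
exists w, (fun j x => y j (fun k => c k x)); split; last split.
- move=> j; have [wY wM _] := wP j; split => // t; have [yj _ _ _] := yP j.
  have -> : w j t - f t = y j (fun k => g k t + - f t).
    by rewrite (dyadic_meanD (fun k => g k t) (fun=> - f t) yj) (dyadic_mean_cst _ yj) w_pt.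
  apply: (dyadic_mean_norm yj) => k pk; have [_ _ gf] := gP k.
  by rewrite (le_trans (gf t))// h_le// (leq_trans (pn j)).
- move=> j x; have [yj _ _ _] := yP j.
  by rewrite (dyadic_mean_lb yj) ?(dyadic_mean_ub yj)// => k _; have /andP[] := c01 k x.
- move=> j x; have [yj _ yq _] := yP j; have [yj1 _ _ _] := yP j.+1.
  apply: (@le_trans _ _ (c (p j.+1) x)); last first.
    by apply: (dyadic_mean_lb yj1) => k; exact: c_mono.
  (* Bounds for means ask for all indices from the start of the block, so the sequence is first cut
     off beyond the support, where [c k x] could exceed [c (p j.+1) x]. *)
  rewrite (yq _ (fun k => if (k < p j.+1)%N then c k x else 0)); last first.
    by move=> k /andP[_ ->].
  apply: (dyadic_mean_ub yj) => k _; case: ltnP => [/ltnW/c_mono//|_].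
  by have /andP[] := c01 (p j.+1) x.
- move=> j l lf; have [yj _ _ yb] := yP j.
  have -> : [seq incr (w j) x - y j (fun k => c k x) * incr f x | x <- l] =
      [seq y j (fun k => band_incr g d k x) + y j (fun k => rest k x) | x <- l].
    apply: eq_map => x; rewrite -(dyadic_meanD _ _ yj).
    have -> : (fun k => band_incr g d k x + rest k x) =
        fun k => (g k x.2 + -1 * g k x.1) + - incr f x * c k x.
      by apply/funext => k; rewrite /rest (_ : incr (g k) x = g k x.2 - g k x.1)//; ring.
    rewrite (dyadic_meanD (fun k => g k x.2 + -1 * g k x.1) (fun k => - incr f x * c k x) yj).
    rewrite (dyadic_meanD (fun k => g k x.2) (fun k => -1 * g k x.1) yj).
    rewrite (dyadic_meanZ _ (fun k => g k x.1) yj) (dyadic_meanZ _ (fun k => c k x) yj).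
    by rewrite -!w_pt /incr; ring.
  apply: (le_trans (bnorm_mapD _ _ _ _)); have := yb l lf.
  have : bnorm e [seq y j (fun k => rest k x) | x <- l] <= 2 * h j.
    apply: (le_trans (bnorm_map_mean e l rest yj)); apply: (dyadic_mean_ub yj) => k pk.
    rewrite (le_trans (rest_le k l lf))// ler_pM2l// h_le//.
    exact: leq_trans (pn j) pk.
  lra.
Qed.

Lemma monotone_weights_subseq w C (m : nat -> nat) : monotone_weights w C ->
  (forall j, (m j < m j.+1)%N) ->
  monotone_weights (w \o m) (fun j => C (m j)).
Proof.
move=> [C01 CS wC] mS; have mj j : (j <= m j)%N.
  by elim: j => [//|j IH]; exact: leq_ltn_trans IH (mS j).
split=> [j x|j x|j l lf]; first exact: C01.
- rewrite -(subnK (ltnW (mS j))); elim: (m j.+1 - m j)%N => [//|i IH].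
  by rewrite addSn; exact: le_trans IH (CS _ _).
- by rewrite (le_trans (wC _ _ lf))// ler_pM2l// h_le.
Qed.

Lemma monotone_weights_unconditional w C (th : nat -> R) N : monotone_weights w C ->
  (forall j, `|th j| <= 1) -> `|\sum_(j < N) th j *: (w j.+1 - w j)| <= M + 12.
Proof.
move=> [C01 CS wC] th1; apply: VX0_norm_le => l lf.
pose rho j x := incr (w j) x - C j x * incr f x.
pose K x := \sum_(j < N) th j * (C j.+1 x - C j x).
pose r n x := \sum_(j < n) th j * (rho j.+1 x - rho j x).
have incr_sum n x : incr (\sum_(j < n) th j *: (w j.+1 - w j) : VX0 e) x =
    \sum_(j < n) th j * (incr (w j.+1) x - incr (w j) x).
  elim: n => [|n IH]; first by rewrite !big_ord0 /incr subrr.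
  have inc (u v : VX0 e) : incr (VX0_fun (u + v)) x = incr u x + incr v x.
    by rewrite /incr -[(u + v) x.2]/(u x.2 + v x.2) -[(u + v) x.1]/(u x.1 + v x.1); lra.
  have incZ k (u v : VX0 e) : incr (VX0_fun (k *: (u - v))) x = k * (incr u x - incr v x).
    have E t : VX0_fun (k *: (u - v)) t = k * (u t - v t) by reflexivity.
    by rewrite /incr !E; lra.
  by rewrite big_ord_recr inc IH incZ [RHS]big_ord_recr.
(* The increments of the weights are nonnegative and telescope to at most 1, so the main part is [f]
   with its increments multiplied by factors in [[-1, 1]]. *)
have K1 x : `|K x| <= 1.
  apply: (@le_trans _ _ (\sum_(j < N) (C j.+1 x - C j x))).
    apply: (le_trans (ler_norm_sum _ _ _)); apply: ler_sum => j _.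
    have CjS : 0 <= C j.+1 x - C j x by rewrite subr_ge0.
    by rewrite normrM (ger0_norm CjS) ler_piMl.
  rewrite -(big_mkord xpredT (fun j => C j.+1 x - C j x)) telescope_sumr//.
  by have /andP[_] := C01 N x; have /andP[+ _] := C01 0%N x; lra.
have -> : dvar e (\sum_(j < N) th j *: (w j.+1 - w j) : VX0 e) l =
    bnorm e [seq K x * incr f x + r N x | x <- l].
  congr bnorm; apply: eq_map => x; rewrite incr_sum /K /r mulr_suml -big_split /=.
  by apply: eq_bigr => j _; rewrite /rho; ring.
apply: (le_trans (bnorm_mapD _ _ _ _)); apply: lerD.
  apply: le_trans (f_dvar lf); apply: bnorm_map_le => x _.
  by rewrite normrM ler_piMl.
(* Step [n] adds at most [3 * h n + 3 * h n.+1], which is below [12 * (h n - h n.+1)]. *)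
suff H n : bnorm e (map (r n) l) <= 12 * (1 - h n).
  by apply: (le_trans (H N)); have := h_gt0 N; lra.
elim: n => [|n IH].
  rewrite expr0 subrr mulr0 (_ : map _ _ = [seq 0 * incr f x | x <- l]); last first.
    by apply: eq_map => x; rewrite /r big_ord0 mul0r.
  by rewrite bnorm_mapZ normr0 mul0r.
rewrite (_ : map _ _ = [seq r n x + th n * (rho n.+1 x + -1 * rho n x) | x <- l]); last first.
  by apply: eq_map => x; rewrite /r big_ord_recr /= mulN1r.
apply: (le_trans (bnorm_mapD _ _ _ _)); rewrite bnorm_mapZ.
have : `|th n| * bnorm e [seq rho n.+1 x + -1 * rho n x | x <- l] <=
    bnorm e [seq rho n.+1 x + -1 * rho n x | x <- l].
  by rewrite ler_piMl// bnorm_ge0.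
have := bnorm_mapD e l (rho n.+1) (fun x => -1 * rho n x).
rewrite bnorm_mapZ normrN normr1 mul1r.
have r1 : bnorm e (map (rho n.+1) l) <= 3 * h n.+1 := wC n.+1 l lf.
have r0 : bnorm e (map (rho n) l) <= 3 * h n := wC n l lf.
move: r0 r1 IH; rewrite (hS n).
set b := bnorm e (map (rho n) l); set b1 := bnorm e (map (rho n.+1) l).
by have := h_gt0 n.+1; set B := bnorm e _; set b2 := bnorm e _; lra.
Qed.

End BlockMeans.

(** * Failure of the point of continuity property *)

Section Limits.
Context (R : realType) (X : normedModType R) (e : symmetric_basis X).
Context (Y : submodClosed (VX0 e)).
Notation I := (unit_interval R).
Notation h n := ((2^-1 : R) ^+ n).
Variables (f : I -> R) (M : R).
Hypothesis f_dvar : forall l, fam (zeroI R) l -> dvar e f l <= M.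

Lemma half_pow_small (C x : R) : 0 < x -> exists N, h N * C <= x.
Proof.
move=> x0; have [C0|C0] := leP C 0.
  by exists 0%N; rewrite (le_trans _ (ltW x0))// mulr_ge0_le0.
have : h n @[n --> \oo] --> 0 by apply: cvg_expr; rewrite gtr0_norm; lra.
move=> /cvgrPdist_le/(_ (x / C)) []; first by rewrite divr_gt0.
move=> N _ /(_ N (leqnn _)); rewrite sub0r normrN ger0_norm ?exprn_ge0// => H.
by exists N; rewrite -ler_pdivlMr.
Qed.

(** On one fixed family the variation of [f - w J] is the limit of those of [w i - w J]. A
    norm-Cauchy sequence thus converges in norm to [f], which inherits vanishing fine variation from
    [w J]. *)
Lemma uniform_limit_in_closed (w : nat -> VX0 e) :
  closed [set g : VX0 e | g \in Y] ->
  (forall j, w j \in Y /\ forall t, `|w j t - f t| <= h j) ->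
  (forall eps : R, 0 < eps -> exists J, forall i, (J <= i)%N -> `|w i - w J| <= eps) ->
  functions_of [set g : VX0 e | g \in Y] f.
Proof.
move=> Yc wP cauchy.
have near_w eps J : (forall i, (J <= i)%N -> `|w i - w J| <= eps) ->
    forall l, fam (zeroI R) l ->
    bnorm e [seq incr f x - incr (w J) x | x <- l] <= eps.
  move=> wJ l lf; apply/ler_addgt0Pr => r r0.
  have [N Nr] := half_pow_small ((size l)%:R * 2 * `|e 0%N|) r0.
  pose i := maxn N J.
  have -> : [seq incr f x - incr (w J) x | x <- l] =
      [seq incr (w i - w J : VX0 e) x + (incr f x - incr (w i) x) | x <- l].
    apply: eq_map => x.
    have E t : VX0_fun (w i - w J) t = w i t - w J t by reflexivity.
    by rewrite /incr !E; lra.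
  apply: (le_trans (bnorm_mapD _ _ _ _)); apply: lerD.
    by apply: le_trans (wJ i (leq_maxr _ _)); exact: dvar_le_VX0_norm.
  apply: (le_trans (@bnorm_map_le_size _ _ e _ l _ (2 * h i) _)).
    move=> x _; rewrite /incr.
    have -> : f x.2 - f x.1 - (w i x.2 - w i x.1) = (w i x.1 - f x.1) - (w i x.2 - f x.2) by lra.
    have [_ wi] := wP i; have := wi x.1; have := wi x.2.
    by have := ler_normB (w i x.1 - f x.1) (w i x.2 - f x.2); lra.
  apply: le_trans Nr.
  have hiN : h i <= h N by rewrite ler_wiXn2l ?leq_maxl//; lra.
  have C0 : 0 <= (size l)%:R * 2 * `|e 0%N| by rewrite !mulr_ge0.
  apply: le_trans (ler_wpM2r C0 hiN).
  by rewrite le_eqVlt; apply/orP; left; apply/eqP; ring.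
have fV : VX0_set e f.
  apply: VX0_set_fine.
  - apply/eqP; rewrite -normr_le0; apply/ler_addgt0Pr => r r0.
    have [N Nr] := half_pow_small 1 r0; have [_ /(_ (zeroI R))] := wP N.
    by have [-> _] := VX0_VX (w N); rewrite sub0r normrN; move: Nr; lra.
  - by exists M.
  - move=> eps eps0; have e20 : 0 < eps / 2 by lra.
    have [J wJ] := cauchy _ e20.
    have [d d0 wd] := dvar_fine (set_mem (VX0P (w J))) e20.
    exists d => // l lf ld.
    have -> : dvar e f l = bnorm e [seq (incr f x - incr (w J) x) + incr (w J) x | x <- l].
      by congr bnorm; apply: eq_map => x; rewrite subrK.
    apply: (le_trans (bnorm_mapD _ _ _ _)).
    by have := near_w _ _ wJ l lf; have := wd l lf ld; rewrite /dvar; lra.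
pose F := MkVX0 (mem_set fV).
exists F => //; apply: Yc => B /nbhs_ballP[r /= r0 rB].
have r20 : 0 < r / 2 by lra.
have [J wJ] := cauchy _ r20.
exists (w J); split; first exact: (wP J).1.
apply: rB; rewrite -ball_normE /=; apply: (@le_lt_trans _ _ (r / 2)); last by lra.
apply: VX0_norm_le => l lf; rewrite (_ : dvar _ _ _ =
  bnorm e [seq incr f x - incr (w J) x | x <- l]); first exact: near_w.
congr bnorm; apply: eq_map => x.
have E t : VX0_fun (F - w J) t = f t - w J t by reflexivity.
by rewrite /incr !E; lra.
Qed.

End Limits.

Section PCPFails.
Context (R : realType) (X : normedModType R) (e : symmetric_basis X).
Context (Y : submodClosed (VX0 e)).
Notation I := (unit_interval R).
Notation E := (subspace_of Y).

(** The norm is a supremum over families of quantities that depend continuously on finitely many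
    point evaluations, hence weakly lower semicontinuous. *)
Lemma unit_ball_weakly_closed (D : set E) : (forall g, D g -> `|g| <= 1) ->
  forall g, @closure (weak E) D g -> `|g| <= 1.
Proof.
move=> D1 g gD; rewrite subspace_normE; apply: VX0_norm_le => l lf.
have e0 := norm_basis_gt0 e.
apply/ler_addgt0Pr => r r0.
have s0 : 0 < (size l).+1%:R :> R by rewrite ltr0n.
pose tau := r / (2 * (size l).+1%:R * `|e 0%N|).
have tau0 : 0 < tau by rewrite divr_gt0// !mulr_gt0.
pose P := map fst l ++ map snd l.
have : nbhs (g : weak E) [set k : E | forall p, p \in P -> `|sfun k p - sfun g p| < tau].
  apply: open_nbhs_nbhs; split; first exact: weak_open_pts.
  by move=> p _; rewrite subrr normr0.
move=> /gD[k [/D1 k1 kP]].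
have k_le : dvar e (sfun k) l <= 1.
  by apply: le_trans k1; exact: (dvar_le_VX0_norm (subspace_val k) lf).
have g_le : dvar e (sfun g) l <= dvar e (sfun k) l + (size l)%:R * (2 * tau) * `|e 0%N|.
  apply: dvar_near => z zl; split; apply: ltW; apply: kP; rewrite mem_cat.
    by rewrite (map_f fst zl).
  by rewrite (map_f snd zl) orbT.
have C_le : (size l)%:R * (2 * tau) * `|e 0%N| <= r.
  have -> : (size l)%:R * (2 * tau) * `|e 0%N| = ((size l)%:R / (size l).+1%:R) * r.
    by rewrite /tau; field; rewrite !gt_eqF.
  by rewrite ler_piMl ?(ltW r0)// ler_pdivrMr// mul1r ler_nat.
rewrite -[dvar e _ l]/(dvar e (sfun g) l); move: C_le g_le; set C := _ * _ * _; lra.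
Qed.

(* The finite sums of the dd n with coefficients in [-1, 1] form a bounded set
   each point x of which is a weak limit of points x + dd n at distance r. *)
Lemma PCP_fails (dd : nat -> E) (r : R) : 0 < r ->
  (forall n, r <= `|dd n|) ->
  (forall (th : nat -> R) N, (forall j, `|th j| <= 1) -> `|\sum_(j < N) th j *: dd j| <= 1) ->
  ~ PCP_space E.
Proof.
move=> r0 ddr dd1 pcp.
pose D : set E := [set g | exists (th : nat -> R) N, [/\ forall j, `|th j| <= 1,
  forall j, (N <= j)%N -> th j = 0 & g = \sum_(j < N) th j *: dd j]].
have D1 g : D g -> `|g| <= 1 by move=> [th [N [th1 _ ->]]]; exact: dd1.
(* PCP is tested on weakly closed sets; a weakly open set that meets the closure already meets
   [D]. *)
pose A := @closure (weak E) D.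
have A1 : A `<=` [set g : E | `|g| <= 1] by exact: unit_ball_weakly_closed.
have DA : D `<=` A by exact: (@subset_closure (weak E) D).
have A0 : A !=set0.
  exists 0; apply: DA; exists (fun=> 0), 0%N; split => //.
    by move=> j; rewrite normr0.
  by rewrite big_ord0.
have [U [Uo [a [Aa Ua]] dU]] := pcp A A1 A0 (@closed_closure (weak E) D) r r0.
have [x [[th [N [th1 thN xE]]] Ux]] : exists x, D x /\ U x.
  by have [x [Dx Ux]] := Aa U (open_nbhs_nbhs (conj Uo Ua)); exists x.
have x_ext k : x = \sum_(j < k + N) th j *: dd j.
  elim: k => [//|k IH]; rewrite addSn big_ord_recr /= -IH thN ?leq_addl//.
  by rewrite scale0r addr0.
(* Choosing the coefficients as the signs of [phi (dd j)] bounds the sum of the absolute values by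
   [opnorm phi], so the terms tend to 0. *)
have dd_weak (phi : dual E) : phi (dd n) @[n --> \oo] --> (0 : R).
  pose u n := `|phi (dd n)|.
  have u_le n : series u n <= opnorm phi.
    pose s j : R := (-1) ^+ (phi (dd j) < 0)%R.
    have s1 j : `|s j| <= 1 by rewrite /s normr_sign.
    have -> : series u n = phi (\sum_(j < n) s j *: dd j).
      rewrite /series/= big_mkord linear_sum; apply: eq_bigr => j _.
      by rewrite /u normrEsign; apply/esym; exact: dual_appZ.
    by rewrite (le_trans (ler_norm _))// opnorm_ge// dd1.
  have uc : cvgn (series u).
    apply: nondecreasing_is_cvgn; first by apply/nondecreasing_seqP => n;
      rewrite seriesSr lerDl normr_ge0.
    by exists (opnorm phi) => _ [n _ <-].
  by apply/norm_cvg0P; exact: cvg_series_cvg_0 uc.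
have xdd_weak : x + dd n @[n --> \oo] --> (x : weak E).
  apply: weak_cvg => phi.
  rewrite -[X in _ --> X]addr0.
  rewrite (_ : (fun n => _) = fun n => phi x + phi (dd n)); last first.
    by apply/funext => n; rewrite dual_appD.
  by apply: cvgD => //; exact: cvg_cst.
have [n0 _ Un] : \forall n \near \oo, U (x + dd n).
  exact: xdd_weak U (open_nbhs_nbhs (conj Uo Ux)).
(* Beyond [N] the coefficients of [x] are 0, so coefficient [n] is free to be set to 1 and
   [x + dd n] stays in [D]. *)
pose n := maxn n0 N.
have Un0 : U (x + dd n) by apply: Un; rewrite /= leq_maxl.
have Dn : D (x + dd n).
  pose th' j := if j == n then 1 else th j.
  exists th', n.+1; split.
  - by move=> j; rewrite /th'; case: eqP => // _; rewrite normr1.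
  - move=> j nj; rewrite /th' gtn_eqF// thN//.
    by rewrite (leq_trans _ (ltnW nj))// leq_maxr.
  rewrite big_ord_recr /= /th' eqxx scale1r; congr (_ + _).
  have -> : x = \sum_(j < n) th j *: dd j.
    by rewrite [LHS](x_ext (n - N)%N) (subnK (leq_maxr n0 N)).
  by apply: eq_bigr => j _; rewrite ltn_eqF.
have : (`|x + dd n - x|%:E <= diameter (A `&` U))%E.
  apply: ereal_sup_ubound; exists (x + dd n, x) => //=; split; split => //.
    exact: DA.
  by apply: DA; exists th, N.
rewrite addrAC subrr add0r => /le_lt_trans/(_ dU).
by rewrite lte_fin ltNge ddr.
Qed.

End PCPFails.

Section PCPNecessary.
Context (R : realType) (X : normedModType R) (e : symmetric_basis X).
Context (Y : submodClosed (VX0 e)).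
Notation I := (unit_interval R).
Notation E := (subspace_of Y).

Lemma PCP_no_continuous_limit (f : I -> R) : reflexive_space X ->
  closed [set g : VX0 e | g \in Y] -> PCP_space E ->
  weak_star_closure [set g : VX0 e | g \in Y] f -> continuous f ->
  functions_of [set g : VX0 e | g \in Y] f.
Proof.
move=> Xr Yc pcp [F FY Ff] fc; apply: contrapT => fY.
pose M := opnorm F + 1.
have interp (T : seq I) : exists g : VX0 e,
    [/\ g \in Y, `|g| <= M & forall t, t \in T -> g t = f t].
  have [g [gY gM gT]] := helly FY (map (@delta _ _ e) T).
  by exists g; split => // t tT; rewrite -Ff /bidual_function gT ?map_f.
have f_dvar := interpolated_dvar_le interp.
have [q [q1 qd]] := unit_interval_dense_sequence R.
have approx := uniform_approximation Xr fc interp q1 qd.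
have [w [C [wP wC]]] := monotone_weights_exist Xr approx.
have [eps eps0 far] : exists2 eps : R, 0 < eps &
    forall J, exists i, (J <= i)%N /\ eps < `|w i - w J|.
  apply: contrapT => H; apply: fY; apply: (uniform_limit_in_closed f_dvar Yc (w := w)).
    by move=> j; have [] := wP j.
  move=> eps eps0; apply: contrapT => /forallNP H1; apply: H; exists eps => // J.
  apply: contrapT => /forallNP H2; apply: (H1 J) => i Ji; rewrite leNgt.
  by apply/negP => wi; apply: (H2 i).
have /choice[next nextP] := far.
pose fix m n := if n is k.+1 then next (m k) else 0%N.
have mS j : (m j < m j.+1)%N.
  have [le_m far_m] := nextP (m j); rewrite /= ltn_neqAle le_m andbT.
  by apply/eqP => mE; move: far_m; rewrite -mE subrr normr0 ltNge ltW.
have wmC := monotone_weights_subseq wC mS.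
(* The bound on the unconditional sums; dividing by it brings them into the unit ball and leaves
   differences of norm at least [eps / L]. *)
pose L := M + 12.
have L0 : 0 < L.
  have [_ + _] := wP 0%N; have := normr_ge0 (w 0%N); rewrite /L; lra.
have ddY n : L^-1 *: (w (m n.+1) - w (m n)) \in Y.
  by rewrite rpredZ// submod_rpredB//; [have [] := wP (m n.+1)|have [] := wP (m n)].
pose dd n : E := SubspaceOf (ddY n).
apply: (@PCP_fails _ _ e Y dd (eps / L)) => //.
- by rewrite divr_gt0.
- move=> n; rewrite subspace_normE normrZ gtr0_norm ?invr_gt0// mulrC.
  by rewrite ler_pM2l ?invr_gt0// ltW// (nextP (m n)).2.
- move=> th N th1; rewrite subspace_normE.
  have -> : subspace_val (\sum_(j < N) th j *: dd j) =
      L^-1 *: \sum_(j < N) th j *: ((w \o m) j.+1 - (w \o m) j).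
    elim: N => [|N IH]; first by rewrite !big_ord0 scaler0.
    have valD (a b : E) : subspace_val (a + b) = subspace_val a + subspace_val b by reflexivity.
    have valZ k (a : E) : subspace_val (k *: a) = k *: subspace_val a by reflexivity.
    rewrite big_ord_recr valD IH valZ [in RHS]big_ord_recr scalerDr; congr (_ + _).
    by rewrite /= !scalerA mulrC.
  rewrite normrZ gtr0_norm ?invr_gt0// ler_pdivrMl// mulr1.
  exact: (monotone_weights_unconditional f_dvar N wmC th1).
Qed.

End PCPNecessary.

Theorem theoremI (R : realType) (X : completeNormedModType R)
    (e : symmetric_basis X) (Y : submodClosed (VX0 e)) :
  reflexive_space X -> closed [set f : VX0 e | f \in Y] ->
  (PCP_space (subspace_of Y) <->
   (weak_star_closure [set f : VX0 e | f \in Y]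
      `\` functions_of [set f : VX0 e | f \in Y]) `&` @C01 R = set0).
Proof.
move=> Xr Yc; split; last exact: PCP_of_no_continuous_limit.
move=> pcp; apply/seteqP; split => // f [[fF fY] fC].
exact: fY (PCP_no_continuous_limit Xr Yc pcp fF fC).
Qed.
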